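(* For any sequence of positive integers $A=(a_1\le\cdots\le a_n)$ there exists a surjective morphism of varieties $\mathrm{sh}^{(n)}\to\mathrm{sh}_A$.
   Context: Fusion products. Let $e,h,f$ be the standard basis of $\mathfrak{sl}_2(\mathbb C)$ and write $x_j=x\otimes t^j$. For positive integers $A=(a_1,\ldots,a_n)$ choose pairwise distinct $z_1,\ldots,z_n\in\mathbb C$, let $\mathbb C^{a}$ be the $a$-dimensional irreducible $\mathfrak{sl}_2$-module, and $\mathbb C^{a_i}(z_i)$ the $\mathfrak{sl}_2\otimes\mathbb C[t]$-module on which $x_j$ acts as $z_i^jx$. Let $\overline{v_A}\in\bigotimes_i\mathbb C^{a_i}(z_i)$ be the tensor product of lowest weight vectors and $F_s$ the span of all $x^{(1)}_{i_1}\cdots x^{(k)}_{i_k}\overline{v_A}$ with $x^{(j)}\in\mathfrak{sl}_2$, $i_1+\cdots+i_k\le s$. The fusion product is the associated graded $\mathfrak{sl}_2\otimes\mathbb C[t]$-module $M^A=\bigoplus_sF_s/F_{s-1}$, with $v_A$ the image of $\overline{v_A}$. Known facts: up to isomorphism $M^A$ is independent of the $z_i$ and of the order of the $a_i$; $\mathfrak{sl}_2\otimes t^j$ acts by $0$ for $j\ge n$; $M^A=\mathbb C[e_0,\ldots,e_{n-1}]v_A\simeq\mathbb C[e_0,\ldots,e_{n-1}]/I_A$ with $I_A$ generated by $\sum_{i_1+\cdots+i_k=s}e_{n-1-i_1}\cdots e_{n-1-i_k}$ for $k\ge1$, $s<\sum_{j=1}^n\max(k+1-a_j,0)$; $\dim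 M^A=\prod a_i$. Schubert variety. $\mathrm G=SL_2(\mathbb C[t]/t^n)$ acts on $M^A$ and on $\mathbb P(M^A)$; $[v]$ denotes the line $\mathbb Cv$; $\mathrm{sh}_A=\overline{\mathrm G\cdot[v_A]}\subset\mathbb P(M^A)$. For $2\le b_1<\cdots<b_n$ the variety $\mathrm{sh}_{(b_1,\ldots,b_n)}$ depends, up to isomorphism, only on $n$ and is denoted $\mathrm{sh}^{(n)}$. *)

(* Defs.v *)
From HB Require Import structures.
From mathcomp Require Import all_boot all_order all_algebra.
From mathcomp Require Import boolp reals.
From mathcomp Require Import complex.
From mathcomp Require Import mpoly.

Set Implicit Arguments.
Unset Strict Implicit.
Unset Printing Implicit Defensive.

Import GRing.Theory.
Local Open Scope ring_scope.

Definition sl2 (C : fieldType) := {x : 'M[C]_2 | \tr x == 0}.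

Fact sl2_e_subproof (C : fieldType) : \tr (delta_mx 0 1 : 'M[C]_2) == 0.
Proof. by rewrite /mxtrace big_ord_recl big_ord1 !mxE /= addr0. Qed.

Fact sl2_f_subproof (C : fieldType) : \tr (delta_mx 1 0 : 'M[C]_2) == 0.
Proof. by rewrite /mxtrace big_ord_recl big_ord1 !mxE /= addr0. Qed.

Definition sl2_e (C : fieldType) : sl2 C :=
  exist (fun x : 'M[C]_2 => \tr x == 0) _ (sl2_e_subproof C).
Definition sl2_f (C : fieldType) : sl2 C :=
  exist (fun x : 'M[C]_2 => \tr x == 0) _ (sl2_f_subproof C).

(* The irreducible module C^a has a basis u_0, ..., u_(a-1) with              *)
(*   e u_l = u_(l+1), f u_l = l (a - l) u_(l-1), h u_l = (2 l - (a - 1)) u_l. *)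
(* Its lowest weight vector is u_0.  The entry (k, l) of sl2_irr a x is the   *)
(* coefficient of u_k in x u_l.                                               *)
Definition sl2_irr (C : fieldType) (a : nat) (x : sl2 C) : 'M[C]_a :=
  \matrix_(k, l)
    (val x 0 1 * (k == l.+1 :> nat)%:R
     + val x 1 0 * (l * (a - l))%:R * (l == k.+1 :> nat)%:R
     + val x 0 0 * ((2 * l)%:R - a.-1%:R) * (k == l)%:R).

(* The tensor product of the C^(a_i), in the coordinates given by the basis   *)
(* of tensors of the u_(k i), for k in the product of the 'I_(a_i).           *)
Definition tensor (C : fieldType) (n : nat) (a : 'I_n -> nat) : vectType C :=
  {ffun {dffun forall i : 'I_n, 'I_(a i)} -> C^o}.

Definition tensor_factor_act (C : fieldType) (n : nat) (a : 'I_n -> nat)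
    (i : 'I_n) (x : sl2 C) (u : tensor C a) : tensor C a :=
  [ffun k : {dffun forall i' : 'I_n, 'I_(a i')} =>
    \sum_(l : {dffun forall i' : 'I_n, 'I_(a i')}
           | [forall i', (i' != i) ==> (l i' == k i')])
      sl2_irr (a i) x (k i) (l i) * u l].

(* the action of x tensor t^j on the tensor product of the C^(a_i)(z_i) *)
Definition tensor_act (C : fieldType) (n : nat) (a : 'I_n -> nat)
    (z : 'I_n -> C) (x : sl2 C) (j : nat) (u : tensor C a) : tensor C a :=
  \sum_(i < n) z i ^+ j *: tensor_factor_act i x u.

Definition tensor_lowest (C : fieldType) (n : nat) (a : 'I_n -> nat) :
    tensor C a :=
  [ffun k : {dffun forall i : 'I_n, 'I_(a i)} =>
     [forall i, k i == 0 :> nat]%:R].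

(* The word [:: (x1, i1); ...; (xk, ik)] stands for the monomial              *)
(* (x1 t^i1) ... (xk t^ik) in U(sl_2 tensor C[t]).                            *)
Definition tensor_word (C : fieldType) (n : nat) (a : 'I_n -> nat)
    (z : 'I_n -> C) (w : seq (sl2 C * nat)) : tensor C a :=
  foldr (fun xj u => tensor_act z xj.1 xj.2 u) (tensor_lowest C a) w.

Definition word_degree (C : fieldType) (w : seq (sl2 C * nat)) : nat :=
  sumn (map snd w).

(* membership in F_s *)
Definition fusion_filtration (C : fieldType) (n : nat) (a : 'I_n -> nat)
    (z : 'I_n -> C) (s : nat) (u : tensor C a) : Prop :=
  exists2 ws : seq (seq (sl2 C * nat)),
    all (fun w => word_degree w <= s)%N ws
    & u \in <<[seq tensor_word a z w | w <- ws]>>%VS.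

(* membership in F_(s - 1), with F_(-1) = 0 *)
Definition fusion_filtration_pred (C : fieldType) (n : nat) (a : 'I_n -> nat)
    (z : 'I_n -> C) (s : nat) (u : tensor C a) : Prop :=
  if s is s'.+1 then fusion_filtration z s' u else u = 0.

(* The associated graded module of the filtration: fus_mod is the direct sum  *)
(* of the images of the F_s under fus_gr s, which has kernel F_(s - 1) on F_s *)
(* and so identifies its image with F_s / F_(s - 1).  The values of fus_gr s  *)
(* outside F_s carry no information.  The structure is thus determined by C,  *)
(* a and z up to a unique isomorphism; it exists by fusion_inhabited below.   *)
Record fusion (C : fieldType) (n : nat) (a : 'I_n -> nat) (z : 'I_n -> C) :=
  Fusion {
  fus_mod : vectType C;
  fus_gr : nat -> 'Hom(tensor C a, fus_mod);
  fus_gr_ker : forall s u, fusion_filtration z s u ->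
    (fus_gr s u = 0 <-> fusion_filtration_pred z s u);
  fus_gr_span : forall m : fus_mod,
    exists (N : nat) (u : 'I_N -> tensor C a),
      (forall s : 'I_N, fusion_filtration z s (u s)) /\ m = \sum_(s < N) fus_gr s (u s);
  fus_gr_direct : forall (N : nat) (u : 'I_N -> tensor C a),
    (forall s : 'I_N, fusion_filtration z s (u s)) ->
    \sum_(s < N) fus_gr s (u s) = 0 -> forall s : 'I_N, fus_gr s (u s) = 0;
  fus_act : sl2 C -> nat -> 'End(fus_mod);
  fus_act_gr : forall x j s u, fusion_filtration z s u ->
    fus_act x j (fus_gr s u) = fus_gr (j + s)%N (tensor_act z x j u)
}.

Definition fus_lowest (C : fieldType) (n : nat) (a : 'I_n -> nat)
    (z : 'I_n -> C) (M : fusion a z) : fus_mod M :=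
  fus_gr M 0 (tensor_lowest C a).

Notation truncpoly C n := {poly %/ ('X^n : {poly C})}.

(* x tensor p for p in C[t]/t^n; the elements of sl_2 tensor t^j with         *)
(* j >= n act by 0 on the fusion product.                                     *)
Definition current_act (C : fieldType) (n : nat) (a : 'I_n -> nat)
    (z : 'I_n -> C) (M : fusion a z) (x : sl2 C) (p : truncpoly C n) :
    'End(fus_mod M) :=
  \sum_(j < n) (p : {poly C})`_j *: fus_act M x j.

(* The exponential of a nilpotent endomorphism, whose powers vanish from the  *)
(* dimension of the space on.                                                 *)
Definition nilp_exp (C : fieldType) (V : vectType C) (T : 'End(V)) (v : V) : V :=
  \sum_(k < \dim {:V}) (k`!%:R)^-1 *: iter k T v.

Definition upper_unip (A : comNzRingType) (p : A) : 'M[A]_2 :=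
  1%:M + p *: delta_mx 0 1.

Definition lower_unip (A : comNzRingType) (p : A) : 'M[A]_2 :=
  1%:M + p *: delta_mx 1 0.

(* SL2_act g v w: the element g of SL_2(C[t]/t^n) maps v to w.  This is the   *)
(* graph of the action integrating that of sl_2 tensor C[t]/t^n, namely the   *)
(* one where exp(e p) and exp(f p) act by the exponentials of the actions of  *)
(* e p and f p; these elements generate SL_2(C[t]/t^n), see SL2_act_total and *)
(* SL2_act_integrates below.                                                  *)
Inductive SL2_act (C : fieldType) (n : nat) (a : 'I_n -> nat) (z : 'I_n -> C)
    (M : fusion a z) : 'M[truncpoly C n]_2 -> fus_mod M -> fus_mod M -> Prop :=
| SL2_act1 v : SL2_act 1%:M v v
| SL2_act_e p g v w : SL2_act g v w ->
    SL2_act (upper_unip p *m g) v (nilp_exp (current_act M (sl2_e C) p) w)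
| SL2_act_f p g v w : SL2_act g v w ->
    SL2_act (lower_unip p *m g) v (nilp_exp (current_act M (sl2_f C) p) w).

Definition proj (C : fieldType) (V : vectType C) :=
  {L : {vspace V} | \dim L == 1%N}.

Definition coords (C : fieldType) (V : vectType C) (v : V) : 'I_(\dim {:V}) -> C :=
  fun i => coord (vbasis {:V}) i v.

Definition vanishes_at (C : fieldType) (V : vectType C)
    (p : {mpoly C[\dim {:V}]}) (L : proj V) : Prop :=
  forall v, v \in val L -> p.@[coords v] = 0.

Definition zariski_closure (C : fieldType) (V : vectType C)
    (S : proj V -> Prop) : proj V -> Prop :=
  fun L => forall (d : nat) (p : {mpoly C[\dim {:V}]}), p \is d.-homog ->
    (forall L', S L' -> vanishes_at p L') -> vanishes_at p L.

(* phi is given, in a neighbourhood of every point, by homogeneous            *)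
(* polynomials q_i of a common degree without common zero at that point.      *)
Definition is_morphism (C : fieldType) (V W : vectType C)
    (X : proj V -> Prop) (Y : proj W -> Prop)
    (phi : {L | X L} -> {L | Y L}) : Prop :=
  forall L0 : {L | X L},
  exists (d : nat) (q : 'I_(\dim {:W}) -> {mpoly C[\dim {:V}]}),
  [/\ forall i, q i \is d.-homog,
      exists i, ~ vanishes_at (q i) (sval L0)
    & forall (L : {L | X L}) (v : V), v \in val (sval L) ->
        (exists i, (q i).@[coords v] != 0) ->
        val (sval (phi L))
          = <[\sum_i (q i).@[coords v] *: (vbasis {:W})`_i]>%VS].

Definition lowest_orbit (C : fieldType) (n : nat) (a : 'I_n -> nat)
    (z : 'I_n -> C) (M : fusion a z) (L : proj (fus_mod M)) : Prop :=
  exists (g : 'M[truncpoly C n]_2) (w : fus_mod M),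
    [/\ \det g = 1, SL2_act g (fus_lowest M) w & val L = <[w]>%VS].

Definition schubert (C : fieldType) (n : nat) (a : 'I_n -> nat)
    (z : 'I_n -> C) (M : fusion a z) : proj (fus_mod M) -> Prop :=
  zariski_closure (@lowest_orbit C n a z M).

Arguments schubert {C n a z} M L.

Lemma tensor_act_linear (C : fieldType) (n : nat) (a : 'I_n -> nat)
  (z : 'I_n -> C) (x : sl2 C) (j : nat) : linear (@tensor_act C n a z x j).
Proof.
move=> c u v; rewrite /tensor_act scaler_sumr -big_split /=.
apply: eq_bigr => i _; rewrite scalerA mulrC -scalerA -scalerDr; congr (_ *: _).
apply/ffunP => k; rewrite !ffunE scaler_sumr -big_split /=.
by apply: eq_bigr => l _; rewrite !ffunE mulrDr mulrCA.
Qed.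

HB.instance Definition _ (C : fieldType) (n : nat) (a : 'I_n -> nat)
    (z : 'I_n -> C) (x : sl2 C) (j : nat) :=
  GRing.isLinear.Build C (tensor C a) (tensor C a) _ (@tensor_act C n a z x j)
    (@tensor_act_linear C n a z x j).

Lemma fusion_filtration_leq (C : fieldType) (n : nat) (a : 'I_n -> nat)
    (z : 'I_n -> C) (s s' : nat) (u : tensor C a) :
  (s <= s')%N -> fusion_filtration z s u -> fusion_filtration z s' u.
Proof.
move=> ss' [ws /allP wss uws]; exists ws => //; apply/allP => w /wss ws1.
exact: leq_trans ws1 ss'.
Qed.

Lemma fusion_filtration_space (C : fieldType) (n : nat) (a : 'I_n -> nat)
    (z : 'I_n -> C) (s : nat) :
  exists U : {vspace tensor C a}, forall u, u \in U <-> fusion_filtration z s u.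
Proof.
pose P d := `[< exists2 ws : seq (seq (sl2 C * nat)),
    all (fun w => word_degree w <= s)%N ws
    & \dim <<[seq tensor_word a z w | w <- ws]>>%VS = d >].
have exP : exists d, P d.
  exists (\dim (<<[::]>>%VS : {vspace tensor C a})).
  by apply/asboolP; exists [::].
have leP d : P d -> (d <= \dim {:tensor C a})%N.
  by move=> /asboolP[ws _ <-]; rewrite dimvS ?subvf.
case: (ex_maxnP exP leP) => d /asboolP[ws wss dws] dmax.
exists <<[seq tensor_word a z w | w <- ws]>>%VS => u; split; first by exists ws.
move=> [ws' wss' uws'].
suff /eqP -> : (<<[seq tensor_word a z w | w <- ws]>>
    == <<[seq tensor_word a z w | w <- ws ++ ws']>>)%VS.
  by rewrite map_cat span_cat; apply: subvP (addvSr _ _) _ uws'.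
rewrite eqEdim map_cat span_cat addvSl /= dws -span_cat -map_cat.
by apply: dmax; apply/asboolP; exists (ws ++ ws'); rewrite // all_cat wss.
Qed.

Lemma tensor_act_filtration (C : fieldType) (n : nat) (a : 'I_n -> nat)
    (z : 'I_n -> C) (x : sl2 C) (j s : nat) (u : tensor C a) :
  fusion_filtration z s u -> fusion_filtration z (j + s) (tensor_act z x j u).
Proof.
move=> [ws /allP wss uws]; exists [seq (x, j) :: w | w <- ws].
  rewrite all_map; apply/allP => w /wss ws1 /=.
  by rewrite /word_degree /= leq_add2l.
have -> : [seq tensor_word a z w | w <- [seq (x, j) :: w | w <- ws]]
    = map (linfun (tensor_act z x j)) [seq tensor_word a z w | w <- ws].
  by rewrite -!map_comp; apply: eq_map => w /=; rewrite lfunE.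
by rewrite -limg_span -(lfunE (tensor_act z x j)) memv_img.
Qed.

Lemma fusion_inhabited (C : fieldType) (n : nat) (a : 'I_n -> nat)
  (z : 'I_n -> C) : inhabited (fusion a z).
Proof.
have [F FP] := choice (@fusion_filtration_space C n a z).
have Fmono s s' : (s <= s')%N -> (F s <= F s')%VS.
  by move=> ss'; apply/subvP => u /FP uF; apply/FP; apply: fusion_filtration_leq ss' uF.
have [N FN] : exists N, forall s, (N <= s)%N -> F s = F N.
  have exd : exists d, `[< exists s, \dim (F s) = d >].
    by exists (\dim (F 0%N)); apply/asboolP; exists 0%N.
  have led d : `[< exists s, \dim (F s) = d >] -> (d <= \dim {:tensor C a})%N.
    by move=> /asboolP[s <-]; rewrite dimvS ?subvf.
  case: (ex_maxnP exd led) => _ /asboolP[N <-] Nmax; exists N => s Ns.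
  apply/eqP; rewrite eq_sym eqEdim Fmono //=.
  by apply: Nmax; apply/asboolP; exists s.
pose G s : {vspace tensor C a} := if s is s'.+1 then F s' else 0%VS.
have GP s u : u \in G s <-> fusion_filtration_pred z s u.
  by case: s => [|s] /=; [rewrite memv0; split=> [/eqP|->] | exact: FP].
have GF s : (G s <= F s)%VS by case: s => [|s]; rewrite ?sub0v //= Fmono.
pose W : vectType C := {ffun 'I_N.+1 -> tensor C a}.
pose inj (s : nat) (u : tensor C a) : W :=
  [ffun i : 'I_N.+1 => if i == s :> nat then addv_pi1 (F s) (G s) u else 0].
have inj_lin s : linear (inj s).
  move=> c u v; apply/ffunP => i; rewrite !ffunE; case: ifP => _.
    by rewrite linearP.
  by rewrite scaler0 addr0.
pose injL s : 'Hom(tensor C a, W) := linfun (HB.pack_for {linear _ -> _} (inj s)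
   (GRing.isLinear.Build C (tensor C a) W _ (inj s) (inj_lin s))).
have injE s u : injL s u = inj s u by rewrite lfunE.
pose K : {vspace W} := (\sum_(i < N.+1) limg (injL i))%VS.
have injK s u : injL s u \in K.
  case: (ltnP s N.+1) => sN.
    by apply: subvP (memv_img _ (memvf u)); apply: (sumv_sup (Ordinal sN)).
  suff -> : injL s u = 0 by rewrite mem0v.
  rewrite injE; apply/ffunP => i; rewrite !ffunE; case: eqP => // is_.
  by move: (ltn_ord i); rewrite is_ ltnNge sN.
pose gr s : 'Hom(tensor C a, subvs_of K) := (linfun (vsproj K) \o injL s)%VF.
have grE s u : vsval (gr s u) = inj s u.
  by rewrite lfunE /= lfunE /= vsprojK ?injK.
have pi_split s u : u \in F s ->
    addv_pi1 (F s) (G s) u + addv_pi2 (F s) (G s) u = u.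
  by move=> uF; rewrite addv_pi1_pi2 // (subvP (addvSl _ _)).
have pi1G s u : u \in G s -> addv_pi1 (F s) (G s) u = 0.
  move=> uG; have uF := subvP (GF s) _ uG.
  have := pi_split _ _ uF; rewrite addv_pi2_id // => h.
  by apply: (addIr u); rewrite h add0r.
have gr0 s u : u \in G s -> gr s u = 0.
  move=> uG; apply: val_inj; rewrite /= grE; apply/ffunP => i.
  by rewrite !ffunE pi1G // if_same.
have grbig s u : (N < s)%N -> gr s u = 0.
  move=> Ns; apply: val_inj; rewrite /= grE; apply/ffunP => i; rewrite !ffunE.
  by case: eqP => // is_; move: (ltn_ord i); rewrite is_ ltnS leqNgt Ns.
have gr_ker s u : fusion_filtration z s u ->
    gr s u = 0 <-> fusion_filtration_pred z s u.
  move=> /FP uF; split=> [gru|/GP]; last exact: gr0.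
  apply/GP; case: (ltnP N s) => [Ns|sN].
    case: s Ns uF {gru} => // s; rewrite ltnS => Ns /=.
    by rewrite FN ?(FN s) // (leq_trans Ns).
  have := congr1 (fun f : W => f (Ordinal (sN : (s < N.+1)%N))) (grE s u).
  rewrite gru !ffunE eqxx => /esym pi1_0.
  by rewrite -(pi_split _ _ uF) pi1_0 add0r memv_pi2.
have gr_pi s v : gr s (addv_pi1 (F s) (G s) v) = gr s v.
  apply: val_inj; rewrite /= !grE; apply/ffunP => i; rewrite !ffunE.
  by rewrite addv_pi1_proj.
have gr_span (m : subvs_of K) : exists (M : nat) (u : 'I_M -> tensor C a),
    (forall s : 'I_M, fusion_filtration z s (u s)) /\
    m = \sum_(s < M) gr s (u s).
  have /memv_sumP[f fP mE] := subvsP m.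
  have /choice[u uE] (i : 'I_N.+1) : exists u, injL i u = f i.
    by have /memv_imgP[u _ ->] := fP i isT; exists u.
  exists N.+1, (fun i : 'I_N.+1 => addv_pi1 (F i) (G i) (u i)); split=> [i|].
    by apply/FP; rewrite memv_pi1.
  apply: val_inj; rewrite /= mE raddf_sum /=; apply: eq_bigr => i _.
  by rewrite gr_pi grE -injE uE.
have gr_direct (M : nat) (u : 'I_M -> tensor C a) :
    (forall s : 'I_M, fusion_filtration z s (u s)) ->
    \sum_(s < M) gr s (u s) = 0 -> forall s : 'I_M, gr s (u s) = 0.
  move=> _ /(congr1 vsval); rewrite raddf_sum raddf0 /= => sum0 s.
  case: (ltnP N s) => [/grbig -> //|sN].
  have := congr1 (fun f : W => f (Ordinal (sN : (s < N.+1)%N))) sum0.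
  rewrite sum_ffunE ffunE (bigD1 s) //= grE ffunE eqxx big1 ?addr0 => [pi0|i iNs].
    by rewrite -gr_pi pi0 linear0.
  by rewrite grE ffunE; case: eqP => // si; case/eqP: iNs; apply: val_inj; rewrite /= -si.
pose act x j (m : subvs_of K) : subvs_of K :=
  \sum_(i < N.+1) gr (j + i)%N (tensor_act z x j (vsval m i)).
have act_lin x j : linear (act x j).
  move=> c m m'; rewrite /act scaler_sumr -big_split /=; apply: eq_bigr => i _.
  by rewrite !ffunE !linearP.
pose actL x j : 'End(subvs_of K) := linfun (HB.pack_for {linear _ -> _} (act x j)
   (GRing.isLinear.Build C (subvs_of K) (subvs_of K) _ (act x j) (act_lin x j))).
have act_gr x j s u : fusion_filtration z s u ->
    actL x j (gr s u) = gr (j + s)%N (tensor_act z x j u).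
  move=> uF; rewrite lfunE /= /act; case: (ltnP N s) => [Ns|sN].
    rewrite (grbig (j + s)%N) ?(leq_trans Ns) ?leq_addl //.
    by rewrite grbig // big1 // => i _; rewrite ffunE !linear0.
  rewrite (bigD1 (Ordinal (sN : (s < N.+1)%N))) //= big1 ?addr0 => [|i iNs].
    rewrite grE ffunE eqxx -{2}(pi_split s u); last exact/FP.
    rewrite !linearD /= (_ : gr _ (tensor_act z x j (addv_pi2 _ _ _)) = 0) ?addr0 //.
    have /GP := memv_pi2 (F s) (G s) u; case: s {uF sN} => [/= ->|s /= pF].
      by rewrite !linear0.
    by apply: gr0; rewrite addnS /=; apply/FP/tensor_act_filtration.
  rewrite grE ffunE; case: eqP => [is_|_]; last by rewrite !linear0.
  by case/eqP: iNs; apply: val_inj.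
exact: inhabits (Fusion gr_ker gr_span gr_direct act_gr).
Qed.

Lemma truncpoly_unit (C : fieldType) (n : nat) (p : truncpoly C n) :
  (p \is a GRing.unit) = ((p : {poly C}).[0] != 0).
Proof.
rewrite -[_ != 0]/(~~ root (p : {poly C}) 0) -coprimepX coprimep_sym.
by rewrite -(@coprimep_pexpl _ n.-1.+1 'X) // -mk_monic_Xn.
Qed.

Lemma truncpoly_hornerM (C : fieldType) (n : nat) (p q : truncpoly C n) :
  ((p * q : truncpoly C n) : {poly C}).[0]
  = (p : {poly C}).[0] * (q : {poly C}).[0].
Proof.
rewrite -hornerM poly_of_qpolyM; move: (_ * _) => r; rewrite mk_monic_Xn.
rewrite {2}(Pdiv.RingMonic.rdivp_eq (monicXn _ n.-1.+1) r).
by rewrite hornerD hornerM hornerXn expr0n mulr0 add0r.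
Qed.

Lemma upper_unipE (A : comNzRingType) (p : A) (g : 'M[A]_2) i j :
  (upper_unip p *m g) i j = g i j + (i == 0)%:R * p * g 1 j.
Proof.
rewrite /upper_unip mulmxDl mul1mx -scalemxAl !mxE; congr (_ + _).
rewrite big_ord_recl big_ord1 !mxE /= ?(andbF, andbT) mul0r add0r mulrCA mulrA.
by congr (_ * g _ _); apply: val_inj.
Qed.

Lemma lower_unipE (A : comNzRingType) (p : A) (g : 'M[A]_2) i j :
  (lower_unip p *m g) i j = g i j + (i == 1)%:R * p * g 0 j.
Proof.
rewrite /lower_unip mulmxDl mul1mx -scalemxAl !mxE; congr (_ + _).
rewrite big_ord_recl big_ord1 !mxE /= ?(andbF, andbT) mul0r addr0 mulrCA mulrA.
by congr (_ * g _ _); apply: val_inj.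
Qed.

Lemma det2 (A : comNzRingType) (g : 'M[A]_2) :
  \det g = g 0 0 * g 1 1 - g 0 1 * g 1 0.
Proof.
rewrite (expand_det_row _ 0) big_ord_recl big_ord1 /cofactor !det_mx11 !mxE /=.
rewrite expr0 expr1 mul1r mulN1r mulrN.
by congr (_ * _ - _ * _); congr (g _ _); apply: val_inj.
Qed.

Lemma det1_unip_factor (A : comUnitRingType) (g : 'M[A]_2) :
  g 1 0 \is a GRing.unit -> \det g = 1 ->
  exists x y, g = upper_unip x *m (lower_unip (g 1 0) *m (upper_unip y *m 1%:M)).
Proof.
rewrite det2 => uc detg; set c := g 1 0 in uc detg *.
exists ((g 0 0 - 1) / c), ((g 1 1 - 1) / c).
have aE : g 0 0 = 1 + (g 0 0 - 1) / c * c by rewrite divrK // addrC subrK.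
have dE : g 1 1 = 1 + (g 1 1 - 1) / c * c by rewrite divrK // addrC subrK.
move: (_ / c) (_ / c) aE dE => y x aE dE.
have ord2 (i : 'I_2) : (i == 0) || (i == 1) by case: i => [[|[|]]].
apply/matrixP => i j; rewrite !(upper_unipE, lower_unipE) !mxE.
case/orP: (ord2 i) => /eqP ->; case/orP: (ord2 j) => /eqP ->;
  rewrite /= ?(mulr0, mul0r, mulr1, mul1r, addr0, add0r) //.
- apply: (mulIr uc).
  have -> : g 0 1 * c = g 0 0 * g 1 1 - 1 by rewrite -detg subKr.
  rewrite aE dE mulrDl mul1r addrAC [1 + _]addrC addrK.
  by rewrite [RHS]mulrDl [1 + _]addrC [c * y]mulrC [x * _ * c]mulrAC.
- by rewrite dE mulrC.
Qed.

Lemma unip_mulV (A : comNzRingType) (p : A) (g : 'M[A]_2) :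
  lower_unip (- p) *m (lower_unip p *m g) = g.
Proof.
apply/matrixP => i j; rewrite !lower_unipE /= mul0r mul0r addr0 mulrN mulNr.
exact: addrK.
Qed.

Lemma SL2_act_total (C : fieldType) (n : nat) (a : 'I_n -> nat)
    (z : 'I_n -> C) (M : fusion a z) (g : 'M[truncpoly C n]_2) (v : fus_mod M) :
  \det g = 1 -> exists w, SL2_act g v w.
Proof.
have act_unit (h : 'M[truncpoly C n]_2) :
    h 1 0 \is a GRing.unit -> \det h = 1 -> exists w, SL2_act h v w.
  move=> uc deth; have [x [y ->]] := det1_unip_factor uc deth.
  by eexists; apply/SL2_act_e/SL2_act_f/SL2_act_e/SL2_act1.
case: (boolP (g 1 0 \is a GRing.unit)) => [|nuc detg]; first exact: act_unit.
have [| |w gw] := act_unit (lower_unip 1 *m g).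
- rewrite lower_unipE /= mul1r mul1r.
  move: nuc; rewrite !truncpoly_unit negbK poly_of_qpolyD hornerD => /eqP c0.
  rewrite c0 add0r; apply/eqP => a0.
  have := congr1 (fun p : truncpoly C n => (p : {poly C}).[0]) detg.
  rewrite det2 hornerD hornerN.
  rewrite !truncpoly_hornerM c0 a0 mul0r mulr0 subr0 hornerC => /esym/eqP.
  by rewrite oner_eq0.
- rewrite det2 !lower_unipE /= !mul0r !mul1r !addr0 mulrDr mulrDr -detg det2.
  by rewrite [g 0 1 * g 0 0]mulrC opprD addrACA subrr addr0.
by eexists; rewrite -(unip_mulV 1 g); apply: SL2_act_f gw.
Qed.

Lemma SL2_act_integrates (C : fieldType) (n : nat) (a : 'I_n -> nat)
    (z : 'I_n -> C) (M : fusion a z)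
    (rho : 'M[truncpoly C n]_2 -> fus_mod M -> fus_mod M) :
  (forall v, rho 1%:M v = v) ->
  (forall g h v, \det g = 1 -> \det h = 1 -> rho (g *m h) v = rho g (rho h v)) ->
  (forall p v, rho (upper_unip p) v = nilp_exp (current_act M (sl2_e C) p) v) ->
  (forall p v, rho (lower_unip p) v = nilp_exp (current_act M (sl2_f C) p) v) ->
  forall g v w, \det g = 1 -> SL2_act g v w <-> w = rho g v.
Proof.
move=> rho1 rhoM rho_e rho_f g v w detg.
have det_u p : \det (upper_unip p : 'M[truncpoly C n]_2) = 1.
  by rewrite -[upper_unip p]mulmx1 det2 !upper_unipE !mxE /=
             !mul0r !addr0 !mulr0 addr0 mulr1 subr0.
have det_l p : \det (lower_unip p : 'M[truncpoly C n]_2) = 1.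
  by rewrite -[lower_unip p]mulmx1 det2 !lower_unipE !mxE /=
             !mul0r !addr0 mulr0 !addr0 !mul1r mul0r subr0.
have actP h u u' : SL2_act h u u' -> \det h = 1 /\ u' = rho h u.
  elim=> {h u u'} [u|p h u u' _ [deth ->]|p h u u' _ [deth ->]].
  - by rewrite det1 rho1.
  - by rewrite det_mulmx det_u deth mul1r rhoM // rho_e.
  - by rewrite det_mulmx det_l deth mul1r rhoM // rho_f.
split=> [/actP[]//|->]; have [w' gw'] := SL2_act_total v detg.
by have [_ <-] := actP _ _ _ gw'.
Qed.

(* Main.v *)
Require Import Defs.
From HB Require Import structures.
From mathcomp Require Import all_boot all_order all_algebra.
From mathcomp Require Import boolp reals.
From mathcomp Require Import complex.
From mathcomp Require Import mpoly perm.
From mathcomp Require classical_sets.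
From mathcomp Require Import zify ring.

Set Implicit Arguments.
Unset Strict Implicit.
Unset Printing Implicit Defensive.

Import Order.TTheory GRing.Theory Num.Theory.
Local Open Scope ring_scope.

(* Let F_A(c) = exp(c_0 e_0 + ... + c_(n-1) e_(n-1)) v_A.  The image of F_A is
   dense in sh_A, so sh_A is determined by the space W_A of polynomials in
   c_0, ..., c_(n-1) spanned by the coordinates of F_A.  Let J_A be the multiset
   of the numbers #{i | a_i > b}, for b >= 1.  The key fact is that W_A is
   spanned by the products of minors, one of each size j in J_A, of the lower
   triangular Toeplitz j x j matrices (c_(l - k)).  Such a product is the part
   of lowest weight (c_j having weight j) of a product of minors of the matrices
   of multiplication by c(t) = sum_j c_j t^j on the algebras
   C[t] / prod_(a_i > b) (t - z_i); as c(t) is diagonal in the basis of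
   idempotents, the latter product is a combination of coordinates of
   exp(sum_j c_j e_j) on the tensor product of the C^(a_i)(z_i), whence
   membership in W_A.  Equality follows by counting: the fusion product has
   dimension at most prod_i a_i, and so many of these products are linearly
   independent.

   If 2 <= b_1 < ... < b_n then J_B contains every size in 1, ..., n, so that for
   d large W_B^d = W_A W' for some space W'.  Dropping the factor W' yields a
   morphism sh_B -> sh_A defined everywhere.  It is surjective because its fibre
   over a point y is cut out by homogeneous equations: if it were empty, the
   projective Nullstellensatz would give (W_A W')^t = ker(y) W_A^(t-1) W'^t for
   some t, and Nakayama's determinant trick would contradict y in sh_A. *)

(** * Multivariate polynomials *)

(** Lowest weight parts enter through derivatives. The iterated derivatives at 0 of a coordinate of
    exp(sum_j c_j e_j) v are the values of the linear form on the words in the e_j applied to v, and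
    a word of degree s only sees the part of weight s. As F_(s - 1) is spanned by such words, a form
    on the tensor product whose polynomial has no part of weight below s kills F_(s - 1), descends
    to F_s / F_(s - 1), and there its polynomial is the part of weight s. The image of F_A is dense
    because exp(e p) translates c, while f_j F_A is a multiple of F_A plus a combination of the
    partial derivatives of F_A, with polynomial coefficients: the f_j are tangent to the cone over
    the image, so their exponentials preserve its closure. The number prod_i a_i of independent
    products comes from a recursion on the Young diagram with rows J_A. For d one takes sum_i a_i:
    then d copies of J_B contain J_A, and the remaining sizes give W'. *)

Lemma mpoly_ring_ind (C : comNzRingType) (N : nat) (P : {mpoly C[N]} -> Prop) :
  (forall c, P c%:MP) -> (forall i, P 'X_i) ->
  (forall p q, P p -> P q -> P (p + q)) ->
  (forall p q, P p -> P q -> P (p * q)) -> forall p, P p.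
Proof.
move=> PC PX PD PM; apply: mpolyind => [|c m p _ _ Pp].
  by rewrite -(mpolyC0 N); apply: PC.
apply: PD => //; rewrite -mul_mpolyC; apply: (PM) => //.
rewrite mpolyXE_id; elim/big_ind: _ => [|x y Px Py|i _].
- by rewrite -mpolyC1; apply: PC.
- exact: PM.
- elim: (m i) => [|k IH]; first by rewrite expr0 -mpolyC1; apply: PC.
  by rewrite exprS; apply: PM.
Qed.

(** The chain rule for an arbitrary derivation [D] of the target that kills scalars; it serves both
    for [deriv] along a curve and for partial derivatives after a substitution. *)
Lemma mmap_chain (C A : comNzRingType) (N : nat) (io : {rmorphism C -> A})
    (W : 'I_N -> A) (D : {additive A -> A}) (p : {mpoly C[N]}) :
  (forall c, D (io c) = 0) ->
  (forall x y, D (x * y) = D x * y + x * D y) ->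
  D (mmap io W p) = \sum_i D (W i) * mmap io W p^`M(i).
Proof.
move=> D0 DM; elim/mpoly_ring_ind: p => [c|i|p q IHp IHq|p q IHp IHq].
- by rewrite mmapC D0 big1 // => i _; rewrite mderivC mmap0 mulr0.
- rewrite mmapX mmap1U (bigD1 i) //= mderivX mnm1E eqxx scale1r.
  have -> : (U_(i) - U_(i))%MM = 0%MM :> 'X_{1..N}.
    by apply/mnmP => j; rewrite mnmBE mnm0E subnn.
  rewrite mmapX mmap11 mulr1 big1 ?addr0 // => j ji.
  by rewrite mderivX mnm1E eq_sym (negbTE ji) scale0r mmap0 mulr0.
- rewrite mmapD raddfD IHp IHq -big_split /=; apply: eq_bigr => i _.
  by rewrite mderivD mmapD mulrDr.
- rewrite rmorphM DM IHp IHq mulr_suml mulr_sumr -big_split /=.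
  apply: eq_bigr => i _; rewrite mderivM mmapD !rmorphM /=.
  by ring.
Qed.

Lemma meval_sum (C : nzRingType) (n : nat) (v : 'I_n -> C) (I : Type) (r : seq I)
    (P : pred I) (F : I -> {mpoly C[n]}) :
  (\sum_(i <- r | P i) F i).@[v] = \sum_(i <- r | P i) (F i).@[v].
Proof. exact: raddf_sum. Qed.

Lemma mderiv_sum (C : nzRingType) (n : nat) (j : 'I_n) (I : Type) (r : seq I)
    (P : pred I) (F : I -> {mpoly C[n]}) :
  (\sum_(i <- r | P i) F i)^`M(j) = \sum_(i <- r | P i) (F i)^`M(j).
Proof. exact: raddf_sum. Qed.

Definition mderivs (C : nzRingType) (n : nat) (t : seq 'I_n) (p : {mpoly C[n]}) :=
  foldl (fun q i => q^`M(i)) p t.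

Lemma meval_at0 (C : comNzRingType) (n : nat) (p : {mpoly C[n]}) :
  p.@[fun=> 0] = p@_0%MM.
Proof.
elim/mpolyind: p => [|c m p _ _ IH]; first by rewrite meval0 mcoeff0.
rewrite mevalD mcoeffD IH mevalZ mcoeffZ mcoeffX mevalX; congr (_ * _ + _).
case: (eqVneq m 0%MM) => [->|m0] /=.
  by rewrite big1 // => i _; rewrite mnm0E expr0.
have [i mi] : exists i, m i != 0%N.
  apply/existsP; rewrite -negb_forall; apply: contra m0 => /forallP m0.
  by apply/eqP/mnmP => i; rewrite mnm0E; apply/eqP.
by rewrite (bigD1 i) //= expr0n (negbTE mi) mul0r.
Qed.

(** In characteristic 0 a Taylor coefficient is a derivative at 0 up to nonzero factorials. *)
Lemma mpoly_eq0_mderivs (C : numDomainType) (n : nat) (p : {mpoly C[n]}) :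
  (forall t, (mderivs t p).@[fun=> 0] = 0) -> p = 0.
Proof.
move=> p0; apply/mpolyP => m; rewrite mcoeff0.
move: {2}(mdeg m) (erefl (mdeg m)) => d dm; elim: d m dm p p0 => [|d IH] m dm p p0.
  have /eqP -> : m == 0%MM by rewrite -mdeg_eq0 dm.
  by have := p0 [::]; rewrite meval_at0.
have [i mi] : exists i, m i != 0%N.
  apply/existsP; rewrite -negb_forall; apply/negP => /forallP m0.
  by move: dm; rewrite mdegE big1 // => i _; apply/eqP.
have um : (m - U_(i) + U_(i))%MM = m by rewrite submK // lep1mP.
have : (p^`M(i))@_(m - U_(i)) = 0.
  apply: IH => [|t]; last exact: (p0 (i :: t)).
  by move: dm; rewrite -um mdegD mdeg1 um addn1 => -[].
by rewrite mcoeff_mderiv um => /eqP; rewrite mulrn_eq0 /= => /eqP.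
Qed.

Lemma poly_eq0_horner (C : numDomainType) (p : {poly C}) :
  (forall x, p.[x] = 0) -> p = 0.
Proof.
move=> p0; apply/eqP; apply: contraT => pn0.
have := @max_poly_roots _ p [seq i%:R | i <- iota 0 (size p)] pn0.
rewrite size_map size_iota ltnn => -> //.
  by apply/allP => x _; apply/eqP.
by rewrite map_inj_uniq ?iota_uniq // => i j /eqP; rewrite eqr_nat => /eqP.
Qed.

Lemma horner_mmap (C : comNzRingType) (N : nat) (W : 'I_N -> {poly C}) p x :
  (mmap polyC W p).[x] = p.@[fun i => (W i).[x]].
Proof.
rewrite /meval /mmap horner_sum; apply: eq_bigr => m _.
rewrite hornerM hornerC /mmap1 horner_prod; congr (_ * _).
by apply: eq_bigr => i _; rewrite horner_exp.
Qed.

Lemma mpoly_eq0_meval (C : numDomainType) (n : nat) (p : {mpoly C[n]}) :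
  (forall v, p.@[v] = 0) -> p = 0.
Proof.
move=> p0; apply: mpoly_eq0_mderivs => t.
elim: t p p0 => [//|i t IH] p p0; apply: IH => v /=.
(* The line through [v] in direction [i]: since [p] vanishes along it, so does its [i]-th
   derivative, at every [v]. *)
pose W (j : 'I_n) : {poly C} := (v j)%:P + (i == j)%:R *: 'X.
have W0 : mmap polyC W p = 0.
  by apply: poly_eq0_horner => x; rewrite horner_mmap.
have := @mmap_chain C {poly C} n polyC W deriv p (fun c => derivC c)
  (fun x y => derivM x y).
rewrite W0 raddf0 (bigD1 i) //= big1 ?addr0 => [|j ji]; last first.
  by rewrite derivD derivC derivZ eq_sym (negbTE ji) scale0r addr0 mul0r.
rewrite derivD derivC derivZ eqxx scale1r derivX add0r mul1r.
move=> /(congr1 (fun q : {poly C} => q.[0])); rewrite horner0 horner_mmap => h.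
rewrite [RHS]h; apply: meval_eq => j.
by rewrite hornerD hornerC hornerZ hornerX mulr0 addr0.
Qed.

(** * Independence of products of Toeplitz minors *)

(** The matrix of multiplication by the series sum_m (c m) t^m in the basis of the powers of t. *)
Definition toep (A : nzRingType) (c : nat -> A) (l k : nat) : A :=
  if (k <= l)%N then c (l - k)%N else 0.

(* The choice of [md_size] rows and columns, possibly repeated, of a matrix. *)
Record mdata := MData {
  md_size : nat; md_row : 'I_md_size -> nat; md_col : 'I_md_size -> nat }.

(** The size of the minor is left free. In particular [j = 0] forces the empty minor, which is 1. *)
Definition within (j : nat) (d : mdata) : Prop :=
  (forall p, @md_row d p < j)%N /\ (forall q, @md_col d q < j)%N.

Definition tminor (A : comNzRingType) (c : nat -> A) (d : mdata) : A :=
  \det (\matrix_(p, q) toep c (@md_row d p) (@md_col d q)).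

Definition tprod (A : comNzRingType) (c : nat -> A) (ds : seq mdata) : A :=
  \prod_(d <- ds) tminor c d.

Fixpoint fills (J : seq nat) (ds : seq mdata) : Prop :=
  match J, ds with
  | [::], [::] => True
  | j :: J', d :: ds' => within j d /\ fills J' ds'
  | _, _ => False
  end.

Lemma tprod_rmorph (A B : comNzRingType) (f : {rmorphism A -> B}) c ds :
  f (tprod c ds) = tprod (f \o c) ds.
Proof.
rewrite /tprod rmorph_prod; apply: eq_bigr => d _.
rewrite /tminor -det_map_mx; congr (\det _); apply/matrixP => p q.
by rewrite !mxE /toep; case: ifP => _ //; rewrite rmorph0.
Qed.

Definition scons (A : Type) (x : A) (c : nat -> A) (k : nat) : A :=
  if k is k'.+1 then c k' else x.

(** If c_0 = 0, the series is t times the shifted series, so row l + 1 of its matrix is row l of the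
    matrix of the latter. *)
Definition dshift (d : mdata) : mdata :=
  MData (fun p => (@md_row d p).+1) (@md_col d).

Lemma toep_shift (A : nzRingType) (c : nat -> A) l k :
  toep (scons 0 c) l.+1 k = toep c l k.
Proof.
rewrite /toep; case: (ltngtP k l.+1) => [|kl|->].
- by rewrite ltnS => kl; rewrite kl subSn.
- by rewrite leqNgt ltnW.
- by rewrite subnn ltnn.
Qed.

Lemma tminor_shift (A : comNzRingType) (c : nat -> A) d :
  tminor (scons 0 c) (dshift d) = tminor c d.
Proof.
by congr (\det _); apply/matrixP => p q; rewrite !mxE toep_shift.
Qed.

(** Borders the minor by row 0 and column 0 and moves its own rows and columns by one. Row 0 of a
    lower triangular Toeplitz matrix is (c_0, 0, 0, ...), and the moved block is unchanged, so the
    minor gets multiplied by c_0. *)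
Definition dext (d : mdata) : mdata :=
  MData (fun p : 'I_(md_size d).+1 => oapp (fun p' => (@md_row d p').+1) 0%N (unlift ord0 p))
        (fun q : 'I_(md_size d).+1 => oapp (fun q' => (@md_col d q').+1) 0%N (unlift ord0 q)).

Lemma tminor_ext (A : comNzRingType) (c : nat -> A) d :
  tminor c (dext d) = c 0%N * tminor c d.
Proof.
rewrite /tminor (expand_det_row _ ord0) big_ord_recl big1 ?addr0 => [|i _].
  rewrite mxE /= unlift_none /= /toep /=; congr (_ * _).
  rewrite /cofactor addn0 expr0 mul1r; congr (\det _).
  by apply/matrixP => p q; rewrite !mxE /= !liftK.
by rewrite mxE /= unlift_none liftK /= /toep mul0r.
Qed.

Lemma fills_shift J ds : fills J ds -> fills (map succn J) (map dshift ds).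
Proof.
elim: J ds => [|j J IH] [|d ds] //= [[rj sj] /IH ?]; split=> //.
by split=> [p|q] /=; [rewrite ltnS; apply: rj | apply: ltnW; apply: sj].
Qed.

Lemma fills_ext j J d ds : fills (j :: J) (d :: ds) -> fills (j.+1 :: J) (dext d :: ds).
Proof.
move=> [[rj sj] ?]; split=> //.
by split=> [p|q] /=; case: unliftP => [i _|_] //=; rewrite ltnS.
Qed.

(** Independence is that of functions of an infinite sequence, so that the induction may shift the
    variables without tracking their number. *)
Definition has_indep_tprods (C : fieldType) (D : nat) (J : seq nat) : Prop :=
  exists2 u : 'I_D -> seq mdata, (forall i, fills J (u i))
    & forall al : 'I_D -> C,
        (forall c : nat -> C, \sum_i al i * tprod c (u i) = 0) -> forall i, al i = 0.

(* At [c 0 = 0] the first family specialises to an independent family in the   *)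
(* shifted variables, while the second one is divisible by [c 0].               *)
Lemma has_indep_step (C : numFieldType) D1 D2 j J :
  has_indep_tprods C D1 (j :: map predn J) -> has_indep_tprods C D2 (j :: J) ->
  all (leq j.+1) J -> has_indep_tprods C (D1 + D2) (j.+1 :: J).
Proof.
move=> [u1 u1P u1i] [u2 u2P u2i] Jj.
pose e (ds : seq mdata) := if ds is d :: ds' then dext d :: ds' else [::].
have eE c i : tprod c (e (u2 i)) = c 0%N * tprod c (u2 i) :> C.
  case: (u2 i) (u2P i) => [|d ds] //= _.
  by rewrite /tprod !big_cons tminor_ext mulrA.
have sE c i : tprod (scons 0 c) (map dshift (u1 i)) = tprod c (u1 i) :> C.
  by rewrite /tprod big_map; apply: eq_bigr => d _; rewrite tminor_shift.
pose u (i : 'I_(D1 + D2)) :=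
  match split i with inl i => map dshift (u1 i) | inr i => e (u2 i) end.
have ul i : u (lshift D2 i) = map dshift (u1 i) by rewrite /u (unsplitK (inl i)).
have ur i : u (rshift D1 i) = e (u2 i) by rewrite /u (unsplitK (inr i)).
exists u => [i|al al0].
  rewrite -(splitK i); case: (split i) => {}i /=.
    rewrite ul; have := fills_shift (u1P i); rewrite /= -map_comp.
    rewrite (_ : map _ J = J) //; rewrite -[RHS]map_id; apply/eq_in_map => x xJ.
    by have := allP Jj x xJ; case: x {xJ}.
  by rewrite ur; case: (u2 i) (u2P i) => [|d ds] // /fills_ext.
have all_ i : al (lshift D2 i) = 0.
  apply: (u1i (al \o @lshift D1 D2)) => c.
  have := al0 (scons 0 c); rewrite big_split_ord /= [X in _ + X]big1 ?addr0 => [h|k _].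
    by rewrite -[RHS]h; apply: eq_bigr => k _; rewrite ul sE.
  by rewrite ur eE /= mul0r mulr0.
have alr i : al (rshift D1 i) = 0.
  apply: (u2i (al \o @rshift D1 D2)) => c.
  (* The relation is known only after multiplication by [c 0], which may vanish. Making it an
     indeterminate allows cancelling the factor before specialising back. *)
  pose cP : nat -> {poly C} := scons 'X (fun k => (c k.+1)%:P).
  pose P := \sum_i al (rshift D1 i) *: tprod cP (u2 i).
  have PE x : P.[x] = \sum_i al (rshift D1 i) * tprod (scons x (c \o succn)) (u2 i).
    rewrite horner_sum; apply: eq_bigr => k _; rewrite hornerZ; congr (_ * _).
    rewrite -[_.[x]]/(horner_eval x _) tprod_rmorph; congr (tprod _ _).
    by apply/funext => -[|m] /=; rewrite /horner_eval ?hornerX ?hornerC.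
  have XP0 : 'X * P = 0.
    apply: poly_eq0_horner => x; rewrite hornerM hornerX PE.
    have := al0 (scons x (c \o succn)).
    rewrite big_split_ord /= big1 ?add0r => [|k _]; last by rewrite all_ mul0r.
    move=> h; rewrite -[RHS]h mulr_sumr; apply: eq_bigr => k _.
    by rewrite ur eE /= mulrCA.
  move/eqP: XP0; rewrite mulf_eq0 polyX_eq0 /= => /eqP P0.
  have := PE (c 0%N); rewrite P0 horner0 => h; rewrite [RHS]h.
  apply: eq_bigr => k _; congr (_ * tprod _ _).
  by apply/funext => -[].
by move=> i; rewrite -(splitK i); case: (split i) => {}i /=.
Qed.

(** With [J] read as the rows of a Young diagram, the factor at [i] is one more than the length of
    column [i]. *)
Definition colprod (N : nat) (J : seq nat) : nat :=
  (\prod_(0 <= i < N) (count (fun x => i < x)%N J).+1)%N.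

(** Row j + 1 is the shortest. With m = [size J] and R the product over the columns after the first
    j + 1, the three terms are (m + 2)^(j + 1) R, (m + 2)^j R and (m + 2)^j (m + 1) R. *)
Lemma colprod_step N j J :
  (j < N)%N -> all (leq j.+1) J -> all (leq^~ N) J ->
  colprod N (j.+1 :: J) = (colprod N (j :: map predn J) + colprod N (j :: J))%N.
Proof.
move=> jN Jj JN; set m := size J.
have cm i : (i <= j)%N -> count (fun x => i < x)%N J = m.
  move=> ij; apply/eqP; rewrite -all_count; apply: sub_all Jj => x.
  exact: leq_ltn_trans.
have cp i : count (fun x => i < x)%N (map predn J) = count (fun x => i.+1 < x)%N J.
  by rewrite count_map; apply: eq_count => x /=; case: x.
have cN : count (fun x => N < x)%N J = 0%N.
  apply/eqP; rewrite -leqn0 leqNgt -has_count; apply/hasPn => x /(allP JN).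
  by rewrite -leqNgt.
have low (f : nat -> nat) (k : nat) : (forall i, (i < j)%N -> f i = k) ->
    (\prod_(0 <= i < N) f i = k ^ j * (f j * \prod_(j.+1 <= i < N) f i))%N.
  move=> fk; rewrite (big_cat_nat (leq0n j) (ltnW jN)) /= (big_ltn jN); congr (_ * _)%N.
  by rewrite -{2}[j]subn0 -prod_nat_const_nat; apply: eq_big_nat => i /fk.
rewrite /colprod !(low _ m.+2) => [|i ij|i ij|i ij] /=; last 3 first.
- by rewrite ij cm // ltnW.
- by rewrite ij cp cm.
- by rewrite ltnS ltnW // cm // ltnW.
rewrite leqnn cm // ltnn cp.
set R := (\prod_(j.+1 <= i < N) (count (fun x => i < x)%N J).+1)%N.
have -> : (\prod_(j.+1 <= i < N) ((i < j.+1) + count (fun x => i < x)%N J).+1 = R)%N.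
  by apply: eq_big_nat => i /andP[ji _]; rewrite ltnNge ji.
have -> : (\prod_(j.+1 <= i < N) ((i < j) + count (fun x => i < x)%N J).+1 = R)%N.
  by apply: eq_big_nat => i /andP[ji _]; rewrite ltnNge ltnW.
have -> : ((0 + count (fun x => j.+1 < x)%N J).+1 *
    \prod_(j.+1 <= i < N) ((i < j) + count (fun x => i < x)%N (map predn J)).+1 = R)%N.
  transitivity (\prod_(j <= i < N) (count (fun x => i.+1 < x)%N J).+1)%N.
    rewrite (big_ltn jN); congr (_ * _)%N.
    by apply: eq_big_nat => i /andP[ji _]; rewrite ltnNge ltnW // cp.
  rewrite -(big_add1 _ _ j N.+1 xpredT (fun i => (count (fun x => i < x)%N J).+1)) /=.
  by rewrite big_nat_recr //= cN muln1.
by rewrite -mulnDr -mulSn.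
Qed.

(** The smallest bin is shortened at each step, so [has_indep_step] and [colprod_step] obey the same
    recursion. The measure counts [size J] as well because dropping an empty bin does not change the
    sum. *)
Lemma has_indep_fills (C : numFieldType) N J :
  sorted leq J -> all (leq^~ N) J -> has_indep_tprods C (colprod N J) J.
Proof.
have [k] := ubnP (sumn J + size J); elim: k J => // k IH [|[|j] J] /=.
- move=> _ _ _; have -> : colprod N [::] = 1%N by rewrite /colprod big1.
  exists (fun=> [::]) => // al /(_ (fun=> 0)); rewrite big_ord1 /tprod big_nil mulr1.
  by move=> al0 i; rewrite (ord1 i).
- rewrite add0n addnS !ltnS => Jk /path_sorted Js JN.
  have [u uP ui] := IH J Jk Js JN.
  have -> : colprod N (0%N :: J) = colprod N J by [].
  exists (fun i => MData (fun p : 'I_0 => 0%N) (fun p : 'I_0 => 0%N) :: u i) => [i|al al0].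
    by split=> //; split; case.
  apply: ui => c; have := al0 c; rewrite /tprod => h; rewrite -[RHS]h.
  by apply: eq_bigr => i _; rewrite big_cons /tminor det_mx00 mul1r.
- rewrite addSn ltnS => Jk Js /andP[jN JN].
  have Jj : all (leq j.+1) J by apply: order_path_min Js => ? ? ?; apply: leq_trans.
  rewrite colprod_step //; apply: has_indep_step => //; apply: IH => /=.
  + have Jp : (sumn (map predn J) <= sumn J)%N.
      by rewrite !sumnE big_map leq_sum // => i _; apply: leq_pred.
    by rewrite size_map; lia.
  + rewrite path_min_sorted ?all_map; last by apply: sub_all Jj; case.
    rewrite sorted_map; apply: sub_sorted (path_sorted Js) => x y /=; lia.
  + rewrite (ltnW jN) all_map; apply: sub_all JN => x /= xN.
    exact: leq_trans (leq_pred _) xN.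
  + by lia.
  + rewrite path_min_sorted ?(path_sorted Js) //.
    by apply: sub_all Jj => x; apply: ltnW.
  + by rewrite (ltnW jN).
Qed.

(** * The projective Nullstellensatz *)

Lemma mnm_split (N : nat) (mu : 'X_{1..N}) k l : mdeg mu = (k + l)%N ->
  exists nu nu' : 'X_{1..N}, [/\ mu = (nu + nu')%MM, mdeg nu = k & mdeg nu' = l].
Proof.
elim: k l => [|k IH] l muE; first by exists 0%MM, mu; rewrite add0m mdeg0.
have [|nu [nu' [-> nuE nuE']]] := IH l.+1; first by rewrite muE addnS.
have [i nui] : exists i, nu' i != 0%N.
  apply/existsP; rewrite -negb_forall; apply/negP => /forallP nu0.
  by move: nuE'; rewrite mdegE big1 // => i _; apply/eqP.
have un : (nu' - U_(i) + U_(i))%MM = nu' by rewrite submK // lep1mP.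
exists (nu + U_(i))%MM, (nu' - U_(i))%MM; split.
- by rewrite -addmA [(U_(i) + _)%MM]addmC un.
- by rewrite mdegD mdeg1 nuE addn1.
- by move: nuE'; rewrite -{1}un mdegD mdeg1 addn1 => -[].
Qed.

(* Graded ideals are given by the pairs (degree, homogeneous element). *)
Section GradedIdeal.
Variables (C : closedFieldType) (N : nat).
Local Notation R := {mpoly C[N]}.
Implicit Types (I J : nat * R -> Prop).

Record gideal I : Prop := GIdeal {
  gi_homog : forall d p, I (d, p) -> p \is d.-homog;
  gi0 : forall d, I (d, 0);
  giD : forall d p q, I (d, p) -> I (d, q) -> I (d, p + q);
  giM : forall e r d p, r \is e.-homog -> I (d, p) -> I ((e + d)%N, r * p) }.

(** No power of the irrelevant ideal lies in [I]; mere absence of 1 would not provide a projective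
    zero. *)
Definition proper I := forall m, exists2 p, p \is m.-homog & ~ I (m, p).

Lemma dhomogC (c : C) : (c%:MP : R) \is 0.-homog.
Proof.
by rewrite -[c%:MP]mulr1 mul_mpolyC -mpolyX0 rpredZ // dhomogX; apply/eqP/mdeg0.
Qed.

Lemma dhomogX1 (i : 'I_N) : ('X_i : R) \is 1.-homog.
Proof. by rewrite dhomogX; apply/eqP/mdeg1. Qed.

Lemma giZ I d c p : gideal I -> I (d, p) -> I (d, c *: p).
Proof. by move=> gI Ip; rewrite -mul_mpolyC -[d]add0n; apply: giM (dhomogC c) _. Qed.

Lemma giB I d p q : gideal I -> I (d, p) -> I (d, q) -> I (d, p - q).
Proof. by move=> gI Ip Iq; apply: giD => //; rewrite -scaleN1r; apply: giZ. Qed.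

Lemma gi_sum I d (T : eqType) (s : seq T) (F : T -> R) : gideal I ->
  (forall i, i \in s -> I (d, F i)) -> I (d, \sum_(i <- s) F i).
Proof.
move=> gI; elim: s => [|x s IH] IF; first by rewrite big_nil; apply: gi0.
rewrite big_cons; apply: giD => //; first by apply: IF; rewrite mem_head.
by apply: IH => i si; apply: IF; rewrite in_cons si orbT.
Qed.

Lemma gi_mon I d : gideal I ->
  (forall mu : 'X_{1..N}, mdeg mu = d -> I (d, 'X_[mu])) ->
  forall p, p \is d.-homog -> I (d, p).
Proof.
move=> gI Imu p /dhomogP pd; rewrite [p]mpolyE; apply: gi_sum => // m mp.
by apply: giZ => //; apply: Imu; apply: pd.
Qed.

Lemma proper_mon I d : gideal I -> proper I ->
  exists2 mu : 'X_{1..N}, mdeg mu = d & ~ I (d, 'X_[mu]).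
Proof.
move=> gI /(_ d) [p pd nIp]; apply: contrapT => h; apply: nIp.
apply: gi_mon => // mu muE; apply: contrapT => h'; apply: h.
by exists mu.
Qed.

(** Zorn's lemma. The union of a chain is still proper: a degree has finitely many monomials, and if
    all of them were in the union, a single member of the chain would contain them. *)
Lemma gideal_maximal J : gideal J -> proper J ->
  exists I, [/\ gideal I, proper I, forall x, J x -> I x
    & forall K, gideal K -> proper K -> (forall x, I x -> K x) -> forall x, K x -> I x].
Proof.
move=> gJ pJ.
(* Adjoining [J] to every set makes the empty set, hence the union of the empty chain, stand for the
   ideal [J] itself. *)
pose U I (x : nat * R) := J x \/ I x.
pose P I := gideal (U I) /\ proper (U I).
have U0 : U (fun=> False) = J by apply/funext => x; apply/propext; split=> [[]|]; [| |left].
have P0 : P (fun=> False) by rewrite /P U0.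
have [F FP Ftot|I [[gI pI] Imax]] := @classical_sets.Zorn_bigcup _ P.
  pose F' X := F X \/ X = (fun=> False).
  have F'P X : F' X -> P X by case=> [/FP|->].
  have F'tot X Y : F' X -> F' Y -> (forall x, X x -> Y x) \/ (forall x, Y x -> X x).
    by case=> [FX|->] [FY|->]; [apply: Ftot| right | left | left].
  set V := classical_sets.bigcup _ _.
  have VP x : U V x <-> exists2 X, F' X & U X x.
    split=> [[Jx|[X FX Xx]]|[X [FX|->] [Jx|Xx]]] //.
    - by exists (fun=> False); [right|left].
    - by exists X; [left|right].
    - by left.
    - by right; exists X.
    - by left.
  have V2 x y : U V x -> U V y -> exists X, [/\ F' X, U X x & U X y].
    move=> /VP[X FX Xx] /VP[Y FY Yy]; case: (F'tot X Y FX FY) => XY.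
      by exists Y; split=> //; case: Xx => [Jx|/XY Yx]; [left|right].
    by exists X; split=> //; case: Yy => [Jx|/XY Yx]; [left|right].
  split; first split.
  - by move=> d p /VP[X /F'P[gX _]]; apply: gi_homog.
  - by move=> d; left; apply: gi0.
  - move=> d p q Vp Vq; have [X [FX Xp Xq]] := V2 _ _ Vp Vq; apply/VP; exists X => //.
    by have [gX _] := F'P X FX; apply: giD.
  - move=> e r d p re /VP[X FX Xp]; apply/VP; exists X => //.
    by have [gX _] := F'P X FX; apply: giM.
  - move=> m; apply: contrapT => h.
    have hV p : p \is m.-homog -> U V (m, p).
      by move=> pm; apply: contrapT => nV; apply: h; exists p.
    have [X FX XM] : exists2 X, F' X &
        forall mu, mu \in [seq val nu | nu <- enum {: 'X_{1..N < m.+1}}] ->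
          mdeg mu = m -> U X (m, 'X_[mu]).
      elim: [seq val nu | nu <- _] => [|mu s [X FX XM]].
        by exists (fun=> False) => //; right.
      have [muE|muN] := eqVneq (mdeg mu) m; last first.
        exists X => // nu; rewrite in_cons => /orP[/eqP -> /eqP|]; last exact: XM.
        by rewrite (negbTE muN).
      have /hV/VP[Y FY Ymu] : ('X_[mu] : R) \is m.-homog by rewrite dhomogX; apply/eqP.
      case: (F'tot X Y FX FY) => XY.
        exists Y => // nu; rewrite in_cons => /orP[/eqP -> //|/XM h' /h'].
        by case=> [Jx|/XY Yx]; [left|right].
      exists X => // nu; rewrite in_cons => /orP[/eqP -> _|/XM//].
      by case: Ymu => [Jx|/XY Yx]; [left|right].
    have [gX pX] := F'P X FX.
    have [mu muE] := proper_mon m gX pX; apply; apply: XM => //.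
    have mum : (mdeg mu < m.+1)%N by rewrite muE.
    by apply/mapP; exists (BMultinom mum); rewrite ?mem_enum.
exists (U I); split=> // [x|K gK pK IK x Kx]; first by left.
apply: contrapT => nIx; apply: (Imax K); last first.
  have KU : U K = K.
    by apply/funext => y; apply/propext; split=> [[Jy|//]|]; [apply: IK; left|right].
  by rewrite /P KU.
split; first by move=> y Iy; apply: IK; right.
by move=> /(_ x Kx) Ix; apply: nIx; right.
Qed.

(** * Maximal proper graded ideals are prime and have a projective zero *)

Section Maximal.
Variable I : nat * R -> Prop.
Hypotheses (gI : gideal I) (pI : proper I).
Hypothesis Imax : forall K, gideal K -> proper K ->
  (forall x, I x -> K x) -> forall x, K x -> I x.

(** The ideal generated by [I] and [a] is strictly larger than [I], so by maximality it contains a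
    whole degree [m]. *)
Lemma maximal_adjoin e (a : R) : a \is e.-homog -> ~ I (e, a) ->
  exists m, forall p, p \is m.-homog -> exists2 j, I (m, j) &
    p = j \/ exists k r, [/\ m = (k + e)%N, r \is k.-homog & p = j + r * a].
Proof.
move=> ae nIa; pose K (x : nat * R) := exists2 j, I (x.1, j) &
    x.2 = j \/ exists k r, [/\ x.1 = (k + e)%N, r \is k.-homog & x.2 = j + r * a].
suff npK : ~ proper K.
  apply: contrapT => h; apply: npK => m; apply: contrapT => h'; apply: h; exists m => p pm.
  by apply: contrapT => nK; apply: h'; exists p.
move=> pK; apply: nIa; apply: (Imax _ pK) => [|[d p] Ip|]; last first.
- by exists 0; [apply: gi0|right; exists 0%N, 1; rewrite add0n add0r mul1r dhomog1].
- by exists p => //; left.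
split=> /=.
- move=> d p [j /= Ij [->|[k [r [dE rk ->]]]]]; first exact: gi_homog Ij.
  by rewrite rpredD ?(gi_homog gI Ij) // dE dhomogM.
- by move=> d; exists 0; [apply: gi0|left].
- move=> d p q [j /= Ij pE] [j' /= Ij' qE]; exists (j + j') => /=; first exact: giD.
  case: pE qE => [->|[k [r [kE rk ->]]]] [->|[k' [r' [k'E rk' ->]]]].
  + by left.
  + by right; exists k', r'; split=> //; rewrite addrA.
  + by right; exists k, r; split=> //; rewrite addrAC.
  + right; exists k, (r + r'); split=> //; last by rewrite mulrDl addrACA.
    by rewrite rpredD //; have /eqP := k'E; rewrite kE eqn_add2r => /eqP ->.
- move=> e' r d p re' [j /= Ij pE]; exists (r * j) => /=; first exact: giM.
  case: pE => [->|[k [s [-> sk ->]]]]; [by left|right].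
  by exists (e' + k)%N, (r * s); rewrite addnA dhomogM // mulrDr mulrA.
Qed.

(** If [a * b] were in [I], so would be the product of the ideals generated by [I] and [a] and by
    [I] and [b]; these contain whole degrees [m1] and [m2], so [I] would contain degree
    [m1 + m2]. *)
Lemma maximal_prime e e' (a b : R) : a \is e.-homog -> b \is e'.-homog ->
  ~ I (e, a) -> ~ I (e', b) -> ~ I ((e + e')%N, a * b).
Proof.
move=> ae be nIa nIb Iab.
have [m1 m1P] := maximal_adjoin ae nIa; have [m2 m2P] := maximal_adjoin be nIb.
have [mu /mnm_split[nu [nu' [-> nuE nuE']]]] := proper_mon (m1 + m2) gI pI.
have nuh : ('X_[nu] : R) \is m1.-homog by rewrite dhomogX; apply/eqP.
have nuh' : ('X_[nu'] : R) \is m2.-homog by rewrite dhomogX; apply/eqP.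
apply; rewrite mpolyXD.
have [j Ij Ej] := m1P _ nuh; have [j' Ij' Ej'] := m2P _ nuh'.
have Il : I ((m1 + m2)%N, j * 'X_[nu']) by rewrite addnC mulrC; apply: giM.
have Ir : I ((m1 + m2)%N, 'X_[nu] * j') by apply: giM.
case: Ej' => [->//|[k' [s [k'E sk' nuE2]]]].
case: Ej => [->//|[k [r [kE rk nuE1]]]].
have -> : 'X_[nu] * 'X_[nu'] = 'X_[nu] * j' + (j * (s * b) + r * s * (a * b)) :> R.
  by rewrite nuE2 mulrDr {2}nuE1; congr (_ + _); ring.
apply: giD => //; apply: giD => //.
  rewrite mulrC addnC; apply: giM => //.
  by rewrite k'E; apply: dhomogM.
by rewrite kE k'E addnACA; apply: giM => //; apply: dhomogM.
Qed.

(* [x := 'X_i] is not in [I], and the degree [m + D] part of the quotient by [I]  *)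
(* is [x ^+ D] times the degree [m] part, hence of bounded dimension: some binary *)
(* form in ['X_j] and [x] lies in [I], and so does one of its linear factors.     *)
Lemma maximal_root : exists2 la : 'I_N -> C, (exists i, la i != 0)
  & forall d p, I (d, p) -> p.@[la] = 0.
Proof.
have [i nIx] : exists i, ~ I (1%N, 'X_i).
  have [mu] := proper_mon 1 gI pI.
  by move=> /eqP; rewrite mdeg_eq1 => /existsP[i /eqP ->]; exists i.
set x : R := 'X_i in nIx.
have xh : x \is 1.-homog by apply: dhomogX1.
have xnh k : x ^+ k \is k.-homog by rewrite -{2}[k]mul1n; apply: dhomogMn.
have nIxn k : ~ I (k, x ^+ k).
  elim: k => [|k IH]; last by rewrite exprS -add1n; apply: maximal_prime.
  rewrite expr0 => I1; have [p ph] := pI 0%N; apply.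
  by rewrite -[p]mulr1 -[0%N]addn0; apply: giM.
have [m mP] := maximal_adjoin xh nIx.
have red D (mu : 'X_{1..N}) : mdeg mu = (m + D)%N ->
    exists2 s : R, s \is m.-homog & I ((m + D)%N, 'X_[mu] - x ^+ D * s).
  elim: D mu => [|D IH] mu muE.
    exists 'X_[mu]; first by rewrite dhomogX; apply/eqP; rewrite /= muE addn0.
    by rewrite expr0 mul1r subrr; apply: gi0.
  have [nu [nu' [-> nuE nuE']]] : exists nu nu' : 'X_{1..N},
      [/\ mu = (nu + nu')%MM, mdeg nu = 1%N & mdeg nu' = (m + D)%N].
    by apply: mnm_split; rewrite muE addnS add1n.
  have [s sm Is] := IH nu' nuE'.
  have nuh : ('X_[nu] : R) \is 1.-homog by rewrite dhomogX; apply/eqP.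
  suff [s' sm' Is'] : exists2 s' : R, s' \is m.-homog & I (m.+1, 'X_[nu] * s - x * s').
    exists s' => //; rewrite mpolyXD.
    have -> : 'X_[nu] * 'X_[nu'] - x ^+ D.+1 * s' =
        'X_[nu] * ('X_[nu'] - x ^+ D * s) + x ^+ D * ('X_[nu] * s - x * s') :> R.
      by rewrite exprS; ring.
    apply: giD => //; first by rewrite addnS -add1n; apply: giM.
    by rewrite addnC addSnnS; apply: giM.
  have {}IH (nu0 : 'X_{1..N}) : mdeg nu0 = m ->
      exists2 s' : R, s' \is m.-homog & I (m.+1, 'X_[nu] * 'X_[nu0] - x * s').
    move=> nu0E; have nu0h : ('X_[nu0] : R) \is m.-homog by rewrite dhomogX; apply/eqP.
    have [j Ij [->|[k [r [kE rk ->]]]]] := mP _ nu0h.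
      by exists 0; rewrite ?dhomog0 // mulr0 subr0 -add1n; apply: giM.
    exists ('X_[nu] * r); first by rewrite kE addnC; apply: dhomogM.
    have -> : 'X_[nu] * (j + r * x) - x * ('X_[nu] * r) = 'X_[nu] * j :> R by ring.
    by rewrite -add1n; apply: giM.
  move/dhomogP: sm => sm; rewrite [s]mpolyE.
  elim: (msupp s) sm => [|mu0 S IHS] sm.
    by exists 0; rewrite ?dhomog0 // big_nil !mulr0 subr0; apply: gi0.
  have [|s1 s1h Is1] := IHS; first by move=> ? h; apply: sm; rewrite in_cons h orbT.
  have [s2 s2h Is2] := IH mu0 (sm mu0 (mem_head _ _)).
  exists (s@_mu0 *: s2 + s1); first by rewrite rpredD ?rpredZ.
  rewrite big_cons.
  have -> : 'X_[nu] * (s@_mu0 *: 'X_[mu0] + \sum_(j <- S) s@_j *: 'X_[j]) -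
      x * (s@_mu0 *: s2 + s1) = s@_mu0 *: ('X_[nu] * 'X_[mu0] - x * s2) +
      ('X_[nu] * (\sum_(j <- S) s@_j *: 'X_[j]) - x * s1).
    by rewrite !mulrDr -!scalerAr scalerBr; ring.
  by apply: giD => //; apply: giZ.
have lin j : exists la, I (1%N, 'X_j - la *: x).
  (* There are at most [D] monomials of degree [m], so the [M + 1] reductions [s k] to degree [m]
     are linearly dependent. *)
  pose D := #|{: 'X_{1..N < m.+1}}|; pose M := (m + D)%N.
  have kP (k : 'I_M.+1) : exists s : R, s \is m.-homog /\
      I (M, 'X_j ^+ k * x ^+ (M - k) - x ^+ D * s).
    have [|s] := red D (U_(j) *+ k + U_(i) *+ (M - k))%MM.
      by rewrite mdegD !mdegMn !mdeg1 !mul1n subnKC // -ltnS.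
    by rewrite mpolyXD !mpolyXn => ? ?; exists s.
  have [s /all_and2[sh sI]] := choice kP.
  pose A := \matrix_(k < M.+1, l < D) (s k)@_(enum_val l : 'X_{1..N < m.+1}).
  have [al al0 alA] : exists2 al : 'rV_M.+1, al != 0 & al *m A = 0.
    have : kermx A != 0.
      rewrite -mxrank_eq0 mxrank_ker subn_eq0 -ltnNge ltnS.
      by apply: leq_trans (rank_leq_col A) _; apply: leq_addl.
    by move=> /rowV0Pn[al /sub_kermxP alA al0]; exists al.
  have als : \sum_k al 0 k *: s k = 0.
    apply/mpolyP => mu; rewrite mcoeff0 raddf_sum /=.
    have [muE|muN] := eqVneq (mdeg mu) m; last first.
      by apply: big1 => k _; rewrite mcoeffZ (dhomog_nemf_coeff (sh k)) ?mulr0.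
    have mum : (mdeg mu < m.+1)%N by rewrite muE.
    have /matrixP/(_ 0 (enum_rank (BMultinom mum))) := alA; rewrite !mxE => h.
    rewrite -[RHS]h; apply: eq_bigr => k _.
    by rewrite mcoeffZ !mxE enum_rankK.
  (* The homogenisation of [p] in degree [d] at 'X_j / x; a factorisation of [p] into linear factors
     carries over to it. *)
  pose H d (p : {poly C}) : R := \sum_(k < d.+1) p`_k *: ('X_j ^+ k * x ^+ (d - k)).
  pose P := \poly_(k < M.+1) al 0 (inord k).
  have HP : I (M, H M P).
    have -> : H M P = \sum_k al 0 k *: ('X_j ^+ k * x ^+ (M - k) - x ^+ D * s k).
      transitivity (H M P - x ^+ D * \sum_k al 0 k *: s k).
        by rewrite als mulr0 subr0.
      rewrite mulr_sumr -sumrB; apply: eq_bigr => k _.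
      rewrite scalerBr -scalerAr; congr (_ *: _ - _).
      by rewrite coef_poly ltn_ord inord_val.
    by apply: gi_sum => // k _; apply: giZ.
  have P0 : P != 0.
    apply: contra al0 => /eqP P0; apply/eqP/rowP => k; rewrite mxE.
    have := congr1 (fun q : {poly C} => q`_k) P0.
    by rewrite coef_poly ltn_ord inord_val coef0.
  have [rs Prs] := closed_field_poly_normal P.
  have lP : lead_coef P != 0 by rewrite lead_coef_eq0.
  have rsM : (size rs <= M)%N.
    have : (size P <= M.+1)%N by apply: size_poly.
    by rewrite Prs size_scale // size_prod_XsubC ltnS.
  have HE (S : seq C) d : (size S <= d)%N -> H d (\prod_(z <- S) ('X - z%:P)) =
      x ^+ (d - size S) * \prod_(z <- S) ('X_j - z *: x).
    elim: S d => [|z S IHS] d Sd.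
      rewrite !big_nil mulr1 subn0 /H big_ord_recl big1 ?addr0 => [|k _].
        by rewrite coef1 scale1r expr0 mul1r subn0.
      by rewrite coef1 scale0r.
    case: d Sd => // d Sd; rewrite !big_cons subSS mulrCA -IHS //.
    set Q := \prod_(z <- S) _.
    have Qd : Q`_d.+1 = 0.
      by apply: nth_default; rewrite size_prod_XsubC ltnS.
    have -> : H d.+1 (('X - z%:P) * Q) = H d.+1 ('X * Q) - z *: H d.+1 Q.
      rewrite /H scaler_sumr -sumrB; apply: eq_bigr => k _.
      by rewrite mulrBl coefB coefCM scalerA -scalerBl.
    rewrite mulrBl; congr (_ - _).
      rewrite /H big_ord_recl coefXM scale0r add0r mulr_sumr.
      apply: eq_bigr => k _; rewrite coefXM /= subSS -scalerAr; congr (_ *: _).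
      by rewrite exprS mulrA.
    rewrite -scalerAl /H big_ord_recr /= Qd scale0r addr0; congr (_ *: _).
    rewrite mulr_sumr; apply: eq_bigr => k _.
    rewrite -scalerAr subSn ?exprS; last by rewrite -ltnS.
    by congr (_ *: _); ring.
  have {HP} : I (M, lead_coef P *: x ^+ (M - size rs) * \prod_(z <- rs) ('X_j - z *: x)).
    rewrite -scalerAl -HE //; move: HP; rewrite {1}Prs /H scaler_sumr.
    suff -> : \sum_(k < M.+1) (lead_coef P *: \prod_(z <- rs) ('X - z%:P))`_k *:
        ('X_j ^+ k * x ^+ (M - k)) = \sum_(k < M.+1) lead_coef P *:
        ((\prod_(z <- rs) ('X - z%:P))`_k *: ('X_j ^+ k * x ^+ (M - k))) :> R by [].
    by apply: eq_bigr => k _; rewrite coefZ scalerA.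
  have : ~ I ((M - size rs)%N, lead_coef P *: x ^+ (M - size rs)).
    move=> /(giZ (lead_coef P)^-1 gI); rewrite scalerA mulVf // scale1r.
    exact: nIxn.
  have : lead_coef P *: x ^+ (M - size rs) \is (M - size rs).-homog by rewrite rpredZ.
  move: (lead_coef P *: x ^+ (M - size rs)) => q.
  rewrite -[in I (M, _)](subnK rsM); move: (M - size rs)%N => e.
  elim: rs q e {Prs rsM HE} => [|z S IHS] q e qe nIq.
    by rewrite big_nil mulr1 addn0 => /nIq.
  rewrite big_cons /= mulrA -addSnnS => Iq.
  have zh : 'X_j - z *: x \is 1.-homog by rewrite rpredB ?rpredZ ?dhomogX1.
  case: (pselect (I (1%N, 'X_j - z *: x))) => [?|nIz]; first by exists z.
  by apply: IHS Iq; rewrite -addn1; [apply: dhomogM|apply: maximal_prime].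
have [la laP] := choice lin.
(* Modulo [I] each 'X_j is [la j *: x], hence a form of degree [d] is its value at [la] times
   [x ^+ d], which is not in [I]. *)
have evP d p : p \is d.-homog -> I (d, p - p.@[la] *: x ^+ d).
  pose Q d p := I (d, p - p.@[la] *: x ^+ d).
  have Qmu (mu : 'X_{1..N}) : mdeg mu = d -> Q d 'X_[mu].
    elim: d mu => [|d IH] mu muE.
      have /eqP -> : mu == 0%MM by rewrite -mdeg_eq0 muE.
      by rewrite /Q mpolyX0 meval1 expr0 scale1r subrr; apply: gi0.
    have [nu [nu' [-> /eqP]]] : exists nu nu' : 'X_{1..N},
      [/\ mu = (nu + nu')%MM, mdeg nu = 1%N & mdeg nu' = d].
      by apply: mnm_split; rewrite add1n.
    rewrite mdeg_eq1 => /existsP[j /eqP ->] nuE'.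
    rewrite /Q mpolyXD mevalM mevalXU.
    have -> : 'X_j * 'X_[nu'] - (la j * 'X_[nu'].@[la]) *: x ^+ d.+1 =
      'X_j * ('X_[nu'] - 'X_[nu'].@[la] *: x ^+ d) +
      'X_[nu'].@[la] *: (x ^+ d * ('X_j - la j *: x)).
      by rewrite exprSr -!mul_mpolyC mpolyCM; ring.
    apply: giD => //; first by rewrite -add1n; apply: giM (dhomogX1 j) (IH _ nuE').
    by apply: giZ => //; rewrite -addn1; apply: giM.
  move=> /dhomogP pd; rewrite {1 2}[p]mpolyE raddf_sum /= scaler_suml -sumrB.
  apply: gi_sum => // mu mup; rewrite mevalZ -scalerA -scalerBr.
  by apply: giZ => //; apply: Qmu; apply: pd.
exists la => [|d p Ip].
  exists i; apply/eqP => la0; apply: nIx; have := laP i.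
  by rewrite la0 scale0r subr0.
have := giB gI Ip (evP _ _ (gi_homog gI Ip)); rewrite opprB addrC subrK => Ix.
apply/eqP; apply: contraT => p0; case: (nIxn d).
by move/(giZ p.@[la]^-1 gI): Ix; rewrite scalerA mulVf // scale1r.
Qed.

End Maximal.

Lemma projective_nullstellensatz J : gideal J -> proper J ->
  exists2 la : 'I_N -> C, (exists i, la i != 0) & forall d p, J (d, p) -> p.@[la] = 0.
Proof.
move=> gJ pJ; have [I [gI pI JI Imax]] := gideal_maximal gJ pJ.
have [la la0 laP] := maximal_root gI pI Imax; exists la => // d p /JI; exact: laP.
Qed.

End GradedIdeal.

(** * Morphisms onto closures of unirational cones *)

Definition msubst (C : comNzRingType) (N n : nat) (f : 'I_N -> {mpoly C[n]})
  (p : {mpoly C[N]}) : {mpoly C[n]} := mmap (@mpolyC n C) f p.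

HB.instance Definition _ (C : comNzRingType) (N n : nat) (f : 'I_N -> {mpoly C[n]}) :=
  GRing.RMorphism.copy (msubst f) (mmap (@mpolyC n C) f).

Lemma msubstZ (C : comNzRingType) (N n : nat) (f : 'I_N -> {mpoly C[n]}) c p :
  msubst f (c *: p) = c *: msubst f p.
Proof. by rewrite /msubst mmapZ mul_mpolyC. Qed.

Lemma msubstX (C : comNzRingType) (N n : nat) (f : 'I_N -> {mpoly C[n]}) i :
  msubst f 'X_i = f i.
Proof. by rewrite /msubst mmapX mmap1U. Qed.

Lemma msubstC (C : comNzRingType) (N n : nat) (f : 'I_N -> {mpoly C[n]}) c :
  msubst f c%:MP = c%:MP.
Proof. by rewrite /msubst mmapC. Qed.

Lemma meval_msubst (C : comNzRingType) (N n : nat) (f : 'I_N -> {mpoly C[n]}) p v :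
  (msubst f p).@[v] = p.@[fun i => (f i).@[v]].
Proof.
elim/mpoly_ring_ind: p => [c|i|p q IHp IHq|p q IHp IHq].
- by rewrite msubstC !mevalC.
- by rewrite msubstX mevalXU.
- by rewrite rmorphD !mevalD IHp IHq.
- by rewrite rmorphM !mevalM IHp IHq.
Qed.

Lemma msubst_comp (C : comNzRingType) (N n m : nat) (f : 'I_N -> {mpoly C[n]})
    (g : 'I_n -> {mpoly C[m]}) p :
  msubst g (msubst f p) = msubst (fun i => msubst g (f i)) p.
Proof.
elim/mpoly_ring_ind: p => [c|i|p q IHp IHq|p q IHp IHq].
- by rewrite !msubstC.
- by rewrite !msubstX.
- by rewrite !rmorphD /= IHp IHq.
- by rewrite !rmorphM /= IHp IHq.
Qed.

Lemma meval_homogZ (C : comNzRingType) (N d : nat) (p : {mpoly C[N]}) (a : C)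
    (x : 'I_N -> C) :
  p \is d.-homog -> p.@[fun i => a * x i] = a ^+ d * p.@[x].
Proof.
move=> /dhomogP pd; rewrite !mevalE mulr_sumr; apply: eq_big_seq => m /pd /= <-.
rewrite mulrCA; congr (_ * _); rewrite mdegE -prodrXr -big_split /=.
by apply: eq_bigr => i _; rewrite exprMn.
Qed.

Lemma msubst_homogZ (C : comNzRingType) (N n d : nat) (p : {mpoly C[N]})
    (a : {mpoly C[n]}) (f : 'I_N -> {mpoly C[n]}) :
  p \is d.-homog -> msubst (fun i => f i * a) p = msubst f p * a ^+ d.
Proof.
move=> /dhomogP pd; rewrite /msubst /mmap mulr_suml; apply: eq_big_seq => m /pd /= <-.
rewrite -mulrA; congr (_ * _); rewrite mdegE -prodrXr -big_split /=.
by apply: eq_bigr => i _; rewrite exprMn.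
Qed.

Lemma dhomog_msubst (C : comNzRingType) (N n d e : nat) (f : 'I_N -> {mpoly C[n]}) p :
  (forall i, f i \is d.-homog) -> p \is e.-homog -> msubst f p \is (d * e).-homog.
Proof.
move=> fd /dhomogP pe; rewrite /msubst /mmap big_seq; apply: rpred_sum => m /pe /= <-.
rewrite mul_mpolyC rpredZ // mdegE big_distrr /= /mmap1.
elim/big_rec2: _ => [|i k q _ IH]; first exact: dhomog1.
by apply: dhomogM => //; apply: dhomogMn.
Qed.

Lemma dhomog_prod_ord (C : comNzRingType) (N t m : nat) (F : 'I_m -> {mpoly C[N]}) :
  (forall i, F i \is t.-homog) -> \prod_i F i \is (t * m).-homog.
Proof.
elim: m F => [|m IH] F Fh; first by rewrite big_ord0 muln0 dhomog1.
by rewrite big_ord_recl mulnS; apply: dhomogM => //; apply: IH.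
Qed.

Section Coordinates.
Variables (C : fieldType) (V : vectType C).

Definition vec (x : 'I_(\dim {:V}) -> C) : V := \sum_i x i *: (vbasis {:V})`_i.

Lemma coords_vec x : coords (vec x) = x.
Proof.
apply/funext => i; apply: coord_sum_free.
exact: basis_free (vbasisP _).
Qed.

Lemma vec_coords v : vec (coords v) = v.
Proof. by rewrite [RHS](coord_vbasis (memvf v)). Qed.

Lemma coordsZ a (v : V) : coords (a *: v) = (fun i => a * @coords C V v i).
Proof. by apply/funext => i; rewrite /coords linearZ. Qed.

Lemma coords0_eq0 (v : V) : (forall i, @coords C V v i = 0) -> v = 0.
Proof. by move=> v0; rewrite -[v]vec_coords /vec big1 // => i _; rewrite v0 scale0r. Qed.

Lemma vecZ a x : vec (fun i => a * x i) = a *: vec x.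
Proof. by rewrite /vec scaler_sumr; apply: eq_bigr => i _; rewrite scalerA. Qed.

Lemma proj_gen (L : proj V) : exists2 v : V, v != 0 & val L = <[v]>%VS.
Proof.
case: L => L /= dL; have L0 : L != 0%VS by rewrite -dimv_eq0 (eqP dL).
exists (vpick L); first by rewrite vpick0.
apply/eqP; rewrite eq_sym eqEdim -memvE memv_pick /= (eqP dL).
by rewrite dim_vline vpick0 L0.
Qed.

Lemma proj_line (v : V) : v != 0 -> exists L : proj V, val L = <[v]>%VS.
Proof.
move=> v0; have dv : \dim <[v]> == 1%N by rewrite dim_vline v0.
by exists (exist (fun L : {vspace V} => \dim L == 1%N) _ dv).
Qed.

Lemma vanishes_line d (p : {mpoly C[\dim {:V}]}) (L : proj V) (v : V) :
  p \is d.-homog -> val L = <[v]>%VS -> (vanishes_at p L <-> p.@[coords v] = 0).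
Proof.
move=> pd Lv; split=> [|p0 u]; first by apply; rewrite Lv memv_line.
by rewrite Lv => /vlineP[a ->]; rewrite coordsZ (meval_homogZ _ _ pd) p0 mulr0.
Qed.

Lemma vlineZ a (v : V) : a != 0 -> <[a *: v]>%VS = <[v]>%VS.
Proof.
move=> a0; apply/eqP; rewrite eqEsubv -!memvE; apply/andP; split.
  by rewrite memvZ // memv_line.
by rewrite -{1}[v]scale1r -(mulVf a0) -scalerA memvZ // memv_line.
Qed.

End Coordinates.

Section ProjectiveMorphism.
Variables (C : closedFieldType) (n : nat) (V W : vectType C).
Variables (SX : proj V -> Prop) (SY : proj W -> Prop).
Local Notation N := (\dim {:V}).
Local Notation K := (\dim {:W}).
Variables (f : 'I_N -> {mpoly C[n]}) (h : 'I_K -> {mpoly C[n]}).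
Hypothesis SXP : forall d p, p \is d.-homog ->
  ((forall L, SX L -> vanishes_at p L) <-> msubst f p = 0).
Hypothesis SYP : forall d p, p \is d.-homog ->
  ((forall L, SY L -> vanishes_at p L) <-> msubst h p = 0).
Variables (d r : nat) (q : 'I_r -> {mpoly C[n]}) (Q : 'I_K -> 'I_r -> {mpoly C[N]}).
Hypothesis d_gt0 : (0 < d)%N.
Hypothesis q_neq0 : exists l, q l != 0.
Hypothesis Qh : forall k l, Q k l \is d.-homog.
Hypothesis Qf : forall k l, msubst f (Q k l) = h k * q l.
Hypothesis fQ : forall mu : 'X_{1..N}, mdeg mu = d -> exists be : 'I_K -> 'I_r -> C,
  msubst f 'X_[mu] = \sum_k \sum_l be k l *: (h k * q l).

Lemma closureXP (L : proj V) (v : V) : val L = <[v]>%VS ->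
  (zariski_closure SX L <-> forall e p, p \is e.-homog -> msubst f p = 0 -> p.@[coords v] = 0).
Proof.
move=> Lv; split=> [XL e p pe fp|XL e p pe SXp]; apply/(vanishes_line pe Lv).
  by apply: (XL e) => //; apply/(SXP pe).
by apply: (XL _ _ pe); apply/(SXP pe).
Qed.

Lemma closureYP (L : proj W) (v : W) : val L = <[v]>%VS ->
  (zariski_closure SY L <-> forall e p, p \is e.-homog -> msubst h p = 0 -> p.@[coords v] = 0).
Proof.
move=> Lv; split=> [XL e p pe fp|XL e p pe SXp]; apply/(vanishes_line pe Lv).
  by apply: (XL e) => //; apply/(SYP pe).
by apply: (XL _ _ pe); apply/(SYP pe).
Qed.

(** On the parametrised cone [Q k l] becomes [h k * q l], so this is the point [h] up to the factor
    [q l]; it yields the image of the line of [v] wherever it is nonzero. *)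
Definition evQ (v : V) (l : 'I_r) : W := vec (fun k => (Q k l).@[coords v]).

Lemma evQZ a (v : V) l : evQ (a *: v) l = a ^+ d *: evQ v l.
Proof.
by rewrite /evQ -vecZ; congr vec; apply/funext => k; rewrite coordsZ (meval_homogZ _ _ (Qh k l)).
Qed.

(** By [fQ] the forms [Q k l] span all forms of degree [d] modulo the relations between the [f i];
    if all vanished at [v], so would the [d]-th powers of its coordinates. *)
Lemma evQ_neq0 (L : proj V) (v : V) : v != 0 -> val L = <[v]>%VS -> zariski_closure SX L ->
  exists l, evQ v l != 0.
Proof.
move=> v0 Lv /(closureXP Lv) XL; apply: contrapT => nl.
have Q0 k l : (Q k l).@[coords v] = 0.
  have : evQ v l = 0 by apply/eqP; apply: contrapT => /negP h'; apply: nl; exists l.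
  by move=> /(congr1 (@coords _ _)); rewrite coords_vec => /(congr1 (@^~ k)) ->; rewrite /coords linear0.
move/eqP: v0; apply; apply: coords0_eq0 => i; apply/eqP.
have dX : mdeg (U_(i) *+ d)%MM = d by rewrite mdegMn mdeg1 mul1n.
have [be beE] := fQ dX.
pose P := 'X_[U_(i) *+ d] - \sum_k \sum_l be k l *: Q k l.
have Ph : P \is d.-homog.
  apply: rpredB; first by rewrite dhomogX; apply/eqP.
  by apply: rpred_sum => k _; apply: rpred_sum => l _; apply: rpredZ.
have /(XL _ _ Ph) : msubst f P = 0.
  rewrite rmorphB /= beE rmorph_sum -sumrB big1 // => k _.
  by rewrite rmorph_sum -sumrB big1 // => l _; rewrite /= msubstZ Qf subrr.
rewrite mevalB (raddf_sum (meval (coords v))) big1 => [|k _]; last first.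
  by rewrite raddf_sum big1 // => l _; rewrite /= mevalZ Q0 mulr0.
by rewrite subr0 -mpolyXn rmorphXn /= mevalXU => /eqP; rewrite expf_eq0 d_gt0.
Qed.

(** The 2 x 2 minors of the matrix [Q] become those of the rank one matrix with entries [h k * q l],
    so they vanish on the closure. *)
Lemma evQ_prop (L : proj V) (v : V) l l' : val L = <[v]>%VS -> zariski_closure SX L ->
  evQ v l != 0 -> evQ v l' != 0 -> <[evQ v l]>%VS = <[evQ v l']>%VS.
Proof.
move=> Lv /(closureXP Lv) XL l0 l0'.
have cr k k' : (Q k l).@[coords v] * (Q k' l').@[coords v] =
   (Q k' l).@[coords v] * (Q k l').@[coords v].
  apply/eqP; rewrite -subr_eq0 -!mevalM -mevalB; apply/eqP; apply: (XL (d + d)%N).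
    by rewrite rpredB // dhomogM.
  by rewrite rmorphB !rmorphM /= !Qf; ring.
have [k0 k0P] : exists k, (Q k l').@[coords v] != 0.
  apply: contrapT => nk; case/eqP: l0'; apply: coords0_eq0 => k; rewrite coords_vec.
  by apply/eqP; apply: contrapT => /negP ?; apply: nk; exists k.
have E : (Q k0 l').@[coords v] *: evQ v l = (Q k0 l).@[coords v] *: evQ v l'.
  rewrite /evQ -!vecZ; congr vec; apply/funext => k.
  by rewrite mulrC cr.
have k0P' : (Q k0 l).@[coords v] != 0.
  apply: contra l0 => /eqP k00; move/eqP: E; rewrite k00 scale0r scaler_eq0.
  by rewrite (negbTE k0P).
by rewrite -(vlineZ _ k0P) E vlineZ.
Qed.

Lemma evQ_closure (L : proj V) (v : V) l (L' : proj W) : val L = <[v]>%VS ->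
  zariski_closure SX L -> val L' = <[evQ v l]>%VS -> zariski_closure SY L'.
Proof.
move=> Lv /(closureXP Lv) XL L'v; apply/(closureYP L'v) => e p pe hp; rewrite coords_vec.
rewrite -(@meval_msubst _ _ _ (Q^~ l)); apply: (XL (d * e)%N).
  by apply: dhomog_msubst.
rewrite msubst_comp (_ : (fun i => _) = (fun i => h i * q l)); last by apply/funext.
by rewrite (msubst_homogZ _ _ pe) hp mul0r.
Qed.

(** * Nonempty fibres over the points of the closure *)

Section Surjective.
Variable y : 'I_K -> C.
Hypothesis yY : forall e p, p \is e.-homog -> msubst h p = 0 -> p.@[y] = 0.
Variable k0 : 'I_K.
Hypothesis yk0 : y k0 != 0.

Definition qmon t (be : t.-tuple 'I_r) := \prod_(l <- be) q l.

(** The products of t of the [q l] with coefficients forms of degree t in the [h k]; when [b] holds,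
    these forms must moreover vanish at [y]. *)
Definition hspan (b : bool) (t : nat) (F : {mpoly C[n]}) : Prop :=
  exists2 S : t.-tuple 'I_r -> {mpoly C[K]},
    forall be, S be \is t.-homog /\ (b ==> ((S be).@[y] == 0))
    & F = \sum_be msubst h (S be) * qmon be.

Lemma hspan0 b t : hspan b t 0.
Proof.
exists (fun=> 0) => [be|]; first by rewrite dhomog0 meval0 eqxx implybT.
by rewrite big1 // => be _; rewrite rmorph0 mul0r.
Qed.

Lemma hspanD b t F G : hspan b t F -> hspan b t G -> hspan b t (F + G).
Proof.
move=> [S SP ->] [S' SP' ->]; exists (fun be => S be + S' be) => [be|].
  have [? /implyP Sy] := SP be; have [? /implyP S'y] := SP' be.
  rewrite rpredD //; split=> //; apply/implyP => bT.
  by rewrite mevalD (eqP (Sy bT)) (eqP (S'y bT)) addr0.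
by rewrite -big_split; apply: eq_bigr => be _; rewrite rmorphD mulrDl.
Qed.

Lemma hspan_sum b t (I : Type) (s : seq I) (P : pred I) F :
  (forall i, P i -> hspan b t (F i)) -> hspan b t (\sum_(i <- s | P i) F i).
Proof.
move=> HF; elim/big_ind: _ => //; [exact: hspan0|exact: hspanD].
Qed.

Lemma hspanM1 b t (s : {mpoly C[K]}) be : s \is t.-homog -> b ==> (s.@[y] == 0) ->
  hspan b t (msubst h s * @qmon t be).
Proof.
move=> sh sy; exists (fun be' => if be' == be then s else 0) => [be'|].
  by case: ifP => // _; rewrite dhomog0 meval0 eqxx implybT.
rewrite (bigD1 be) //= eqxx big1 ?addr0 // => be' /negbTE ->.
by rewrite rmorph0 mul0r.
Qed.

Lemma hspanMl b b' t F (s : {mpoly C[K]}) l : s \is 1.-homog -> b' ==> b || (s.@[y] == 0) ->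
  hspan b t F -> hspan b' t.+1 (F * (msubst h s * q l)).
Proof.
move=> sh sy [S SP ->]; rewrite mulr_suml; apply: hspan_sum => be _.
have [Sh Sy] := SP be.
have -> : msubst h (S be) * qmon be * (msubst h s * q l) =
    msubst h (S be * s) * @qmon t.+1 [tuple of l :: be].
  by rewrite /qmon /= big_cons rmorphM /=; ring.
apply: hspanM1; first by rewrite -addn1; apply: dhomogM.
apply/implyP => /(implyP sy); rewrite mevalM mulf_eq0 => /orP[bT|->]; last by rewrite orbT.
by rewrite (implyP Sy).
Qed.

Lemma hspan_homog t p : p \is (d * t).-homog -> hspan false t (msubst f p).
Proof.
have hZ c F : hspan false t F -> hspan false t (c *: F).
  move=> [S SP ->]; exists (fun be => c *: S be) => [be|].
    by have [Sh _] := SP be; rewrite rpredZ.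
  by rewrite scaler_sumr; apply: eq_bigr => be _; rewrite msubstZ scalerAl.
move=> /dhomogP ph; rewrite [p]mpolyE rmorph_sum /= big_seq.
apply: hspan_sum => mu /ph /= {ph} muE; rewrite msubstZ; apply: hZ.
elim: t mu muE => [|t IH] mu muE.
  have /eqP -> : mu == 0%MM by rewrite -mdeg_eq0 muE muln0.
  have -> : msubst f 'X_[0] = msubst h 1 * @qmon 0 [tuple].
    by rewrite mpolyX0 !rmorph1 /qmon big_nil mulr1.
  by apply: hspanM1 => //; apply: dhomog1.
have [nu [nu' [-> nuE nuE']]] : exists nu nu' : 'X_{1..N},
    [/\ mu = (nu + nu')%MM, mdeg nu = (d * t)%N & mdeg nu' = d].
  by apply: mnm_split; rewrite muE mulnSr.
have [be beE] := fQ nuE'.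
rewrite mpolyXD rmorphM /= beE mulr_sumr; apply: hspan_sum => k _.
rewrite mulr_sumr; apply: hspan_sum => l _.
have -> : be k l *: (h k * q l) = msubst h (be k l *: 'X_k) * q l.
  by rewrite msubstZ msubstX scalerAl.
apply: (@hspanMl false) => //; last exact: IH.
by rewrite rpredZ // dhomogX1.
Qed.

(* Nakayama: otherwise [h k0 ^+ t * qmon be] is, for every [be], a combination of  *)
(* the [qmon be'] with coefficients vanishing at [y]; the determinant trick then   *)
(* gives a relation between the [h k] which does not vanish at [y].                *)
Lemma nakayama_hspan t : ~ (forall be : t.-tuple 'I_r, hspan true t (h k0 ^+ t * qmon be)).
Proof.
move=> hs; have /choice[S SP] (be : t.-tuple 'I_r) : exists S : t.-tuple 'I_r -> {mpoly C[K]},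
    (forall be', S be' \is t.-homog /\ (S be').@[y] = 0) /\
    h k0 ^+ t * qmon be = \sum_be' msubst h (S be') * qmon be'.
  by have [S SP SE] := hs be; exists S; split=> // be'; have [? /eqP] := SP be'.
pose m := #|{: t.-tuple 'I_r}|.
pose ev (i : 'I_m) : t.-tuple 'I_r := enum_val i.
pose A : 'M_m := \matrix_(i, j) (('X_k0 ^+ t) *+ (i == j) - S (ev i) (ev j)).
have Ah : \det A \is (t * m).-homog.
  rewrite /determinant; apply: rpred_sum => /= s _.
  rewrite mulr_sign; suff h1 : \prod_i A i (s i) \is (t * m).-homog.
    by case: (odd_perm _); rewrite ?rpredN.
  apply: dhomog_prod_ord => i; rewrite mxE; have [Sh _] := (SP (ev i)).1 (ev (s i)).
  rewrite rpredB // rpredMn // -{2}[t]mul1n.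
  by apply: dhomogMn; apply: dhomogX1.
have Ay : (\det A).@[y] = (y k0 ^+ t) ^+ m.
  rewrite -det_map_mx -det_scalar; congr (\det _); apply/matrixP => i j; rewrite !mxE.
  have [_ S0] := (SP (ev i)).1 (ev j).
  by rewrite rmorphB rmorphMn rmorphXn /= S0 subr0 mevalXU.
suff : (\det A).@[y] = 0.
  by rewrite Ay => /eqP; rewrite !expf_eq0 (negbTE yk0) !andbF.
apply: yY Ah _.
pose u := \col_i qmon (ev i) : 'cV_m.
have Au : map_mx (msubst h) A *m u = 0.
  apply/matrixP => i j; rewrite !mxE.
  under eq_bigr => k _ do rewrite !mxE rmorphB rmorphMn rmorphXn /= msubstX mulrBl.
  rewrite sumrB (bigD1 i) //= eqxx big1 ?addr0 => [|k ki]; last first.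
    by rewrite eq_sym (negbTE ki) mul0r.
  rewrite (SP (ev i)).2 (reindex ev) /= ?subrr //.
  by exists enum_rank => x _; rewrite /ev ?enum_valK ?enum_rankK.
have := mul_adj_mx (map_mx (msubst h) A).
move=> /(congr1 (fun B => B *m u)); rewrite -mulmxA Au mulmx0 mul_scalar_mx det_map_mx.
have [l ql] := q_neq0.
(* The determinant kills every [qmon]; that of the constant tuple at [l] is nonzero, and polynomials
   form a domain. *)
move=> /colP/(_ (enum_rank (nseq_tuple t l))); rewrite !mxE /ev enum_rankK => /esym/eqP.
rewrite mulf_eq0 => /orP[/eqP //|]; rewrite /qmon.
by rewrite prodf_seq_eq0 => /hasP[l' /nseqP[-> _] /=]; rewrite (negbTE ql).
Qed.

(** The ideal of the fibre over [y], generated by the [y k0 *: Q k l - y k *: Q k0 l] together with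
    all relations between the [f i]. The relations are included by comparing only after substitution
    of [f], and they put the zeros in the closure. *)
Definition compat_ideal (x : nat * {mpoly C[N]}) : Prop :=
  x.2 \is x.1.-homog /\ exists2 g : 'I_K -> 'I_r -> {mpoly C[N]},
    forall k l m, m \in msupp (g k l) -> (mdeg m + d)%N = x.1
    & msubst f x.2 =
      \sum_k \sum_l msubst f (g k l) * ((y k0 *: h k - y k *: h k0) * q l).

Lemma gideal_compat : gideal compat_ideal.
Proof.
split=> [e p []//|e|e p p' [/= ph [g gh gE]] [/= ph' [g' gh' gE']]|e' s e p sh [/= ph [g gh gE]]].
- split; first exact: dhomog0.
  exists (fun _ _ => 0) => [k l m|]; first by rewrite msupp0.
  by rewrite /= rmorph0 big1 // => k _; rewrite big1 // => l _; rewrite ?rmorph0 mul0r.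
- split; first exact: rpredD.
  exists (fun k l => g k l + g' k l) => [k l m|/=].
    by move/msuppD_le; rewrite mem_cat => /orP[/gh|/gh'].
  rewrite rmorphD /= gE gE' -big_split; apply: eq_bigr => k _ /=.
  rewrite -big_split; apply: eq_bigr => l _; by rewrite rmorphD /= [in RHS]mulrDl.
- split; first exact: dhomogM.
  exists (fun k l => s * g k l) => [k l m|/=].
    move=> /msuppM_le/allpairsP[[m1 m2] /= [m1s m2g ->]].
    by rewrite mdegD -addnA (gh _ _ _ m2g) (dhomogP _ _ _ sh _ m1s).
  rewrite rmorphM /= gE mulr_sumr; apply: eq_bigr => k _; rewrite mulr_sumr.
  by apply: eq_bigr => l _; rewrite rmorphM /= mulrA.
Qed.

(** If a whole degree m0 lay in the ideal, then so would a product of t = m0 + 1 forms [Q k0 l], of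
    degree d t, which becomes [h k0 ^+ t] times a [qmon]. Its cofactors [g] have degree d (t - 1),
    so [hspan_homog] turns this membership into the situation excluded by [nakayama_hspan]. *)
Lemma proper_compat : proper compat_ideal.
Proof.
move=> m0; apply: contrapT => h0.
have all0 p : p \is m0.-homog -> compat_ideal (m0, p).
  by move=> ph; apply: contrapT => nc; apply: h0; exists p.
have all1 p : p \is (d * m0.+1).-homog -> compat_ideal ((d * m0.+1)%N, p).
  move=> ph; apply: (gi_mon gideal_compat _ ph) => mu muE {p ph}.
  have m0d : (m0 <= d * m0.+1)%N by rewrite (leq_trans (leqnSn _)) // leq_pmull.
  have [|nu [nu' [-> nuE nuE']]] := @mnm_split N mu (d * m0.+1 - m0) m0.
    by rewrite subnK.
  rewrite mpolyXD -[(d * m0.+1)%N](subnK m0d); apply: (giM gideal_compat).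
    by rewrite dhomogX; apply/eqP.
  by apply: all0; rewrite dhomogX; apply/eqP.
apply: (@nakayama_hspan m0.+1) => be.
have Ph : \prod_(i < m0.+1) Q k0 (tnth be i) \is (d * m0.+1).-homog.
  exact: dhomog_prod_ord.
have [_ [g gh gE]] := all1 _ Ph.
have -> : h k0 ^+ m0.+1 * qmon be = msubst f (\prod_(i < m0.+1) Q k0 (tnth be i)).
  have -> : h k0 ^+ m0.+1 = \prod_(i < m0.+1) h k0 by rewrite prodr_const card_ord.
  rewrite rmorph_prod /qmon big_tuple -big_split.
  by apply: eq_bigr => i _; rewrite /= Qf.
rewrite gE; apply: hspan_sum => k _; apply: hspan_sum => l _.
have -> : y k0 *: h k - y k *: h k0 = msubst h (y k0 *: 'X_k - y k *: 'X_k0).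
  by rewrite rmorphB /= !msubstZ !msubstX.
apply: (@hspanMl false).
- by rewrite rpredB // rpredZ // dhomogX1.
- by rewrite mevalB !mevalZ !mevalXU mulrC subrr eqxx.
apply: hspan_homog; apply/dhomogP => m /gh /=.
by rewrite mulnS addnC => /eqP; rewrite eqn_add2l => /eqP.
Qed.

Lemma evQ_surj : exists2 v : V, v != 0 &
  (forall e p, p \is e.-homog -> msubst f p = 0 -> p.@[coords v] = 0) /\
  forall l, evQ v l != 0 -> <[evQ v l]>%VS = <[vec y]>%VS.
Proof.
have [x [i xi] xP] := projective_nullstellensatz gideal_compat proper_compat.
exists (vec x); rewrite ?coords_vec.
  by apply: contra xi => /eqP x0; rewrite -[x]coords_vec x0 /coords linear0.
split=> [e p pe fp|l l0].
  apply: (xP e); split=> //; exists (fun _ _ => 0) => [k l m|]; first by rewrite msupp0.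
  by rewrite /= fp big1 // => k _; rewrite big1 // => l _; rewrite ?rmorph0 mul0r.
have cr k : y k0 * (Q k l).@[x] = y k * (Q k0 l).@[x].
  apply/eqP; rewrite -subr_eq0 -!mevalZ -mevalB; apply/eqP; apply: (xP d).
  split=> /=; first by apply: rpredB; apply: rpredZ; apply: Qh.
  exists (fun k' l' => ((k' == k) && (l' == l))%:R%:MP) => [k' l' m|/=].
    case: (_ && _); last by rewrite msupp0.
    by rewrite msupp1 inE => /eqP ->; rewrite mdeg0.
  rewrite (bigD1 k) //= [X in _ = _ + X]big1 ?addr0 => [|k' /negbTE ->]; last first.
    by rewrite big1 // => l' _; rewrite mpolyC0 rmorph0 mul0r.
  rewrite (bigD1 l) //= [X in _ = _ + X]big1 ?addr0 => [|l' /negbTE ->]; last first.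
    by rewrite andbF mpolyC0 rmorph0 mul0r.
  by rewrite !eqxx mpolyC1 rmorph1 mul1r rmorphB /= !msubstZ !Qf mulrBl !scalerAl.
have E : y k0 *: evQ (vec x) l = (Q k0 l).@[x] *: vec y.
  rewrite /evQ -!vecZ coords_vec; congr vec; apply/funext => k.
  by rewrite cr mulrC.
have Q0 : (Q k0 l).@[x] != 0.
  apply: contra l0 => /eqP Q0; move/eqP: E; rewrite Q0 scale0r scaler_eq0.
  by rewrite (negbTE yk0).
by rewrite -(vlineZ _ yk0) E vlineZ.
Qed.

End Surjective.

Lemma closure_surjection :
  exists phi : {L | zariski_closure SX L} -> {L | zariski_closure SY L},
    is_morphism phi /\ forall y, exists x, phi x = y.
Proof.
have /choice[phi phiP] (L : {L | zariski_closure SX L}) :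
    exists L' : {L | zariski_closure SY L},
      forall v l, v \in val (sval L) -> evQ v l != 0 -> val (sval L') = <[evQ v l]>%VS.
  case: L => L XL /=; have [v v0 Lv] := proj_gen L.
  have [l l0] := evQ_neq0 v0 Lv XL; have [L' L'v] := proj_line l0.
  exists (exist _ L' (evQ_closure Lv XL L'v)) => u l'.
  rewrite Lv => /vlineP[a ->]; rewrite evQZ scaler_eq0 negb_or => /andP[a0 l0'].
  by rewrite vlineZ //= L'v; apply: (evQ_prop Lv XL).
exists phi; split=> [[L XL]|[L' YL']].
  have [v v0 Lv] := proj_gen L; have [l l0] := evQ_neq0 v0 Lv XL.
  exists d, (Q^~ l); split=> [k||L1 u uL1 [k Qk]]; first exact: Qh.
    have [k Qk] : exists k, (Q k l).@[coords v] != 0.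
      apply: contrapT => nk; case/eqP: l0; apply: coords0_eq0 => k; rewrite coords_vec.
      by apply/eqP; apply: contrapT => /negP ?; apply: nk; exists k.
    by exists k => /(vanishes_line (Qh k l) Lv)/eqP; rewrite (negbTE Qk).
  apply: (phiP L1 u l uL1).
  apply: contra Qk => /eqP /(congr1 (fun w => coords w k)).
  by rewrite coords_vec /coords linear0 => ->.
have [w w0 L'w] := proj_gen L'.
have [k0 yk0] : exists k, coords w k != 0.
  apply: contrapT => nk; case/eqP: w0; apply: coords0_eq0 => k.
  by apply/eqP; apply: contrapT => /negP ?; apply: nk; exists k.
have yY := (closureYP L'w).1 YL'.
have [v v0 [XL vP]] := evQ_surj yY yk0.
have [L Lv] := proj_line v0; have XL' := (closureXP Lv).2 XL.
exists (exist _ L XL').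
have [l l0] := evQ_neq0 v0 Lv XL'.
have E : sval (phi (exist _ L XL')) = L'.
  apply: val_inj => /=; rewrite L'w -[w in RHS]vec_coords -(vP l l0).
  by apply: phiP => //=; rewrite Lv memv_line.
by case: (phi _) E => L2 XL2 /= E; apply: eq_exist.
Qed.

End ProjectiveMorphism.

(** * Cones stable under one-parameter groups *)

Section ExpClosure.
Variables (C : numFieldType) (n : nat) (V : vectType C).
Local Notation N := (\dim {:V}).
Variable f : 'I_N -> {mpoly C[n]}.

Definition in_cone (w : V) : Prop :=
  forall d p, p \is d.-homog -> msubst f p = 0 -> p.@[coords w] = 0.

Lemma euler_homog d (p : {mpoly C[N]}) : p \is d.-homog ->
  \sum_i 'X_i * p^`M(i) = p *+ d.
Proof.
move=> /dhomogP pd; rewrite [in LHS](mpolyE p) [in RHS](mpolyE p) -sumrMnl.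
under eq_bigr do rewrite raddf_sum mulr_sumr /=.
rewrite exchange_big /=; apply: eq_big_seq => m /pd /= <-.
rewrite mdegE -sumrMnr; apply: eq_bigr => i _.
rewrite mderivZ mderivX -!scalerAr scalerMnr; congr (_ *: _).
have [->|mi] := posnP (m i); first by rewrite scale0r mulr0n.
rewrite -mpolyXD addmC submK ?scaler_nat //.
by rewrite lep1mP -lt0n.
Qed.

Variables (T : 'End(V)) (al : {mpoly C[n]}) (be : 'I_n -> {mpoly C[n]}).
Definition lfmx (i l : 'I_N) : C := coords (T (vbasis {:V})`_l) i.

Lemma coords_lfmx w i : coords (T w) i = \sum_l lfmx i l * coords w l.
Proof.
rewrite -[in LHS](vec_coords w) /vec linear_sum /coords linear_sum.
by apply: eq_bigr => l _; rewrite linearZ /= linearZ mulrC.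
Qed.

Hypothesis Tnil : forall w, iter N T w = 0.
Hypothesis Tf : forall i,
  \sum_l lfmx i l *: f l = al * f i + \sum_m be m * (f i)^`M(m).

(* The derivative of [p] along the linear vector field [T]. *)
Definition lfderiv (p : {mpoly C[N]}) : {mpoly C[N]} :=
  \sum_i \sum_l lfmx i l *: ('X_l * p^`M(i)).

Lemma lfderiv_homog d p : p \is d.-homog -> lfderiv p \is d.-homog.
Proof.
move=> /dhomogP pd; apply: rpred_sum => i _; apply: rpred_sum => l _.
apply/rpredZ/dhomogP => m /msuppM_le/allpairsP[[m1 m2] /= [+ m2p ->]].
rewrite msuppX inE => /eqP ->; rewrite mdegD mdeg1.
have /pd /= <- : (m2 + U_(i))%MM \in msupp p.
  move: m2p; rewrite !mcoeff_msupp mcoeff_mderiv.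
  by apply: contra => /eqP ->; rewrite mul0rn.
by rewrite mdegD mdeg1 addnC.
Qed.

(** By [Tf], the field [T] at the point [f] is [al] times the Euler field plus the image of the
    field sum_m be_m d/dc_m. The former multiplies a form by [al] and its degree, the latter
    differentiates the substituted form, so both preserve the relation p(f) = 0. *)
Lemma lfderiv_subst d p : p \is d.-homog -> msubst f p = 0 -> msubst f (lfderiv p) = 0.
Proof.
move=> ph p0.
transitivity (\sum_i (al * f i + \sum_m be m * (f i)^`M(m)) * msubst f p^`M(i)).
  rewrite rmorph_sum; apply: eq_bigr => i _; rewrite rmorph_sum -Tf mulr_suml.
  by apply: eq_bigr => l _; rewrite /= msubstZ rmorphM /= msubstX scalerAl.
under eq_bigr do rewrite mulrDl -mulrA -{1}(msubstX f) -rmorphM mulr_suml.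
rewrite big_split -mulr_sumr -rmorph_sum /= (euler_homog ph) rmorphMn /= p0 mul0rn mulr0.
rewrite add0r exchange_big big1 //= => m _.
under eq_bigr do rewrite -mulrA.
rewrite -mulr_sumr -(@mmap_chain _ _ _ _ f (mderiv m)).
- by rewrite -/(msubst f p) p0 raddf0 mulr0.
- by move=> c; apply: mderivC.
- by move=> x y; apply: mderivM.
Qed.

Lemma poly_eq0_derivn (p : {poly C}) : (forall k, p^`(k).[0] = 0) -> p = 0.
Proof.
move=> p0; apply/polyP => k; rewrite coef0; have := p0 k.
rewrite horner_coef0 coef_derivn addn0 ffactnn => /eqP.
by rewrite mulrn_eq0 -leqn0 leqNgt fact_gt0 => /eqP.
Qed.

(** Along the curve exp(s T) w, polynomial in s, the derivatives of [p] are the values of the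
    iterates of [lfderiv] on [p]. These vanish at s = 0, hence [p] vanishes on the whole curve, in
    particular at s = 1. *)
Lemma in_cone_exp w : in_cone w -> in_cone (nilp_exp T w).
Proof.
move=> cw d p ph p0.
pose W (i : 'I_N) := \poly_(k < N) ((k`!%:R)^-1 * coords (iter k T w) i).
pose E q := mmap polyC W q.
have WD i : (W i)^`() = \sum_l lfmx i l *: W l.
  apply/polyP => k; rewrite coef_deriv coef_poly coef_sum.
  under eq_bigr do rewrite coefZ coef_poly.
  have -> : \sum_(l < N) lfmx i l * (if (k < N)%N then (k`!%:R)^-1 * coords (iter k T w) l else 0)
     = if (k < N)%N then (k`!%:R)^-1 * coords (iter k.+1 T w) i else 0.
    case: ifP => _; last by rewrite big1 // => l _; rewrite mulr0.
    by rewrite iterS coords_lfmx mulr_sumr; apply: eq_bigr => l _; rewrite mulrCA.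
  case: (ltngtP k.+1 N) => kN.
  - rewrite -mulrnAl; congr (_ * _).
    have k0 : (k.+1%:R : C) != 0 by rewrite pnatr_eq0.
    by rewrite factS natrM invfM -mulr_natl mulrA divff // mul1r.
  - by rewrite mul0rn.
  - by rewrite mul0rn kN Tnil /coords linear0 mulr0.
have ED q : (E q)^`() = E (lfderiv q).
  rewrite /E (@mmap_chain _ _ _ _ W deriv) => [|c|x y]; [|exact: derivC|exact: derivM].
  rewrite (rmorph_sum (mmap polyC W)); apply: eq_bigr => i _.
  rewrite [X in X * _](WD i) mulr_suml [RHS]rmorph_sum; apply: eq_bigr => l _.
  by rewrite /= mmapZ rmorphM /= mmapX mmap1U mul_polyC scalerAl.
have Edn k q : (E q)^`(k) = E (iter k lfderiv q).
  by elim: k q => // k IH q; rewrite derivSn ED IH iterSr.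
have W0 i : (W i).[0] = coords w i.
  by rewrite horner_coef0 coef_poly (leq_ltn_trans _ (ltn_ord i)) // fact0 invr1 mul1r.
have E0 : E p = 0.
  apply: poly_eq0_derivn => k; rewrite Edn horner_mmap.
  rewrite (meval_eq _ W0).
  have [qh q0] : iter k lfderiv p \is d.-homog /\ msubst f (iter k lfderiv p) = 0.
    elim: k => // k [IH IH0]; rewrite iterS.
    by split; [apply: lfderiv_homog | apply: lfderiv_subst IH IH0].
  exact: cw qh q0.
have := horner_mmap W p 1; rewrite -/(E p) E0 horner0 => /esym; rewrite (_ : (fun=> _) = coords (nilp_exp T w)) //.
apply/funext => i; rewrite horner_poly /nilp_exp /coords linear_sum.
by apply: eq_bigr => k _; rewrite expr1n mulr1 linearZ.
Qed.

End ExpClosure.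

(** * Tensor products of evaluation modules *)

Lemma Vandermonde_unit (C : fieldType) (k : nat) (z : 'I_k -> C) :
  injective z -> Vandermonde k (\row_i z i) \in unitmx.
Proof.
move=> zi; rewrite unitmxE unitfE det_Vandermonde; apply/prodf_neq0 => i _.
apply/prodf_neq0 => j ij; rewrite !mxE subr_eq0 (inj_eq zi).
by rewrite -val_eqE neq_ltn ij orbT.
Qed.

Lemma power_interpolation (C : fieldType) (k : nat) (z : 'I_k -> C) (g : 'I_k -> C) :
  injective z -> exists al : 'I_k -> C, forall i, g i = \sum_m al m * z i ^+ m.
Proof.
move=> zi; pose V := Vandermonde k (\row_i z i).
pose al := (\row_i g i) *m invmx V.
exists (fun m => al 0 m) => i.
have /rowP/(_ i) : al *m V = \row_i g i by rewrite mulmxKV // Vandermonde_unit.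
by rewrite !mxE => <-; apply: eq_bigr => m _; rewrite !mxE.
Qed.

Section Tensor.
Variables (C : numFieldType) (n : nat) (a : 'I_n -> nat).
Local Notation idx := {dffun forall i : 'I_n, 'I_(a i)}.

Definition upd (k : idx) (i : 'I_n) (m : 'I_(a i)) : idx :=
  [ffun j => dfwith k m j].

Lemma updE (k : idx) i (m : 'I_(a i)) : upd k m i = m.
Proof. by rewrite ffunE dfwith_in. Qed.

Lemma upd_out (k : idx) i (m : 'I_(a i)) j : i != j -> upd k m j = k j.
Proof. by move=> ij; rewrite ffunE dfwith_out. Qed.

Lemma upd_id (k : idx) i : upd k (k i) = k.
Proof.
apply/ffunP => j; case: (eqVneq i j) => [<-|ij]; first by rewrite updE.
by rewrite upd_out.
Qed.

Lemma upd_upd (k : idx) i (m m' : 'I_(a i)) : upd (upd k m) m' = upd k m'.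
Proof.
apply/ffunP => j; case: (eqVneq i j) => [<-|ij]; first by rewrite !updE.
by rewrite !upd_out.
Qed.

Lemma updC (k : idx) i j (m : 'I_(a i)) (p : 'I_(a j)) : i != j ->
  upd (upd k m) p = upd (upd k p) m.
Proof.
move=> ij; apply/ffunP => l; case: (eqVneq j l) => [<-|jl].
  by rewrite updE upd_out // updE.
rewrite (upd_out _ _ jl); case: (eqVneq i l) => [<-|il]; first by rewrite !updE.
by rewrite !upd_out.
Qed.

Lemma factor_actE i x (u : tensor C a) (k : idx) :
  tensor_factor_act i x u k = \sum_m sl2_irr (a i) x (k i) m * u (upd k m).
Proof.
rewrite ffunE (reindex_onto (fun m => upd k m) (fun l : idx => l i)) /=.
  apply: eq_big => [m|m _]; last by rewrite updE.
  rewrite updE eqxx andbT; apply/forallP => j; apply/implyP => ji.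
  by rewrite upd_out // eq_sym.
move=> l /forallP lk; apply/ffunP => j; case: (eqVneq i j) => [<-|ij]; first by rewrite updE.
by rewrite upd_out //; have /implyP := lk j; rewrite eq_sym => /(_ ij)/eqP.
Qed.

Lemma factor_act_comm i j x y (u : tensor C a) : i != j ->
  tensor_factor_act i x (tensor_factor_act j y u) =
  tensor_factor_act j y (tensor_factor_act i x u).
Proof.
move=> ij; apply/ffunP => k; rewrite !factor_actE.
under eq_bigr => m _ do rewrite factor_actE upd_out // mulr_sumr.
rewrite exchange_big /=; apply: eq_bigr => p _.
rewrite factor_actE mulr_sumr upd_out 1?eq_sym //; apply: eq_bigr => m _.
by rewrite mulrCA updC.
Qed.

Lemma factor_act_same i x y (u : tensor C a) k :
  tensor_factor_act i x (tensor_factor_act i y u) k =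
  \sum_m (sl2_irr (a i) x *m sl2_irr (a i) y) (k i) m * u (upd k m).
Proof.
rewrite factor_actE; under eq_bigr => m _ do rewrite factor_actE updE mulr_sumr.
rewrite exchange_big /=; apply: eq_bigr => p _; rewrite mxE mulr_suml.
by apply: eq_bigr => m _; rewrite upd_upd mulrA.
Qed.

Fact sl2_h_subproof : \tr (delta_mx 0 0 - delta_mx 1 1 : 'M[C]_2) == 0.
Proof.
by rewrite /mxtrace big_ord_recl big_ord1 !mxE /= subr0 sub0r subrr.
Qed.

Definition sl2_h : sl2 C := exist (fun x : 'M[C]_2 => \tr x == 0) _ sl2_h_subproof.

(** The relation [x, y] = c w as operators on all irreducible modules. The scalar stands apart since
    [sl2 C] is a bare subtype of matrices. *)
Definition bracket_rel (x y w : sl2 C) (c : C) : Prop :=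
  forall b, sl2_irr b x *m sl2_irr b y = sl2_irr b y *m sl2_irr b x + c *: sl2_irr b w.

Lemma sl2_irr_e b k l : sl2_irr b (sl2_e C) k l = (k == l.+1 :> nat)%:R.
Proof. by rewrite !mxE /= !mul0r !addr0 mul1r. Qed.

Lemma sl2_irr_f b k l :
  sl2_irr b (sl2_f C) k l = (l * (b - l))%:R * (l == k.+1 :> nat)%:R.
Proof. by rewrite !mxE /= !mul0r add0r addr0 mul1r. Qed.

Lemma sl2_irr_h b k l :
  sl2_irr b sl2_h k l = ((2 * l)%:R - b.-1%:R) * (k == l)%:R.
Proof. by rewrite !mxE /= !subr0 !mul0r !add0r mul1r. Qed.

Lemma sl2_irrE b (x : sl2 C) : sl2_irr b x =
  val x 0 1 *: sl2_irr b (sl2_e C) + val x 1 0 *: sl2_irr b (sl2_f C)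
  + val x 0 0 *: sl2_irr b sl2_h.
Proof.
apply/matrixP => k l; rewrite [RHS]mxE [X in X + _]mxE [X in X + _ + _]mxE [X in _ + X + _]mxE.
rewrite [X in _ + X]mxE sl2_irr_e sl2_irr_f sl2_irr_h !mxE mulrA.
by congr (_ + _ + _); rewrite mulrA.
Qed.

Lemma bracket_ee : bracket_rel (sl2_e C) (sl2_e C) (sl2_e C) 0.
Proof. by move=> b; rewrite scale0r addr0. Qed.

Lemma bracket_he : bracket_rel sl2_h (sl2_e C) (sl2_e C) 2%:R.
Proof.
move=> b; apply/matrixP => k l; rewrite [LHS]mxE [RHS]mxE [X in X + _]mxE [X in _ + X]mxE sl2_irr_e.
rewrite (bigD1 k) //= big1 ?addr0 => [|m mk]; last first.
  by rewrite sl2_irr_h eq_sym (negbTE mk) mulr0 mul0r.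
rewrite (bigD1 l) //= big1 ?addr0 => [|m ml]; last first.
  by rewrite sl2_irr_h (negbTE ml) !mulr0.
rewrite !sl2_irr_h !eqxx !mulr1 sl2_irr_e; case: eqP => [->|_]; last by rewrite /= !mulr0 mul0r addr0.
by rewrite /= !mulr1 mul1r mulnS natrD; ring.
Qed.

Lemma bracket_fe : bracket_rel (sl2_f C) (sl2_e C) sl2_h (- 1).
Proof.
move=> b; apply/matrixP => k l; rewrite [LHS]mxE [RHS]mxE [X in X + _]mxE [X in _ + X]mxE.
have -> : \sum_m sl2_irr b (sl2_f C) k m * sl2_irr b (sl2_e C) m l
    = (l.+1 * (b - l.+1))%:R * (k == l)%:R.
  have [lb|bl] := ltnP l.+1 b; last first.
    have -> : (b - l.+1 = 0)%N by apply/eqP; rewrite subn_eq0.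
    rewrite muln0 mul0r big1 // => m _; rewrite sl2_irr_e.
    by case: eqP => [ml|_]; rewrite ?mulr0 //; move: (ltn_ord m); rewrite ml ltnNge bl.
  rewrite (bigD1 (Ordinal lb)) //= big1 ?addr0 => [|m ml]; last first.
    by rewrite sl2_irr_e; case: eqP => [ml'|_]; rewrite ?mulr0 //; case/eqP: ml; apply: val_inj.
  rewrite sl2_irr_e sl2_irr_f /= eqxx mulr1 eqSS eq_sym.
  by rewrite -val_eqE.
have -> : \sum_m sl2_irr b (sl2_e C) k m * sl2_irr b (sl2_f C) m l
    = (l * (b - l))%:R * (k == l)%:R.
  case lE : (val l) => [|l'].
    by rewrite mul0n mul0r big1 // => m _; rewrite sl2_irr_f lE mul0n mul0r mulr0.
  have lb : (l' < b)%N by apply: ltnW; rewrite -lE; apply: ltn_ord.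
  rewrite (bigD1 (Ordinal lb)) //= big1 ?addr0 => [|m ml]; last first.
    rewrite sl2_irr_f; case: eqP => [ml'|_]; rewrite ?mulr0 //.
    by case/eqP: ml; apply: val_inj => /=; move: ml'; rewrite lE => -[].
  rewrite sl2_irr_e sl2_irr_f /= lE eqxx mulr1 mulrC; congr (_ * _).
  by rewrite -val_eqE /= lE.
rewrite sl2_irr_h; case: eqP => [_|_]; last by rewrite !mulr0 addr0.
have lb := ltn_ord l.
have [-> -> ->] : [/\ b - l = (b - l.+1).+1, b.-1 = l + (b - l.+1) & 2 * l = l + l]%N.
  by split; lia.
by rewrite !mulr1 !natrM !natrD -!natr1; ring.
Qed.

Lemma factor_act_linear i x : linear (@tensor_factor_act C n a i x).
Proof.
move=> c u v; apply/ffunP => k; rewrite !ffunE scaler_sumr -big_split /=.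
by apply: eq_bigr => l _; rewrite !ffunE mulrDr mulrCA.
Qed.

HB.instance Definition _ i x := GRing.isLinear.Build C (tensor C a) (tensor C a) _
  (@tensor_factor_act C n a i x) (factor_act_linear i x).

Lemma factor_act_bracket i x y w c (u : tensor C a) : bracket_rel x y w c ->
  tensor_factor_act i x (tensor_factor_act i y u) =
  tensor_factor_act i y (tensor_factor_act i x u) + c *: tensor_factor_act i w u.
Proof.
move=> xy; apply/ffunP => k; rewrite [RHS]ffunE [X in _ + X]ffunE !factor_act_same factor_actE.
rewrite /GRing.scale /= mulr_sumr -big_split; apply: eq_bigr => m _.
by rewrite xy mxE [X in _ + X]mxE mulrDl mulrA.
Qed.

Variable z : 'I_n -> C.
Local Notation act := (tensor_act z).

Lemma tensor_act_bracket x y w c j k (u : tensor C a) : bracket_rel x y w c ->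
  act x j (act y k u) = act y k (act x j u) + c *: act w (j + k) u.
Proof.
move=> xy; rewrite /tensor_act scaler_sumr.
under eq_bigr => i _ do rewrite linear_sum scaler_sumr.
under [X in _ = X + _]eq_bigr => i _ do rewrite linear_sum scaler_sumr.
rewrite [X in _ = X + _]exchange_big -big_split /=; apply: eq_bigr => i _.
rewrite (bigD1 i) //= [X in _ = X + _](bigD1 i) //= -!addrA.
rewrite !linearZ /= (factor_act_bracket _ _ xy) !scalerDr -!addrA.
rewrite !scalerA -[z i ^+ k * z i ^+ j]mulrC; congr (_ + _).
rewrite addrC; congr (_ + _); last by rewrite exprD mulrC.
apply: eq_bigr => i' i'i; rewrite !linearZ /= factor_act_comm 1?eq_sym //.
by rewrite !scalerA mulrC.
Qed.

Lemma tensor_actDx x j (u : tensor C a) : act x j u =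
  val x 0 1 *: act (sl2_e C) j u + val x 1 0 *: act (sl2_f C) j u
  + val x 0 0 *: act sl2_h j u.
Proof.
rewrite /tensor_act !scaler_sumr -!big_split; apply: eq_bigr => i _ /=.
rewrite !(scalerA (val x _ _)) ![val x _ _ * _]mulrC -!scalerA -!scalerDr.
congr (_ *: _); apply/ffunP => k; rewrite !ffunE.
rewrite /GRing.scale /= !mulr_sumr -!big_split; apply: eq_bigr => m _ /=.
rewrite (sl2_irrE (a i) x) mxE [X in (X + _) * _]mxE.
by rewrite [X in (X + _ + _) * _]mxE [X in (_ + X + _) * _]mxE [X in (_ + X) * _]mxE; ring.
Qed.

(** The index [ph] grades the tensor basis and [x] raises it by one, so combinations of the x t^j
    are nilpotent as soon as [ph] is bounded. *)
Definition raises (x : sl2 C) (ph : idx -> nat) := forall i (k : idx) m,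
  sl2_irr (a i) x (k i) m != 0 -> ph k = (ph (upd k m)).+1.

Definition supported (ph : idx -> nat) (d : nat) (u : tensor C a) :=
  forall k, (ph k < d)%N -> u k = 0.

Lemma supported_act x ph j d u : raises x ph -> supported ph d u ->
  supported ph d.+1 (act x j u).
Proof.
move=> rx du k kd; rewrite /tensor_act sum_ffunE big1 // => i _.
rewrite ffunE factor_actE big1 ?scaler0 // => m _.
have [->|Xn0] := eqVneq (sl2_irr (a i) x (k i) m) 0; first by rewrite mul0r.
by rewrite du ?mulr0 //; move: kd; rewrite (rx _ _ _ Xn0).
Qed.

Lemma sum_upd (g : forall i, 'I_(a i) -> nat) (k : idx) i (m : 'I_(a i)) :
  (\sum_j g j (upd k m j) + g i (k i) = \sum_j g j (k j) + g i m)%N.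
Proof.
rewrite (bigD1 i) //= [in RHS](bigD1 i) //= updE.
rewrite (eq_bigr (fun j => g j (k j))) => [|j ji]; last by rewrite upd_out // eq_sym.
lia.
Qed.

Lemma raises_e : raises (sl2_e C) (fun k => \sum_i k i)%N.
Proof.
move=> i k m; rewrite sl2_irr_e; case: (nat_of_ord (k i) =P m.+1) => [km _|_]; last by rewrite eqxx.
by have := sum_upd (fun i (l : 'I_(a i)) => nat_of_ord l) k m; lia.
Qed.

Lemma raises_f : raises (sl2_f C) (fun k => \sum_i (a i - k i))%N.
Proof.
move=> i k m; rewrite sl2_irr_f; case: (nat_of_ord m =P (k i).+1) => [km _|_]; last by rewrite mulr0 eqxx.
have := sum_upd (fun i (l : 'I_(a i)) => (a i - l)%N) k m.
by have := ltn_ord m; lia.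
Qed.

Lemma supported_eq0 (ph : idx -> nat) d u :
  (forall k, ph k < d)%N -> supported ph d u -> u = 0.
Proof. by move=> phd du; apply/ffunP => k; rewrite ffunE du. Qed.

Local Notation lowest := (tensor_lowest C a).

Lemma factor_lowest i x c : (forall b m k, (val m = 0)%N -> sl2_irr b x k m = c b * (k == m)%:R) ->
  tensor_factor_act i x lowest = c (a i) *: lowest.
Proof.
move=> xc; apply/ffunP => k; rewrite factor_actE [RHS]ffunE /GRing.scale /=.
have [k0|/forallPn[j kj]] := boolP [forall i, k i == 0 :> nat].
  have k0P := forallP k0.
  rewrite (bigD1 (k i)) //= big1 ?addr0 => [|m mk].
    by rewrite upd_id xc; [rewrite eqxx mulr1|apply/eqP; apply: k0P].
  rewrite [lowest _]ffunE; case: forallP => [/(_ i)|]; last by rewrite mulr0.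
  by rewrite updE => m0; case/eqP: mk; apply: val_inj => /=; rewrite (eqP m0) (eqP (k0P i)).
rewrite [lowest k]ffunE (introF forallP) ?mulr0 => [|/(_ j)]; last by rewrite (negbTE kj).
apply: big1 => m _; rewrite [lowest _]ffunE.
case: forallP => [u0|]; last by rewrite mulr0.
have m0 : val m = 0%N by have := u0 i; rewrite updE => /eqP.
rewrite xc // mulr1; case: eqP => [km|_]; last by rewrite mulr0.
have := u0 j; have [ij|ij] := eqVneq i j; last by rewrite upd_out // (negbTE kj).
by case: _ / ij kj => /negP kj; rewrite updE -km => /kj.
Qed.

Lemma act_f_lowest j : act (sl2_f C) j lowest = 0.
Proof.
rewrite /tensor_act big1 // => i _.
rewrite (@factor_lowest _ _ (fun=> 0)) => [|b m k m0]; first by rewrite scale0r scaler0.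
by rewrite sl2_irr_f m0 mul0n !mul0r.
Qed.

Lemma act_h_lowest j : act sl2_h j lowest = - (\sum_i z i ^+ j * (a i).-1%:R) *: lowest.
Proof.
rewrite /tensor_act scaleNr scaler_suml -sumrN; apply: eq_bigr => i _.
rewrite (@factor_lowest _ _ (fun b => - b.-1%:R)) => [|b m k m0].
  by rewrite scalerA mulrN scaleNr.
by rewrite sl2_irr_h m0 muln0 sub0r.
Qed.

Hypothesis zi : injective z.

(** Interpolation at the points z_i: on them t^j agrees with a polynomial of degree below n. In the
    associated graded module this drop in degree makes x t^j act by 0. *)
Lemma act_high j : (n <= j)%N -> exists al : 'I_n -> C,
  forall x (u : tensor C a), act x j u = \sum_(m < n) al m *: act x m u.
Proof.
move=> nj; have [al alE] := power_interpolation (fun i => z i ^+ j) zi.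
exists al => x u; rewrite /tensor_act.
under [RHS]eq_bigr do rewrite scaler_sumr.
rewrite exchange_big; apply: eq_bigr => i _ /=; rewrite alE scaler_suml.
by apply: eq_bigr => m _; rewrite scalerA.
Qed.

Definition eword (t : seq nat) : tensor C a :=
  foldr (fun j u => act (sl2_e C) j u) lowest t.

Inductive espan (s : nat) : tensor C a -> Prop :=
| espan0 : espan s 0
| espanS c t u : (sumn t <= s)%N -> all (gtn n) t -> espan s u ->
    espan s (c *: eword t + u).

Lemma espanD s u v : espan s u -> espan s v -> espan s (u + v).
Proof.
move=> su sv; elim: su => [|c t u' ts tn _ IH]; first by rewrite add0r.
by rewrite -addrA; apply: espanS.
Qed.

Lemma espanZ s c u : espan s u -> espan s (c *: u).
Proof.
elim=> [|c' t u' ts tn _ IH]; first by rewrite scaler0; apply: espan0.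
by rewrite scalerDr scalerA; apply: espanS.
Qed.

Lemma espan_sum s (I : Type) (r : seq I) (P : pred I) (F : I -> tensor C a) :
  (forall i, P i -> espan s (F i)) -> espan s (\sum_(i <- r | P i) F i).
Proof.
by move=> H; elim/big_ind: _ => //; [apply: espan0|apply: espanD].
Qed.

Lemma espan_leq s s' u : (s <= s')%N -> espan s u -> espan s' u.
Proof.
move=> ss'; elim=> [|c t u' ts tn _ IH]; first exact: espan0.
by apply: espanS => //; apply: leq_trans ss'.
Qed.

Lemma espan_word t : all (gtn n) t -> espan (sumn t) (eword t).
Proof.
move=> tn; rewrite -[eword t]scale1r -[_ *: _]addr0; apply: espanS => //.
exact: espan0.
Qed.

Lemma espan_map x j s : (forall t, all (gtn n) t -> espan (j + sumn t) (act x j (eword t))) ->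
  forall u, espan s u -> espan (j + s) (act x j u).
Proof.
move=> H u; elim=> [|c t u' ts tn _ IH]; first by rewrite linear0; apply: espan0.
rewrite linearP; apply: espanD => //; apply: espanZ.
by apply: espan_leq (H t tn); rewrite leq_add2l.
Qed.

Lemma espan_e j s u : espan s u -> espan (j + s) (act (sl2_e C) j u).
Proof.
apply: espan_map => t tn; case: (ltnP j n) => jn.
  by apply: (@espan_word (j :: t)) => /=; rewrite jn.
have [al alE] := act_high jn; rewrite alE; apply: espan_sum => m _; apply: espanZ.
have := @espan_word (val m :: t); rewrite /= ltn_ord => /(_ tn).
by apply: espan_leq; rewrite leq_add2r (leq_trans (ltnW (ltn_ord m))).
Qed.

Lemma espan_h j s u : espan s u -> espan (j + s) (act sl2_h j u).
Proof.
apply: espan_map => t; elim: t j {s u} => [|i t IH] j.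
  move=> _ /=; rewrite act_h_lowest; apply: espanZ.
  by apply: espan_leq (@espan_word [::] isT).
move=> /= /andP[in_ tn]; rewrite (tensor_act_bracket _ _ _ bracket_he); apply: espanD.
  by rewrite addnCA; apply: espan_e; apply: IH.
by apply: espanZ; rewrite addnA; apply: espan_e; apply: espan_word.
Qed.

Lemma espan_f j s u : espan s u -> espan (j + s) (act (sl2_f C) j u).
Proof.
apply: espan_map => t; elim: t j {s u} => [|i t IH] j.
  by move=> _ /=; rewrite act_f_lowest; apply: espan0.
move=> /= /andP[in_ tn]; rewrite (tensor_act_bracket _ _ _ bracket_fe); apply: espanD.
  by rewrite addnCA; apply: espan_e; apply: IH.
by apply: espanZ; rewrite addnA; apply: espan_h; apply: espan_word.
Qed.

(* PBW: words in [e], [f], [h] applied to the lowest weight vector reduce to words *)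
(* in [e] of no larger degree.                                                    *)
Lemma filtration_espan s u : fusion_filtration z s u -> espan s u.
Proof.
move=> [ws /allP wss]; set X := [seq tensor_word a z w | w <- ws] => /(@coord_span _ _ _ (in_tuple X)) ->.
apply: espan_sum => i _; apply: espanZ.
have /mapP[w ww ->] : (in_tuple X)`_i \in X by apply: mem_nth.
apply: espan_leq (wss w ww) _; elim: w {ww} => [|[x j] w IH] /=.
  exact: (@espan_word [::] isT).
rewrite tensor_actDx /word_degree /=; apply: espanD; first apply: espanD; apply: espanZ.
- exact: espan_e.
- exact: espan_f.
- exact: espan_h.
Qed.

End Tensor.

(** * Parts of lowest weight *)

Lemma mderivs_linear (C : comNzRingType) n (t : seq 'I_n) : linear (@mderivs C n t).
Proof.
elim: t => [|i t IH] c p q //=.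
by rewrite /mderivs /= linearP; apply: IH.
Qed.

HB.instance Definition _ (C : comNzRingType) n (t : seq 'I_n) :=
  GRing.isLinear.Build C {mpoly C[n]} {mpoly C[n]} _ (@mderivs C n t) (mderivs_linear t).

Definition mwt n (m : 'X_{1..n}) : nat := (\sum_(i < n) i * m i)%N.

Lemma mwtD n (m m' : 'X_{1..n}) : mwt (m + m')%MM = (mwt m + mwt m')%N.
Proof. by rewrite /mwt -big_split; apply: eq_bigr => i _; rewrite mnmDE mulnDr. Qed.

Lemma mwt0 n : mwt (0%MM : 'X_{1..n}) = 0%N.
Proof. by rewrite /mwt big1 // => i _; rewrite mnm0E muln0. Qed.

Lemma mwt1 n (i : 'I_n) : mwt U_(i)%MM = i.
Proof.
rewrite /mwt (bigD1 i) //= mnm1E eqxx muln1 big1 ?addn0 // => j ji.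
by rewrite mnm1E eq_sym (negbTE ji) muln0.
Qed.

Lemma mcoeff_mderivs (C : comNzRingType) n (t : seq 'I_n) m : exists c : nat,
  forall p : {mpoly C[n]},
    (mderivs t p)@_m = p@_(m + \big[+%MM/0%MM]_(i <- t) U_(i))%MM *+ c.
Proof.
elim: t => [|i t [c cP]]; first by exists 1%N => p; rewrite big_nil addm0.
exists (((m + \big[+%MM/0%MM]_(i <- t) U_(i))%MM i).+1 * c)%N => p.
by rewrite /mderivs /= -/(mderivs t _) cP mcoeff_mderiv big_cons -mulrnA -addmA [(_ + U_(i))%MM]addmC.
Qed.

(** The part [p] may be 0, as [s] merely bounds the weights in [P] from below. It is an integer
    because the weight l - k expected of an entry (l, k) is negative above the diagonal. *)
Definition lowest_part (C : nzRingType) n (s : int) (P p : {mpoly C[n]}) : Prop :=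
  (forall m, ((mwt m)%:Z < s)%O -> P@_m = 0) /\
  (forall m, p@_m = if (mwt m)%:Z == s then P@_m else 0).

Lemma lowest_part_mderivs (C : comNzRingType) n s (P p : {mpoly C[n]}) t :
  lowest_part s P p ->
  (((sumn (map val t))%:Z < s)%O -> (mderivs t P).@[fun=> 0] = 0) /\
  (mderivs t p).@[fun=> 0] =
    if (sumn (map val t))%:Z == s then (mderivs t P).@[fun=> 0] else 0.
Proof.
have tE : mwt (0 + \big[+%MM/0%MM]_(i <- t) U_(i))%MM = sumn (map val t).
  rewrite add0m; elim: t => [|i t IH]; first by rewrite big_nil mwt0.
  by rewrite big_cons mwtD mwt1 IH.
move=> [Plow pP]; rewrite !meval_at0; have [c cP] := mcoeff_mderivs C t 0%MM.
rewrite !cP; split=> [ts|]; first by rewrite Plow ?mul0rn // tE.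
by rewrite pP tE; case: ifP => _ //; rewrite mul0rn.
Qed.

Lemma lowest_part0 (C : nzRingType) n s : lowest_part s (0 : {mpoly C[n]}) 0.
Proof. by split=> m; rewrite mcoeff0 ?if_same. Qed.

Lemma lowest_partD (C : nzRingType) n s (P p Q q : {mpoly C[n]}) :
  lowest_part s P p -> lowest_part s Q q -> lowest_part s (P + Q) (p + q).
Proof.
move=> [P0 pP] [Q0 qQ]; split=> m; rewrite !mcoeffD.
  by move=> ms; rewrite P0 // Q0 // addr0.
by rewrite pP qQ; case: ifP; rewrite ?addr0.
Qed.

Lemma lowest_partZ (C : nzRingType) n s c (P p : {mpoly C[n]}) :
  lowest_part s P p -> lowest_part s (c *: P) (c *: p).
Proof.
move=> [P0 pP]; split=> m; rewrite !mcoeffZ.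
  by move=> ms; rewrite P0 // mulr0.
by rewrite pP; case: ifP; rewrite ?mulr0.
Qed.

Lemma lowest_part_sum (C : nzRingType) n s (I : Type) (r : seq I) (Q : pred I)
    (F G : I -> {mpoly C[n]}) : (forall i, Q i -> lowest_part s (F i) (G i)) ->
  lowest_part s (\sum_(i <- r | Q i) F i) (\sum_(i <- r | Q i) G i).
Proof.
by move=> H; elim/big_rec2: _ => [|i x y /H]; [apply: lowest_part0|apply: lowest_partD].
Qed.

Lemma lowest_part1 (C : nzRingType) n : lowest_part 0 (1 : {mpoly C[n]}) 1.
Proof.
split=> m; rewrite mcoeff1; first by move=> h; exfalso; lia.
have [->|m0] := eqVneq m 0%MM; first by rewrite mwt0.
by rewrite if_same.
Qed.

Lemma lowest_partM (C : nzRingType) n s s' (P p Q q : {mpoly C[n]}) :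
  lowest_part s P p -> lowest_part s' Q q -> lowest_part (s + s') (P * Q) (p * q).
Proof.
move=> [P0 pP] [Q0 qQ]; split=> m; rewrite !mcoeffM.
  move=> ms; apply: big1 => -[k1 k2] /= /eqP/(congr1 (@mwt n)); rewrite mwtD => mE.
  have [k1s|k1s] := ltP (mwt k1)%:Z s; first by rewrite P0 // mul0r.
  rewrite Q0 ?mulr0 //; lia.
case: eqP => [ms|ms].
  apply: eq_bigr => -[k1 k2] /= /eqP/(congr1 (@mwt n)); rewrite mwtD => mE; rewrite pP qQ.
  have [k1s|k1s|k1s] := ltgtP (mwt k1)%:Z s.
  - by rewrite P0 // !mul0r.
  - by rewrite [Q@_k2]Q0 ?if_same ?mulr0 //; lia.
  - by rewrite (_ : _ == _); last by lia.
apply: big1 => -[k1 k2] /= /eqP/(congr1 (@mwt n)); rewrite mwtD => mE; rewrite pP qQ.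
case: eqP => [k1s|_]; last by rewrite mul0r.
case: eqP => [k2s|_]; last by rewrite mulr0.
by case: ms; lia.
Qed.

Lemma lowest_part_prod (C : nzRingType) n (I : Type) (r : seq I)
    (F G : I -> {mpoly C[n]}) (s : I -> int) :
  (forall i, lowest_part (s i) (F i) (G i)) ->
  lowest_part (\sum_(i <- r) s i) (\prod_(i <- r) F i) (\prod_(i <- r) G i).
Proof.
move=> H; elim: r => [|i r IH]; first by rewrite !big_nil; apply: lowest_part1.
by rewrite !big_cons; apply: lowest_partM.
Qed.

Section Realization.
Variables (C : numFieldType) (n : nat) (a : 'I_n -> nat) (z : 'I_n -> C).
Local Notation idx := {dffun forall i : 'I_n, 'I_(a i)}.
Local Notation act := (tensor_act z).

(** The value c(z_i): on the i-th factor sum_j c_j e_j acts as c(z_i) e. *)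
Definition zeval (i : 'I_n) : {mpoly C[n]} := \sum_(m < n) z i ^+ m *: 'X_m.

(** As e^k u_0 = u_k, this is the coefficient of u_k in exp(x e) u_0. *)
Definition dpow (k : nat) (x : {mpoly C[n]}) : {mpoly C[n]} := (k`!%:R)^-1 *: x ^+ k.

(* The coordinates of exp(sum_j c_j e_j) applied to the lowest weight vector. *)
Definition tensor_exp (k : idx) : {mpoly C[n]} := \prod_i dpow (k i) (zeval i).

Lemma zeval_deriv i j : (zeval i)^`M(j) = (z i ^+ j)%:MP.
Proof.
rewrite /zeval linear_sum (bigD1 j) //= big1 => [|m mj]; last first.
  by rewrite mderivZ mderivX mnm1E (negbTE mj) scale0r scaler0.
rewrite addr0 mderivZ mderivX mnm1E eqxx scale1r.
have -> : (U_(j) - U_(j))%MM = 0%MM :> 'X_{1..n}.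
  by apply/mnmP => i'; rewrite mnmBE mnm0E subnn.
by rewrite mpolyX0 -alg_mpolyC.
Qed.

Lemma mderivXn (p : {mpoly C[n]}) j k : (p ^+ k.+1)^`M(j) = (p ^+ k * p^`M(j)) *+ k.+1.
Proof.
elim: k => [|k IH]; first by rewrite expr1 expr0 mul1r mulr1n.
by rewrite exprS mderivM IH mulrnAr mulrA -exprS [in RHS]mulrSr [RHS]addrC mulrC.
Qed.

Lemma dpow_deriv i j b (k : 'I_b) : (dpow k (zeval i))^`M(j) =
  \sum_(m < b) (z i ^+ j * sl2_irr b (sl2_e C) k m) *: dpow m (zeval i).
Proof.
case kE : (val k) => [|k'].
  rewrite /dpow expr0 mderivZ -mpolyC1 mderivC scaler0 big1 // => m _.
  by rewrite sl2_irr_e kE mulr0 scale0r.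
have kb : (k' < b)%N by apply: ltnW; rewrite -kE; apply: ltn_ord.
rewrite (bigD1 (Ordinal kb)) //= big1 ?addr0 => [|m mk]; last first.
  rewrite sl2_irr_e kE eqSS; case: (k' =P m) => [km|_]; last by rewrite mulr0 scale0r.
  by case/eqP: mk; apply: val_inj.
rewrite sl2_irr_e kE eqxx mulr1 /dpow mderivZ mderivXn zeval_deriv scalerA.
rewrite [_ * (_)%:MP]mulrC mul_mpolyC -scaler_nat !scalerA; congr (_ *: _).
have k0 : (k'.+1%:R : C) != 0 by rewrite pnatr_eq0.
by rewrite factS natrM invfM [X in X * _]mulrAC mulVf // mul1r mulrC.
Qed.

Lemma tensor_exp_deriv (k : idx) j : (tensor_exp k)^`M(j) =
  \sum_i \sum_m (z i ^+ j * sl2_irr (a i) (sl2_e C) (k i) m) *: tensor_exp (upd k m).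
Proof.
have prodD (r : seq 'I_n) (F : 'I_n -> {mpoly C[n]}) : uniq r ->
    (\prod_(i <- r) F i)^`M(j) =
    \sum_(i <- r) (F i)^`M(j) * \prod_(i' <- r | i' != i) F i'.
  elim: r => [_|i r IH /= /andP[ir ur]]; first by rewrite !big_nil -mpolyC1 mderivC.
  rewrite !big_cons mderivM IH // eqxx /=; congr (_ * _ + _).
    rewrite big_seq [RHS]big_seq_cond; apply: eq_bigl => i'.
    by case: (boolP (i' \in r)) => //= i'r; apply/esym; apply: contraNneq ir => <-.
  rewrite mulr_sumr big_seq [RHS]big_seq; apply: eq_bigr => i' i'r.
  rewrite big_cons mulrCA; case: eqP => [ii'|//].
  by move: ir; rewrite ii' i'r.
rewrite /tensor_exp prodD ?index_enum_uniq //; apply: eq_bigr => i _.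
rewrite dpow_deriv mulr_suml; apply: eq_bigr => m _.
rewrite -scalerAl; congr (_ *: _); rewrite [in RHS](bigD1 i) //= updE; congr (_ * _).
by apply: eq_bigr => i' i'i; rewrite upd_out // eq_sym.
Qed.

Definition tensor_point (c : 'I_n -> C) : tensor C a :=
  [ffun k : idx => (tensor_exp k).@[c]].

Lemma mderivs_tensor_exp t k c : (mderivs t (tensor_exp k)).@[c] =
  foldr (fun j u => act (sl2_e C) j u) (tensor_point c) (map val t) k.
Proof.
elim: t k => [|j t IH] k; first by rewrite ffunE.
rewrite [LHS]/(meval c (mderivs t (tensor_exp k)^`M(j))) tensor_exp_deriv.
rewrite [map _ _]/=; set u := foldr _ _ (map val t) in IH *.
rewrite (linear_sum (mderivs t)) (raddf_sum (meval c)) /= -/u /tensor_act sum_ffunE.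
apply: eq_bigr => i _.
rewrite (linear_sum (mderivs t)) (raddf_sum (meval c)) [RHS]ffunE factor_actE.
rewrite /GRing.scale /= mulr_sumr; apply: eq_bigr => m _.
by rewrite linearZ /= mevalZ IH mulrA.
Qed.

Lemma tensor_point0 : tensor_point (fun=> 0) = tensor_lowest C a.
Proof.
apply/ffunP => k; rewrite !ffunE rmorph_prod /=.
have y0 i : (zeval i).@[fun=> 0] = 0.
  rewrite /zeval raddf_sum big1 //= => m _.
  by rewrite mevalZ mevalXU mulr0.
have [k0|/forallPn[j kj]] := boolP [forall i, k i == 0 :> nat].
  rewrite big1 // => i _; rewrite /dpow (eqP (forallP k0 i)).
  by rewrite expr0 fact0 invr1 scale1r meval1.
by rewrite (bigD1 j) //= /dpow mevalZ rmorphXn /= y0 expr0n (negbTE kj) mulr0 mul0r.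
Qed.

(** Differentiating exp(sum_j c_j e_j) in c_j inserts the operator e_j, so derivatives at 0 evaluate
    the form [l] on words. *)
Lemma tensor_realization (be : idx -> C) : exists l : 'Hom(tensor C a, C^o),
  forall t, (mderivs t (\sum_k be k *: tensor_exp k)).@[fun=> 0] =
    l (eword a z (map val t)).
Proof.
pose l0 (u : tensor C a) : C^o := \sum_k be k * u k.
have l0_lin : linear l0.
  move=> c u v; rewrite /l0 scaler_sumr -big_split; apply: eq_bigr => k _ /=.
  by rewrite !ffunE mulrDr /GRing.scale /= mulrCA.
pose l := HB.pack_for {linear tensor C a -> C^o} l0
  (GRing.isLinear.Build C (tensor C a) C^o _ l0 l0_lin).
exists (linfun l) => t; rewrite lfunE /= /l0 !linear_sum; apply: eq_bigr => k _ /=.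
by rewrite !linearZ /= mderivs_tensor_exp tensor_point0.
Qed.

End Realization.

(** * Toeplitz minors as lowest weight parts *)

Section MinorsLowest.
Variables (C : numFieldType) (n : nat) (z : 'I_n -> C).
Hypothesis zi : injective z.

Definition xvar (m : nat) : {mpoly C[n]} := oapp (fun i : 'I_n => 'X_i) 0 (insub m).

(** Polynomials in the values c(z_i) of degree at most [ka i] in the i-th one; for [ka i < a i]
    these are the combinations of the [tensor_exp]. *)
Definition zspan (ka : 'I_n -> nat) (P : {mpoly C[n]}) : Prop :=
  exists2 Q : {mpoly C[n]}, forall m, m \in msupp Q -> forall i, (m i <= ka i)%N
    & P = msubst (zeval z) Q.

Lemma zspanM ka ka' P P' : zspan ka P -> zspan ka' P' ->
  zspan (fun i => (ka i + ka' i)%N) (P * P').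
Proof.
move=> [Q Qka ->] [Q' Qka' ->]; exists (Q * Q'); last by rewrite rmorphM.
move=> m /msuppM_le/allpairsP[[m1 m2] /= [m1Q m2Q ->]] i.
by rewrite mnmDE leq_add // ?Qka ?Qka'.
Qed.

Lemma zspan1 : zspan (fun=> 0%N) 1.
Proof.
exists 1; last by rewrite rmorph1.
by move=> m; rewrite msupp1 inE => /eqP -> i; rewrite mnm0E.
Qed.

Section OneMinor.
Variables (j : nat) (ix : 'I_j -> 'I_n).
Hypothesis ixi : injective ix.

(** The entry [W i l] is the coefficient of t^l in the Lagrange interpolation polynomial of the i-th
    point. *)
Let W := invmx (Vandermonde j (\row_i z (ix i))).

Let WE (l m : 'I_j) : \sum_i z (ix i) ^+ m * W i l = (m == l)%:R.
Proof.
have := mulmxV (@Vandermonde_unit C j (z \o ix) (inj_comp zi ixi)).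
move=> /matrixP/(_ m l); rewrite !mxE => <-; apply: eq_bigr => i _.
by rewrite !mxE.
Qed.

(* The matrix of multiplication by c(t) on C[t] / prod_i (t - z (ix i)). *)
Let entry (l : 'I_j) (k : nat) (X : 'I_n -> {mpoly C[n]}) : {mpoly C[n]} :=
  \sum_i (W i l * z (ix i) ^+ k) *: X (ix i).

(** The coefficient of c_m is that of t^l in the remainder of t^(m + k). For m + k < j this is 1 or
    0 according to whether m + k = l; otherwise m + k >= j > l, so the weight m exceeds l - k. *)
Lemma entry_lowest (l k : 'I_j) :
  lowest_part (l%:Z - k%:Z) (entry l k (zeval z)) (toep xvar l k).
Proof.
have jn : (j <= n)%N by rewrite -[j]card_ord -[n]card_ord; apply: leq_card ixi.
have -> : entry l k (zeval z) =
    \sum_(m < n) (\sum_i z (ix i) ^+ (m + k) * W i l) *: 'X_m.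
  rewrite /entry /zeval; under eq_bigr do rewrite scaler_sumr.
  rewrite exchange_big /=; apply: eq_bigr => m _; rewrite scaler_suml.
  by apply: eq_bigr => i _; rewrite scalerA exprD; congr (_ *: _); ring.
have -> : toep xvar l k = \sum_(m < n) (if (m + k == l)%N then 'X_m else 0).
  rewrite /toep; case: leqP => kl; last first.
    rewrite big1 // => m _; case: eqP => // mk.
    by move: kl; rewrite -mk ltnNge leq_addl.
  have ln : (l - k < n)%N by apply: leq_ltn_trans (leq_subr _ _) (leq_trans (ltn_ord l) jn).
  rewrite (bigD1 (Ordinal ln)) //= subnK // eqxx /xvar insubT /= big1 ?addr0 // => m mlk.
  case: eqP => // mk; case/eqP: mlk; apply: val_inj => /=.
  by rewrite -mk addnK.
apply: lowest_part_sum => m _; set c := \sum_i _.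
have cE : (m + k < j)%N -> c = (m + k == l)%N%:R.
  by move=> mkj; rewrite -(WE l (Ordinal mkj)).
split=> mu; rewrite mcoeffZ mcoeffX.
  have [<-|_] := eqVneq U_(m)%MM mu; last by rewrite mulr0.
  rewrite mwt1 => ml; have lj := ltn_ord l.
  by rewrite cE; [case: eqP => [mk|_]; rewrite ?mul0r //; exfalso|]; lia.
have [mkl|mkl] := eqVneq (m + k)%N l.
  rewrite mcoeffX cE; last by rewrite mkl.
  have [<-|_] := eqVneq U_(m)%MM mu; last by rewrite mulr0 if_same.
  by rewrite mwt1 mkl eqxx mulr1 (_ : (_ == _) = true) //; lia.
rewrite mcoeff0; case: eqP => // muE.
have [mmu|_] := eqVneq U_(m)%MM mu; last by rewrite mulr0.
by move: muE; rewrite -mmu mwt1 => ?; exfalso; lia.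
Qed.

(** Every term of the determinant has the same weight, the sum of the row indices minus that of the
    column indices, so lowest parts may be taken entrywise. *)
Lemma minor_lowest d : within j d -> exists s P,
  [/\ lowest_part s P (tminor xvar d) & zspan (fun i => (i \in codom ix) : nat) P].
Proof.
case: d => k r0 s0 [/= rj sj].
pose r p := Ordinal (rj p); pose s q := Ordinal (sj q).
pose P X := \det (\matrix_(p < k, q < k) entry (r p) (s q) X).
exists (\sum_p ((r p)%:Z - (s p)%:Z)), (P (zeval z)); split.
  apply: lowest_part_sum => /= sg _; rewrite !mulr_sign -!scaler_sign.
  apply: lowest_partZ.
  have -> : \sum_p ((r p)%:Z - (s p)%:Z) = \sum_p ((r p)%:Z - (s (sg p))%:Z).
    by rewrite !sumrB; congr (_ - _); rewrite (reindex_inj (@perm_inj _ sg)).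
  apply: lowest_part_prod => p; rewrite !mxE; exact: entry_lowest.
exists (P (fun i => 'X_i)); last first.
  rewrite -det_map_mx; congr (\det _); apply/matrixP => p q; rewrite !mxE /entry.
  by rewrite rmorph_sum; apply: eq_bigr => i _; rewrite /= msubstZ msubstX.
(* Expansion by rows as in the Cauchy-Binet formula: [g] chooses an idempotent for each row, and the
   remaining determinant has two equal rows unless [g] is injective. Hence each value c(z_i) occurs
   at most once. *)
have -> : P (fun i => 'X_i) = \sum_(g : {ffun 'I_k -> 'I_j})
    ((\prod_p W (g p) (r p)) * \det (\matrix_(p, q) z (ix (g p)) ^+ (s q)))
    *: 'X_[\big[+%MM/0%MM]_p U_(ix (g p))%MM].
  rewrite /P /determinant.
  under eq_bigr => sg _ do under eq_bigr => p _ do rewrite mxE.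
  under eq_bigr => sg _ do rewrite bigA_distr_bigA mulr_sumr.
  rewrite exchange_big /=; apply: eq_bigr => g _.
  rewrite mulr_sumr scaler_suml; apply: eq_bigr => sg _.
  rewrite scaler_prod mprodXE mulr_sign -scaler_sign scalerA; congr (_ *: _).
  rewrite big_split /= mulrCA; congr (_ * (_ * _)).
  by apply: eq_bigr => p _; rewrite mxE.
move=> m /msupp_sum_le/flattenP[ms /mapP[g _ ->]] {ms}.
have [gi|gni] := boolP (injectiveb g); last first.
  have [p [p' pp' gpp']] := injectivePn _ gni.
  rewrite (determinant_alternate pp') ?mulr0 ?scale0r ?msupp0 // => q.
  by rewrite !mxE gpp'.
move=> /msuppZ_le; rewrite msuppX inE => /eqP -> i; rewrite mnm_sumE.
have [/codomP[i' ->]|ni] := boolP (i \in codom ix); last first.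
  rewrite big1 // => p _; rewrite mnm1E; case: eqP => // ip.
  by case/negP: ni; rewrite -ip codom_f.
have [p0 /eqP gp0|none] := pickP (fun p => g p == i'); last first.
  by rewrite big1 // => p _; rewrite mnm1E (inj_eq ixi) none.
rewrite (bigD1 p0) //= big1 => [|p pp0]; first by rewrite addn0 mnm1E leq_b1.
by rewrite mnm1E (inj_eq ixi) -gp0 (inj_eq (injectiveP _ gi)) (negbTE pp0).
Qed.

End OneMinor.

Lemma zspan_leq ka ka' P : (forall i, ka i <= ka' i)%N -> zspan ka P -> zspan ka' P.
Proof.
move=> kk [Q Qk ->]; exists Q => // m mQ i; exact: leq_trans (Qk m mQ i) (kk i).
Qed.

Lemma zspan_tensor_exp (a : 'I_n -> nat) ka P : (forall i, ka i < a i)%N -> zspan ka P ->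
  exists be, P = \sum_(k : {dffun forall i : 'I_n, 'I_(a i)}) be k *: tensor_exp z k.
Proof.
move=> kaa [Q Qka ->]; rewrite [Q]mpolyE rmorph_sum /=.
elim: (msupp Q) Qka => [|m S IH] Qka.
  exists (fun=> 0); rewrite big_nil big1 // => k _; exact: scale0r.
have [|be beE] := IH; first by move=> ? h; apply: Qka; rewrite in_cons h orbT.
have ma i : (m i < a i)%N by apply: leq_ltn_trans (Qka m (mem_head _ _) i) (kaa i).
pose km : {dffun forall i : 'I_n, 'I_(a i)} := [ffun i => Ordinal (ma i)].
have mE : 'X_[m] = \prod_i 'X_i ^+ m i :> {mpoly C[n]} by rewrite -mpolyXE_id.
exists (fun k => (k == km)%:R * (Q@_m * \prod_i (m i)`!%:R) + be k).
under [RHS]eq_bigr do rewrite scalerDl; rewrite big_split /= -beE big_cons; congr (_ + _).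
rewrite (bigD1 km) //= eqxx mul1r [X in _ = _ + X]big1 ?addr0 => [|k /negbTE ->]; last first.
  by rewrite mul0r scale0r.
rewrite msubstZ mE rmorph_prod -scalerA; congr (_ *: _).
rewrite -scaler_prod; apply: eq_bigr => i _; rewrite /= rmorphXn /= msubstX /dpow ffunE /=.
by rewrite scalerA divff ?scale1r // pnatr_eq0 -lt0n fact_gt0.
Qed.

(** Levels are numbered from 0, whence the successor; the index [i] belongs to exactly [a i - 1] of
    them. *)
Definition level (a : 'I_n -> nat) (b : nat) : {set 'I_n} := [set i | b.+1 < a i]%N.

Lemma in_level (a : 'I_n -> nat) b (i : 'I_n) : (i \in level a b) = (b.+1 < a i)%N.
Proof. exact: in_set. Qed.

Lemma fills_lowest (a : 'I_n -> nat) bs ds : fills [seq #|level a b| | b <- bs] ds ->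
  exists s P, lowest_part s P (tprod xvar ds) /\
    zspan (fun i : 'I_n => \sum_(b <- bs) (i \in level a b))%N P.
Proof.
elim: bs ds => [|b bs IH] [|d ds] //=.
  move=> _; exists 0, 1; rewrite /tprod big_nil; split; first exact: lowest_part1.
  by apply: zspan_leq zspan1.
move=> [db /IH[s [P [Pl Pz]]]]; have [s' [P' [P'l P'z]]] := minor_lowest (@enum_val_inj _ (mem (level a b))) db.
exists (s' + s), (P' * P); split; first by rewrite /tprod big_cons; apply: lowest_partM.
apply: zspan_leq (zspanM P'z Pz) => i; rewrite big_cons leq_add2r.
have [/codomP[l ->]|//] := boolP (i \in codom _).
by rewrite enum_valP.
Qed.

(** The reversal sorts the sizes increasingly. Empty levels pad the list to length sum_i a_i,
    harmlessly since a bin 0 only admits the minor 1. *)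
Definition colbins (a : 'I_n -> nat) : seq nat :=
  [seq #|level a b| | b <- rev (iota 0 (\sum_i a i))].

Lemma count_levels (a : 'I_n -> nat) (i : 'I_n) :
  (\sum_(b <- rev (iota 0 (\sum_i a i))) (i \in level a b) = (a i).-1)%N.
Proof.
have sa : (a i <= \sum_i a i)%N by rewrite (bigD1 i) //= leq_addr.
rewrite (perm_big (iota 0 (\sum_i a i))) /=; last by rewrite perm_rev.
have -> : iota 0 (\sum_i a i) = index_iota 0 (\sum_i a i) by rewrite /index_iota subn0.
rewrite (big_cat_nat (leq0n (a i).-1)) /=; last exact: leq_trans (leq_pred _) sa.
rewrite (eq_big_nat _ _ (F2 := fun=> 1%N)) => [|b bi]; last by rewrite in_level; lia.
rewrite [X in (_ + X)%N]big_nat_cond [X in (_ + X)%N]big1 => [|b bi]; last by rewrite in_level; lia.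
by rewrite sum_nat_const_nat; lia.
Qed.

Lemma colbins_sorted a : sorted leq (colbins a).
Proof.
rewrite /colbins map_rev rev_sorted sorted_map.
apply: sub_sorted (iota_sorted 0 _) => b b' bb'.
by apply: subset_leq_card; apply/subsetP => i; rewrite !inE; lia.
Qed.

Lemma colbins_leq a : all (leq^~ n) (colbins a).
Proof.
by apply/allP => x /mapP[b _ ->]; rewrite -[X in (_ <= X)%N]card_ord max_card.
Qed.

(** Conjugate partitions: as [a] is monotone, every level is a final segment of the indices, so
    column [j] of the diagram has length [a (rev_ord j) - 1]. *)
Lemma colprod_colbins (a : 'I_n -> nat) : (forall i, 0 < a i)%N ->
  (forall i j : 'I_n, (i <= j)%N -> (a i <= a j)%N) ->
  colprod n (colbins a) = (\prod_i a i)%N.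
Proof.
move=> a0 amono; rewrite /colprod big_mkord [RHS](reindex_inj rev_ord_inj) /=.
apply: eq_bigr => j _; rewrite -[RHS](prednK (a0 _)); congr _.+1.
rewrite -[in RHS]count_levels count_map -sum1_count big_mkcond /=.
apply: eq_bigr => b _.
suff -> : (j < #|level a b|)%N = (rev_ord j \in level a b) by case: (_ \in _).
have up (k : 'I_n) : #|[set i : 'I_n | (k <= i)%N]| = (n - k)%N.
  have -> : [set i : 'I_n | (k <= i)%N] = ~: [set i : 'I_n | (i < k)%N].
    by apply/setP => i; rewrite !inE -leqNgt.
  rewrite cardsCs setCK card_ord; congr (n - _)%N.
  rewrite -sum1_card (eq_bigl (fun i : 'I_n => i < k)%N) => [|i]; last by rewrite inE.
  by rewrite (big_ord_narrow (ltnW (ltn_ord k))) sum1_card card_ord.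
have rj : (n - rev_ord j = j.+1)%N by rewrite /=; have := ltn_ord j; lia.
case: (boolP (rev_ord j \in level a b)) => [jb|njb].
  rewrite -rj -up; apply: subset_leq_card; apply/subsetP => i.
  move: jb; rewrite !inE => jb ij; exact: leq_trans jb (amono _ _ ij).
apply/negbTE; rewrite -leqNgt -ltnS -rj -up; apply: proper_card.
apply/properP; split.
  apply/subsetP => i; rewrite inE => ib; rewrite inE leqNgt; apply: contra njb => ij.
  by rewrite inE; apply: leq_trans ib (amono _ _ (ltnW ij)).
by exists (rev_ord j); rewrite ?inE //; rewrite inE in njb.
Qed.

End MinorsLowest.

(** * Fusion products *)

(** The images of the powers of [T] shrink strictly until they become stable, and the stable image
    is 0. Thus the truncation in [nilp_exp] loses nothing. *)
Lemma nilp_iter_dim (C : fieldType) (V : vectType C) (T : 'End(V)) K :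
  (forall v, iter K T v = 0) -> forall v, iter (\dim {:V}) T v = 0.
Proof.
move=> TK v; pose U k := iter k (fun X : {vspace V} => T @: X)%VS fullv.
have UE k w : iter k T w \in U k.
  by elim: k => [|k IH]; rewrite ?memvf // !iterS memv_img.
have Usub k : (U k.+1 <= U k)%VS.
  elim: k => [|k IH]; first exact: subvf.
  by rewrite /U iterS [in X in (_ <= X)%VS]iterS; apply: limgS.
have UK k : (K <= k)%N -> U k = 0%VS.
  have iU j (w : V) : w \in U j -> exists w', w = iter j T w'.
    elim: j w => [|j IH] w; first by exists w.
    by rewrite /U iterS => /memv_imgP[w' /IH[w'' ->] ->]; exists w''.
  move=> Kk; apply/eqP; rewrite -subv0; apply/subvP => w /iU[w' ->].
  by rewrite -(subnK Kk) iterD TK memv0; elim: (k - K)%N => //= i /eqP ->; rewrite linear0.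
have dU k : (\dim (U k) <= \dim {:V} - k)%N.
  elim: k => [|k IH]; first by rewrite subn0.
  have [/eqP Uk|Uk] := eqVneq (\dim (U k.+1)) (\dim (U k)); last first.
    have : (\dim (U k.+1) < \dim (U k))%N by rewrite ltn_neqAle Uk dimvS.
    by lia.
  have {}Uk : U k.+1 = U k by apply/eqP; rewrite eqEdim Usub (eqP Uk) leqnn.
  have Uc i : U (k + i)%N = U k.
    by elim: i => [|i IHi]; rewrite ?addn0 // addnS -[LHS]/(T @: U (k + i)%N)%VS IHi.
  by rewrite Uk -(Uc K) UK ?dimv0 // leq_addl.
have := UE (\dim {:V}) v; suff -> : U (\dim {:V}) = 0%VS by rewrite memv0 => /eqP.
by apply/eqP; rewrite -dimv_eq0 -leqn0 (leq_trans (dU _)) // subnn.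
Qed.

Section FusionModule.
Variables (C : numFieldType) (n : nat) (a : 'I_n -> nat) (z : 'I_n -> C).
Hypothesis zi : injective z.
Variable M : fusion a z.
Local Notation T := (tensor C a).
Local Notation act := (tensor_act z).
Local Notation gr := (fus_gr M).
Local Notation F := (fusion_filtration z).

Lemma filtration0 s : F s (0 : T).
Proof. by exists [::]; rewrite // mem0v. Qed.

Lemma filtration_lowest : F 0 (tensor_lowest C a).
Proof. by exists [:: [::]] => //=; apply: memv_span1. Qed.

Lemma filtration_lin s c (u v : T) : F s u -> F s v -> F s (c *: u + v).
Proof.
have [U UP] := fusion_filtration_space a z s.
by move=> /UP uU /UP vU; apply/UP; rewrite memvD ?memvZ.
Qed.

Lemma filtration_eword t : F (sumn t) (eword a z t).
Proof.
elim: t => [|j t IH]; first exact: filtration_lowest.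
exact: tensor_act_filtration.
Qed.

Lemma gr_eq0 s u : F s u -> (forall s', s = s'.+1 -> F s' u) -> (s = 0%N -> u = 0) -> gr s u = 0.
Proof.
by move=> us h h0; apply/(fus_gr_ker M us); case: s us h h0 => [|s] us h h0 /=; [apply: h0 | apply: h].
Qed.

Lemma fus_ext (U : vectType C) (f g : fus_mod M -> U) : linear f -> linear g ->
  (forall s u, F s u -> f (gr s u) = g (gr s u)) -> forall m, f m = g m.
Proof.
move=> fl gl fg m; have [N [u [uF ->]]] := fus_gr_span m.
pose fL := HB.pack_for {linear fus_mod M -> U} f (GRing.isLinear.Build C _ _ _ f fl).
pose gL := HB.pack_for {linear fus_mod M -> U} g (GRing.isLinear.Build C _ _ _ g gl).
rewrite -[f]/(fL : _ -> _) -[g]/(gL : _ -> _) !linear_sum; apply: eq_bigr => s _.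
exact: fg.
Qed.

Lemma fus_act_bracket x y w c j k m : bracket_rel x y w c ->
  fus_act M x j (fus_act M y k m) =
  fus_act M y k (fus_act M x j m) + c *: fus_act M w (j + k) m.
Proof.
move=> xy; move: m; apply: fus_ext => [b u v|b u v|s u us].
- by rewrite !linearP.
- by rewrite !linearP /= !scalerDr !scalerA addrACA.
have := tensor_act_filtration y k us; have := tensor_act_filtration x j us => usx usy.
rewrite (fus_act_gr M _ _ us) (fus_act_gr M _ _ usy) (fus_act_gr M x j us) (fus_act_gr M _ _ usx).
rewrite (fus_act_gr M _ _ us) (tensor_act_bracket _ _ _ _ xy) linearD linearZ /=.
by rewrite -[(j + k + s)%N]addnA [(k + (j + s))%N]addnCA.
Qed.

Lemma fus_act_high x j m : (n <= j)%N -> fus_act M x j m = 0.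
Proof.
move=> nj; move: m; apply: fus_ext => [b u v|b u v|s u us].
- by rewrite linearP.
- by rewrite scaler0 addr0.
rewrite (fus_act_gr M _ _ us); apply: gr_eq0; first exact: tensor_act_filtration.
  have [al ->] := act_high a zi nj => s' s'E.
  have [U UP] := fusion_filtration_space a z s'.
  apply/UP; apply: rpred_sum => m _; apply: rpredZ; apply/UP.
  apply: fusion_filtration_leq (tensor_act_filtration x m us).
  by have := ltn_ord m; lia.
(* Total degree 0 remains; then j = 0, so n = 0 and the sum over the tensor factors is empty. *)
case: j nj => // n0 _; have -> : act x 0 u = 0; last by [].
rewrite /tensor_act big1 // => i _.
by move: (ltn_ord i); rewrite ltnNge (leq_trans n0).
Qed.

Local Notation v0 := (fus_lowest M).

Lemma fus_f_lowest j : fus_act M (sl2_f C) j v0 = 0.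
Proof. by rewrite (fus_act_gr M _ _ filtration_lowest) act_f_lowest linear0. Qed.

Lemma fus_h_lowest j : fus_act M (sl2_h C) j v0 =
  ((j == 0)%:R * - (\sum_i (a i).-1%:R)) *: v0.
Proof.
rewrite (fus_act_gr M _ _ filtration_lowest) act_h_lowest addn0 linearZ /=.
case: j => [|j] /=.
  rewrite mul1r; congr (- _ *: _); apply: eq_bigr => i _; by rewrite expr0 mul1r.
rewrite mul0r scale0r (_ : gr j.+1 _ = 0) ?scaler0 //.
apply: gr_eq0 => // [|s' _]; apply: fusion_filtration_leq filtration_lowest => //.
Qed.

Lemma fus_word t : foldr (fun j m => fus_act M (sl2_e C) j m) v0 t = gr (sumn t) (eword a z t).
Proof.
elim: t => [|j t /= ->] //.
by rewrite (fus_act_gr M _ _ (filtration_eword t)).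
Qed.

(** The grading [ph] need not descend to classes, so one only asks for some representatives
    supported in [ph] >= [d]; this suffices to transport nilpotency. *)
Inductive gr_supported (ph : {dffun forall i : 'I_n, 'I_(a i)} -> nat) (d : nat) :
    fus_mod M -> Prop :=
| gr_supported0 : gr_supported ph d 0
| gr_supportedS s u m : F s u -> supported ph d u -> gr_supported ph d m ->
    gr_supported ph d (gr s u + m).

Lemma gr_supportedD ph d m m' :
  gr_supported ph d m -> gr_supported ph d m' -> gr_supported ph d (m + m').
Proof.
move=> + m'd; elim=> [|s u m1 us ud _ IH]; first by rewrite add0r.
by rewrite -addrA; apply: gr_supportedS.
Qed.

Lemma gr_supportedZ ph d c m : gr_supported ph d m -> gr_supported ph d (c *: m).
Proof.
elim=> [|s u m1 us ud _ IH]; first by rewrite scaler0; apply: gr_supported0.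
rewrite scalerDr -linearZ /=; apply: gr_supportedS => //.
  by rewrite -[_ *: u]addr0; apply: filtration_lin us (filtration0 _).
by move=> k kd; rewrite ffunE ud // /GRing.scale /= mulr0.
Qed.

Lemma gr_supported_act x (ph : {dffun forall i : 'I_n, 'I_(a i)} -> nat) d
    (q : 'I_n -> C) m : raises x ph -> gr_supported ph d m ->
  gr_supported ph d.+1 ((\sum_(j < n) q j *: fus_act M x j) m).
Proof.
move=> rx md; rewrite sum_lfunE; elim/big_ind: _ => [||j _]; first exact: gr_supported0.
  exact: gr_supportedD.
rewrite scale_lfunE; apply: gr_supportedZ.
elim: md => [|s u m1 us ud _ IH]; first by rewrite linear0; apply: gr_supported0.
rewrite linearD /= (fus_act_gr M _ _ us); apply: gr_supportedS => //.
  exact: tensor_act_filtration.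
exact: supported_act.
Qed.

Lemma fus_nilp x (ph : {dffun forall i : 'I_n, 'I_(a i)} -> nat) B (q : 'I_n -> C) m :
  raises x ph -> (forall k, ph k < B)%N ->
  iter B (\sum_(j < n) q j *: fus_act M x j) m = 0.
Proof.
move=> rx phB.
have : forall d, gr_supported ph d (iter d (\sum_(j < n) q j *: fus_act M x j) m).
  elim=> [|d IH]; last by rewrite iterS; apply: gr_supported_act.
  have [N [u [uF ->]]] := fus_gr_span m; rewrite /=.
  elim/big_ind: _ => [||s _]; [exact: gr_supported0|exact: gr_supportedD|].
  by rewrite -[gr s (u s)]addr0; apply: gr_supportedS => //; apply: gr_supported0.
by move=> /(_ B); elim=> // s u m' _ ud _ ->; rewrite (supported_eq0 phB ud) linear0 addr0.
Qed.

(** The dimensions of the graded pieces telescope, as [gr s] kills F_(s - 1); the total is at most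
    the dimension of the tensor product. *)
Lemma dim_fusion : (\dim {:fus_mod M} <= \prod_i a i)%N.
Proof.
have [FF FP] := choice (fusion_filtration_space a z).
pose S N := (\sum_(s < N) (gr s @: FF s))%VS.
have SN N N' : (N <= N')%N -> (S N <= S N')%VS.
  move=> NN'; apply/subv_sumP => s _.
  by apply: (sumv_sup (widen_ord NN' s)).
have mS m : exists N, m \in S N.
  have [N [u [uF ->]]] := fus_gr_span m; exists N.
  by apply: memv_sumr => s _; apply: memv_img; apply/FP.
have [N SNf] : exists N, (fullv <= S N)%VS.
  suff [N NP] : exists N, {subset (tval (vbasis {:fus_mod M})) <= S N}.
    exists N; rewrite -(span_basis (vbasisP {:fus_mod M})); apply/span_subvP => m.
    exact: NP.
  elim: (tval (vbasis {:fus_mod M})) => [|m X [N NP]]; first by exists 0%N => m; rewrite in_nil.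
  have [N' mN'] := mS m; exists (maxn N N') => m'; rewrite in_cons => /orP[/eqP ->|/NP].
    exact: subvP (SN _ _ (leq_maxr N N')) _ mN'.
  exact: subvP (SN _ _ (leq_maxl N N')) m'.
have FF1 s : (FF s <= FF s.+1)%VS.
  by apply/subvP => u /FP us; apply/FP; apply: fusion_filtration_leq us.
have dimS N1 : (\sum_(s < N1.+1) \dim (gr s @: FF s) <= \dim (FF N1))%N.
  elim: N1 => [|N1 IH].
    by rewrite big_ord1 -(limg_ker_dim (gr 0) (FF 0)) leq_addl.
  rewrite big_ord_recr /= -(limg_ker_dim (gr N1.+1) (FF N1.+1)) leq_add2r.
  apply: leq_trans IH _; apply: dimvS; apply/subvP => u uF.
  rewrite memv_cap (subvP (FF1 _) _ uF) memv_ker; apply/eqP.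
  by apply/(fus_gr_ker M); [apply/FP; apply: subvP (FF1 _) _ uF|apply/FP].
have -> : (\prod_i a i = \dim {:tensor C a})%N.
  rewrite dimvf [RHS](muln1 #|{dffun forall i : 'I_n, 'I_(a i)}|).
  have -> : #|{dffun forall i : 'I_n, 'I_(a i)}| = foldr muln 1%N [seq #|'I_(a i)| | i : 'I_n].
    exact: card_dep_ffun.
  by rewrite foldrE big_image; apply: eq_bigr => i _; rewrite card_ord.
apply: leq_trans (dimvS (subv_trans SNf (SN N N.+1 (leqnSn N)))) _.
apply: leq_trans (leq_trans (dimv_leq_sum _ _ _) (dimS N)) _.
exact: dimvS (subvf _).
Qed.

(** By [filtration_espan] such a form kills F_(s - 1), so it descends to F_s / F_(s - 1); it is
    extended by 0 to the other graded pieces. *)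
Lemma fus_dual (l : 'Hom(T, C^o)) s :
  (forall t, all (gtn n) t -> (sumn t < s)%N -> l (eword a z t) = 0) ->
  exists l' : 'Hom(fus_mod M, C^o), forall r u, F r u ->
    l' (gr r u) = if r == s then l u else 0.
Proof.
move=> ls.
have lF s' u : (s' < s)%N -> F s' u -> l u = 0.
  move=> s's /(filtration_espan zi) us; elim: us => [|c t u' ts tn _ IH].
    by rewrite linear0.
  by rewrite linearP /= ls ?IH ?scaler0 ?addr0 // (leq_ltn_trans ts).
(* The graph of the form sought, built from decompositions of [m] into graded pieces;
   [fus_gr_direct] makes it single-valued. *)
pose R m (c : C^o) := exists N (u : nat -> T),
  [/\ (s < N)%N, forall r, F r (u r), m = \sum_(r < N) gr r (u r) & c = l (u s)].
have pad N N' (u : nat -> T) : (N <= N')%N -> (forall r, F r (u r)) ->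
    exists u' : nat -> T, [/\ forall r, F r (u' r), forall r, (r < N)%N -> u' r = u r
      & \sum_(r < N') gr r (u' r) = \sum_(r < N) gr r (u r)].
  move=> NN' uF; exists (fun r => if (r < N)%N then u r else 0); split=> [r|r ->//|].
    by case: ifP => // _; apply: filtration0.
  rewrite (big_ord_widen N' (fun r => gr r (u r)) NN') [RHS]big_mkcond /=.
  by apply: eq_bigr => r _; case: ifP => // _; rewrite linear0.
have Rtot m : exists c, R m c.
  have [N [u [uF mE]]] := fus_gr_span m.
  pose u1 r := oapp u 0 (insub r).
  have u1F r : F r (u1 r).
    rewrite /u1; case: insubP => [i _ <-|_] /=; [exact: uF|exact: filtration0].
  have [u' [u'F _ u'E]] := pad N (maxn N s.+1) u1 (leq_maxl _ _) u1F.
  exists (l (u' s)), (maxn N s.+1), u'; split=> //; first exact: leq_maxr.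
  rewrite u'E mE; apply: eq_bigr => r _; rewrite /u1 insubT //= => rN.
  by congr (gr _ (u _)); apply: val_inj.
have Rlin b m m' c c' : R m c -> R m' c' -> R (b *: m + m') (b *: c + c').
  move=> [N [u [sN uF -> ->]]] [N' [u' [sN' u'F -> ->]]].
  have [w [wF wu wE]] := pad N (maxn N N') u (leq_maxl _ _) uF.
  have [w' [w'F w'u w'E]] := pad N' (maxn N N') u' (leq_maxr _ _) u'F.
  exists (maxn N N'), (fun r => b *: w r + w' r); split.
  - by rewrite leq_max sN.
  - by move=> r; apply: filtration_lin.
  - rewrite -wE -w'E scaler_sumr -big_split; apply: eq_bigr => r _.
    by rewrite linearP.
  - by rewrite linearP /= wu // w'u.
have R0 c : R 0 c -> c = 0.
  move=> [N [u [sN uF /esym sum0 ->]]].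
  have /(_ (Ordinal sN)) /= := @fus_gr_direct _ _ _ _ M N u (fun r => uF r) sum0.
  move/(fus_gr_ker M (uF s)); case: (s) lF (u s) => [|s'] lF us /=; first by move=> ->; rewrite linear0.
  exact: lF.
have Runiq m c c' : R m c -> R m c' -> c = c'.
  move=> mc mc'; apply/eqP; rewrite -subr_eq0; apply/eqP; apply: R0.
  by have := Rlin (-1) _ _ _ _ mc' mc; rewrite !scaleN1r addNr addrC.
have [f fR] := choice Rtot.
have f_lin : linear f by move=> b m m'; apply: Runiq (fR _) (Rlin _ _ _ _ _ (fR m) (fR m')).
pose fL := HB.pack_for {linear fus_mod M -> C^o} f
  (GRing.isLinear.Build C (fus_mod M) C^o _ f f_lin).
exists (linfun fL) => r u uF; rewrite lfunE /=.
apply: Runiq (fR _) _; exists (maxn r s).+1, (fun r' => if r' == r then u else 0); split.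
- by rewrite ltnS leq_maxr.
- by move=> r'; case: eqP => [->|_] //; apply: filtration0.
- have rN : (r < (maxn r s).+1)%N by rewrite ltnS leq_maxl.
  rewrite (bigD1 (Ordinal rN)) //= eqxx big1 ?addr0 // => r' r'r.
  case: eqP => [r'E|_]; last by rewrite linear0.
  by case/eqP: r'r; apply: val_inj.
- by rewrite eq_sym; case: ifP => // _; rewrite linear0.
Qed.

End FusionModule.

(** * Matrix coefficients of exp(sum_j c_j e_j) *)

Section FusionPolynomials.
Variables (C : numFieldType) (n : nat) (a : 'I_n -> nat) (z : 'I_n -> C).
Hypothesis zi : injective z.
Variable M : fusion a z.
Local Notation V := (fus_mod M).
Local Notation dual := ('Hom(V, C^o)).
Local Notation E j := (fus_act M (sl2_e C) j).
Local Notation H j := (fus_act M (sl2_h C) j).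
Local Notation F j := (fus_act M (sl2_f C) j).
Local Notation v0 := (fus_lowest M).
Local Notation xv := (xvar C n).

Definition esum (c : 'I_n -> C) : 'End(V) := \sum_(j < n) c j *: E j.

(** The polynomial c |-> la((sum_j c_j e_j)^k v0). Recursion through [la] avoids extending scalars
    to polynomials. *)
Fixpoint gpow (k : nat) (la : dual) : {mpoly C[n]} :=
  if k is k'.+1 then \sum_(j < n) 'X_j * gpow k' (la \o E j)%VF
  else (la v0 : C)%:MP.

Lemma gpowS k la : gpow k.+1 la = \sum_(j < n) 'X_j * gpow k (la \o E j)%VF.
Proof. by []. Qed.

Lemma gpow_linear k : linear (gpow k).
Proof.
elim: k => [|k IH] b la la' /=.
  by rewrite !lfunE /= lfunE /= mpolyCD mpolyCM mul_mpolyC.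
rewrite scaler_sumr -big_split; apply: eq_bigr => j _ /=.
by rewrite comp_lfunDl -comp_lfunZl IH mulrDr scalerAr.
Qed.

HB.instance Definition _ k := GRing.isLinear.Build C dual {mpoly C[n]} _ (gpow k) (gpow_linear k).

Lemma gpow_meval k la c : (gpow k la).@[c] = la (iter k (esum c) v0).
Proof.
elim: k la => [|k IH] la /=; first by rewrite mevalC.
rewrite /esum sum_lfunE linear_sum raddf_sum; apply: eq_bigr => j _ /=.
by rewrite mevalM mevalXU IH lfunE /= scale_lfunE linearZ.
Qed.

Lemma E_comm i j : (E i \o E j)%VF = (E j \o E i)%VF.
Proof.
apply/lfunP => m; rewrite !lfunE /= (fus_act_bracket _ _ _ (@bracket_ee C)).
by rewrite scale0r addr0.
Qed.

Lemma gpow_deriv k la i : (gpow k.+1 la)^`M(i) = gpow k (la \o E i)%VF *+ k.+1.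
Proof.
elim: k la => [|k IH] la.
  rewrite /= linear_sum (bigD1 i) //= big1 => [|j ji].
    rewrite mulrC mul_mpolyC mderivZ mderivX mnm1E eqxx scale1r addr0.
    have -> : (U_(i) - U_(i))%MM = 0%MM :> 'X_{1..n}.
      by apply/mnmP => i'; rewrite mnmBE mnm0E subnn.
    by rewrite mpolyX0 -alg_mpolyC mulr1n.
  rewrite mulrC mul_mpolyC mderivZ mderivX mnm1E (negbTE ji) scale0r scaler0 //.
rewrite gpowS linear_sum.
under eq_bigr => j _ do rewrite /= mderivM -gpowS IH.
rewrite big_split /= (bigD1 i) //= [X in _ + X + _]big1 => [|j ji]; last first.
  by rewrite mderivX mnm1E (negbTE ji) scale0r mul0r.
rewrite addr0 mderivX mnm1E eqxx scale1r.
have -> : (U_(i) - U_(i))%MM = 0%MM :> 'X_{1..n}.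
  by apply/mnmP => i'; rewrite mnmBE mnm0E subnn.
rewrite mpolyX0 mul1r [RHS]mulrS; congr (_ + _).
under eq_bigr => j _ do rewrite -comp_lfunA E_comm comp_lfunA mulrnAr.
by rewrite sumrMnl.
Qed.

Definition nbound : nat := (\sum_i a i).+1.

Lemma esum_nilp c m : iter nbound (esum c) m = 0.
Proof.
apply: (fus_nilp _ _ (@raises_e C n a)) => k; rewrite ltnS.
by apply: leq_sum => i _; apply: ltnW.
Qed.

Lemma gpow_nbound la : gpow nbound la = 0.
Proof. by apply: mpoly_eq0_meval => c; rewrite gpow_meval esum_nilp linear0. Qed.

Definition gpoly (la : dual) : {mpoly C[n]} :=
  \sum_(k < nbound) (k`!%:R)^-1 *: gpow k la.

Lemma gpoly_linear : linear gpoly.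
Proof.
move=> b la la'; rewrite /gpoly scaler_sumr -big_split; apply: eq_bigr => k _ /=.
by rewrite linearP scalerDr scalerA mulrC -scalerA.
Qed.

HB.instance Definition _ := GRing.isLinear.Build C dual {mpoly C[n]} _ gpoly gpoly_linear.

(** As the e_j commute, differentiating the exponential in c_i multiplies it by e_i. *)
Lemma gpoly_deriv la i : (gpoly la)^`M(i) = gpoly (la \o E i)%VF.
Proof.
rewrite /gpoly linear_sum big_ord_recl [in RHS]big_ord_recr /=.
rewrite linearZ /= mderivC scaler0 add0r.
(* The right-hand sum has one more term; it vanishes, being up to a factor the derivative of
   [gpow nbound la = 0]. *)
have -> : gpow (\sum_i a i) (la \o E i)%VF = 0.
  have := gpow_deriv (\sum_i a i) la i; rewrite gpow_nbound linear0 => /esym/eqP.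
  by rewrite -scaler_nat scaler_eq0 pnatr_eq0 /= => /eqP.
rewrite scaler0 addr0; apply: eq_bigr => k _; rewrite mderivZ -gpowS gpow_deriv.
rewrite -scaler_nat scalerA; congr (_ *: _).
by rewrite /bump /= add1n factS natrM invfM mulrAC mulVf ?mul1r // pnatr_eq0.
Qed.

(** The truncations of the exponential at [nbound] and at the dimension agree, since the terms are 0
    from the smaller of the two on. *)
Lemma gpoly_meval la c : (gpoly la).@[c] = la (nilp_exp (esum c) v0).
Proof.
pose G k := (k`!%:R)^-1 *: iter k (esum c) v0.
have Gz k : (minn nbound (\dim {:V}) <= k)%N -> G k = 0.
  move=> mk; rewrite /G (_ : iter k _ _ = 0) ?scaler0 //.
  have it0 m : (m <= k)%N -> iter m (esum c) v0 = 0 -> iter k (esum c) v0 = 0.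
    move=> mk' h; rewrite -(subnK mk') iterD h.
    by elim: (k - m)%N => //= j ->; rewrite linear0.
  move: mk; rewrite geq_min => /orP[/it0|/it0]; apply; first exact: esum_nilp.
  exact: nilp_iter_dim (esum_nilp c) _.
have Gs m : (minn nbound (\dim {:V}) <= m)%N ->
    \sum_(k < m) G k = \sum_(k < minn nbound (\dim {:V})) G k.
  move=> mm; rewrite [RHS](big_ord_widen m G mm) [RHS]big_mkcond /=.
  by apply: eq_bigr => k _; case: ltnP => // /Gz.
rewrite /nilp_exp (Gs _ (geq_minr _ _)) -(Gs _ (geq_minl _ _)) linear_sum raddf_sum.
by apply: eq_bigr => k _ /=; rewrite mevalZ gpow_meval linearZ.
Qed.

Lemma gpoly_meval0 la : (gpoly la).@[fun=> 0] = la v0.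
Proof.
rewrite /gpoly big_ord_recl /= fact0 invr1 scale1r mevalD mevalC raddf_sum big1 ?addr0 // => k _.
rewrite /= mevalZ -gpowS gpow_meval iterS.
by rewrite /esum sum_lfunE [X in la X]big1 ?linear0 ?mulr0 // => j _; rewrite scale_lfunE scale0r.
Qed.

Lemma gpoly_mderivs la t : (mderivs t (gpoly la)).@[fun=> 0] =
  la (foldr (fun j m => E j m) v0 (map val t)).
Proof.
elim: t la => [|j t IH] la; first exact: gpoly_meval0.
by rewrite [mderivs _ _]/(mderivs t (gpoly la)^`M(j)) gpoly_deriv IH lfunE.
Qed.

(* Identities between matrix coefficients of exp(sum_j c_j e_j) are proved by     *)
(* checking that both sides satisfy the differential system d_i R_la = R_(la e_i) *)
(* with the same value at 0.                                                      *)
Lemma horizontal_eq0 (R : dual -> {mpoly C[n]}) :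
  (forall la i, (R la)^`M(i) = R (la \o E i)%VF) -> (forall la, (R la).@[fun=> 0] = 0) ->
  forall la, R la = 0.
Proof.
move=> RD R0 la; apply: mpoly_eq0_mderivs => t; elim: t la => [|j t IH] la; first exact: R0.
by rewrite [mderivs _ _]/(mderivs t (R la)^`M(j)) RD IH.
Qed.

Lemma xvar_ord (i : 'I_n) : xv i = 'X_i.
Proof. by rewrite /xvar valK. Qed.

Lemma xvar_out m : (n <= m)%N -> xv m = 0.
Proof. by move=> nm; rewrite /xvar insubN // -leqNgt. Qed.

Lemma xvar_deriv m (i : 'I_n) : (xv m)^`M(i) = (m == i :> nat)%:R.
Proof.
have [mn|nm] := ltnP m n; last first.
  by rewrite xvar_out // linear0 gtn_eqF // (leq_trans (ltn_ord i)).
rewrite -[m]/(val (Ordinal mn)) xvar_ord mderivX mnm1E -val_eqE /=.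
case: eqP => [mi|_]; last by rewrite scale0r.
rewrite scale1r (_ : (U_(_) - U_(_))%MM = 0%MM) ?mpolyX0 //.
by apply/mnmP => i'; rewrite mnmBE mnm0E !mnm1E -!val_eqE /= mi subnn.
Qed.

Lemma toep_deriv l k (i : 'I_n) : (toep xv l k)^`M(i) = (l == k + i)%N%:R.
Proof.
rewrite /toep; case: leqP => kl; last first.
  by rewrite linear0 ltn_eqF // (leq_trans kl) // leq_addr.
by rewrite xvar_deriv -(eqn_add2l k) subnKC.
Qed.

Lemma xvar_meval0 m : (xv m).@[fun=> 0] = 0.
Proof. by rewrite /xvar; case: insub => [i|] /=; rewrite ?mevalXU ?meval0. Qed.

Lemma toep_meval0 l k : (toep xv l k).@[fun=> 0] = 0.
Proof. by rewrite /toep; case: ifP => _; rewrite ?xvar_meval0 ?meval0. Qed.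

Lemma gpoly_E_sum la k : \sum_(m < n) (m == k :> nat)%:R * gpoly (la \o E m)%VF = gpoly (la \o E k)%VF.
Proof.
have [kn|nk] := ltnP k n.
  rewrite (bigD1 (Ordinal kn)) //= eqxx mul1r big1 ?addr0 // => m mk.
  by case: eqP => [mk'|_]; [case/eqP: mk; apply: val_inj|rewrite mul0r].
have -> : (la \o E k)%VF = 0.
  by apply/lfunP => m; rewrite !lfunE /= (fus_act_high zi) ?linear0.
rewrite linear0 big1 // => m _.
by rewrite ltn_eqF ?mul0r // (leq_trans (ltn_ord m)).
Qed.

Let wt : C := \sum_i (a i).-1%:R.

(** With E = sum_m c_m e_m, this is exp(-E) h_k exp(E) = h_k + 2 sum_m c_m e_(m + k) applied to the
    lowest weight vector. *)
Lemma gpoly_h la k : gpoly (la \o H k)%VF =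
  - ((k == 0)%N%:R * wt) *: gpoly la + (\sum_(m < n) toep xv m k * gpoly (la \o E m)%VF) *+ 2.
Proof.
pose R la := gpoly (la \o H k)%VF - (- ((k == 0)%N%:R * wt) *: gpoly la +
   (\sum_(m < n) toep xv m k * gpoly (la \o E m)%VF) *+ 2).
apply/eqP; rewrite -subr_eq0; apply/eqP; rewrite -/(R la); apply: horizontal_eq0 => {}la.
  move=> i; rewrite /R mderivB mderivD mderivZ mderivMn !gpoly_deriv mderiv_sum /=.
  have -> : ((la \o H k) \o E i = (la \o E i) \o H k + 2%:R *: (la \o E (k + i)))%VF.
    apply/lfunP => m; rewrite !lfunE /= !lfunE /= !lfunE /= (fus_act_bracket _ _ _ (@bracket_he C)).
    by rewrite linearD linearZ.
  under eq_bigr => m _ do rewrite mderivM toep_deriv gpoly_deriv -comp_lfunA E_comm comp_lfunA.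
  rewrite big_split /= gpoly_E_sum linearD linearZ /= scaler_nat mulrnDl; ring.
rewrite /R mevalB mevalD mevalZ mevalMn !gpoly_meval0 lfunE /= fus_h_lowest linearZ /=.
rewrite meval_sum [X in X *+ 2]big1 => [|m _]; last first.
  by rewrite mevalM toep_meval0 mul0r.
by rewrite mul0rn addr0 mulrN; exact: subrr.
Qed.

(** The coefficient of t^(m - j) in c(t)^2, and 0 for m < j. *)
Definition sqcoef (j m : nat) : {mpoly C[n]} := \sum_(p < n) xv p * toep xv m (j + p).

Lemma sqcoef_deriv j (m : 'I_n) (i : 'I_n) : (sqcoef j m)^`M(i) = toep xv m (j + i) *+ 2.
Proof.
rewrite /sqcoef linear_sum.
under eq_bigr => p _ do rewrite /= mderivM xvar_deriv toep_deriv.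
rewrite big_split /= (bigD1 i) //= eqxx mul1r big1 ?addr0 => [|p pi]; last first.
  by case: eqP => [pi'|_]; [case/eqP: pi; apply: val_inj|rewrite mul0r].
rewrite mulr2n; congr (_ + _).
rewrite [in RHS]/toep; case: leqP => jim; last first.
  rewrite big1 // => p _; case: eqP => [mE|_]; rewrite ?mulr0 //.
  by move: jim; rewrite mE addnAC ltnNge leq_addr.
have mn : (m - (j + i) < n)%N by apply: leq_ltn_trans (leq_subr _ _) (ltn_ord m).
rewrite (bigD1 (Ordinal mn)) //= addnAC subnKC // eqxx mulr1 big1 ?addr0 // => p pm.
case: eqP => [mE|_]; rewrite ?mulr0 //.
by case/eqP: pm; apply: val_inj => /=; rewrite mE addnAC addKn.
Qed.

(** Here exp(-E) f_j exp(E) = f_j - sum_m c_m h_(j + m) - sum_(p, m) c_p c_m e_(j + p + m); on the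
    lowest weight vector f_j gives 0, and only h_0 contributes among the h. By [gpoly_deriv] this is
    the tangency required by [Tf]. *)
Lemma gpoly_f la j : gpoly (la \o F j)%VF =
  ((j == 0)%N%:R * wt) *: (xv 0 * gpoly la) - \sum_(m < n) sqcoef j m * gpoly (la \o E m)%VF.
Proof.
pose R la := gpoly (la \o F j)%VF - (((j == 0)%N%:R * wt) *: (xv 0 * gpoly la) -
  \sum_(m < n) sqcoef j m * gpoly (la \o E m)%VF).
apply/eqP; rewrite -subr_eq0; apply/eqP; rewrite -/(R la); apply: horizontal_eq0 => {}la.
  move=> i; rewrite /R !mderivB mderivZ mderivM xvar_deriv !gpoly_deriv mderiv_sum /=.
  have -> : ((la \o F j) \o E i = (la \o E i) \o F j + (- 1) *: (la \o H (j + i)))%VF.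
    apply/lfunP => m; rewrite !lfunE /= !lfunE /= !lfunE /= (fus_act_bracket _ _ _ (@bracket_fe C)).
    by rewrite linearD linearZ.
  under eq_bigr => m _ do rewrite mderivM sqcoef_deriv gpoly_deriv -comp_lfunA E_comm comp_lfunA mulrnAl.
  rewrite big_split /= sumrMnl linearD linearZ /= gpoly_h addn_eq0 scaleN1r.
  rewrite -mulnb natrM [0%N == _]eq_sym -!mul_mpolyC !mpolyCN !mpolyCM !mpolyC_nat.
  by ring.
rewrite /R !mevalB mevalZ mevalM !gpoly_meval0 lfunE /= fus_f_lowest linear0 xvar_meval0 mul0r mulr0.
rewrite meval_sum big1 ?subr0 // => m _.
rewrite mevalM /sqcoef meval_sum big1 ?mul0r // => p _.
by rewrite mevalM xvar_meval0 mul0r.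
Qed.

End FusionPolynomials.

(** * The open cell and the coordinate space *)

Section OrbitClosure.
Variables (C : numFieldType) (n : nat) (a : 'I_n -> nat) (z : 'I_n -> C).
Hypothesis zi : injective z.
Variable M : fusion a z.
Local Notation V := (fus_mod M).
Local Notation dual := ('Hom(V, C^o)).
Local Notation E j := (fus_act M (sl2_e C) j).
Local Notation F j := (fus_act M (sl2_f C) j).
Local Notation v0 := (fus_lowest M).

Definition coordf (l : 'I_(\dim {:V})) : dual := linfun (coord (vbasis {:V}) l : V -> C^o).

Lemma coordfE l v : coordf l v = coords v l.
Proof. by rewrite /coordf lfunE. Qed.

Definition fpol (l : 'I_(\dim {:V})) : {mpoly C[n]} := gpoly (coordf l).

Lemma fpol_meval c l : (fpol l).@[c] = coords (nilp_exp (esum M c) v0) l.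
Proof. by rewrite /fpol gpoly_meval coordfE. Qed.

Lemma lfmx_fpol (T : 'End(V)) i : \sum_l lfmx T i l *: fpol l = gpoly (coordf i \o T)%VF.
Proof.
have -> : (coordf i \o T)%VF = \sum_l lfmx T i l *: coordf l.
  apply/lfunP => w; rewrite !lfunE /= -/(coords _ _) coordfE coords_lfmx sum_lfunE.
  by apply: eq_bigr => l _; rewrite scale_lfunE coordfE.
by rewrite linear_sum; apply: eq_bigr => l _; rewrite linearZ.
Qed.

Lemma current_gpoly la x (p : truncpoly C n) :
  gpoly (la \o current_act M x p)%VF =
  \sum_(j < n) (p : {poly C})`_j *: gpoly (la \o fus_act M x j)%VF.
Proof.
have -> : (la \o current_act M x p)%VF =
    \sum_(j < n) (p : {poly C})`_j *: (la \o fus_act M x j)%VF.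
  apply/lfunP => w; rewrite lfunE /= /current_act !sum_lfunE linear_sum.
  by apply: eq_bigr => j _; rewrite !scale_lfunE lfunE linearZ.
by rewrite linear_sum; apply: eq_bigr => j _; rewrite linearZ.
Qed.

Lemma current_e_nilp p w : iter (\dim {:V}) (current_act M (sl2_e C) p) w = 0.
Proof.
apply: (@nilp_iter_dim _ _ _ (nbound a)) => v; apply: (fus_nilp _ _ (@raises_e C n a)) => k.
by rewrite ltnS; apply: leq_sum => i _; apply: ltnW.
Qed.

Lemma current_f_nilp p w : iter (\dim {:V}) (current_act M (sl2_f C) p) w = 0.
Proof.
apply: (@nilp_iter_dim _ _ _ (nbound a)) => v; apply: (fus_nilp _ _ (@raises_f C n a)) => k.
by rewrite ltnS; apply: leq_sum => i _; apply: leq_subr.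
Qed.

Lemma in_cone_SL2 g v w : SL2_act g v w -> in_cone fpol v -> in_cone fpol w.
Proof.
move=> gvw cv; elim: gvw cv => {g v w} [//|p g v w _ IH|p g v w _ IH] /IH cw.
  apply: (@in_cone_exp _ _ _ _ _ 0 (fun m => ((p : {poly C})`_m)%:MP)) cw => [u|i].
    exact: current_e_nilp.
  rewrite lfmx_fpol current_gpoly mul0r add0r; apply: eq_bigr => j _.
  by rewrite mul_mpolyC /fpol gpoly_deriv.
apply: (@in_cone_exp _ _ _ _ _
  (\sum_(j < n) (p : {poly C})`_j *: (((j == 0 :> nat)%:R * \sum_i (a i).-1%:R) *: xvar C n 0))
  (fun m => - \sum_(j < n) (p : {poly C})`_j *: sqcoef C n j m)) cw => [u|i].
  exact: current_f_nilp.
rewrite lfmx_fpol current_gpoly mulr_suml.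
under eq_bigr => j _ do rewrite (gpoly_f zi) scalerBr.
rewrite sumrB; congr (_ + _).
  by apply: eq_bigr => j _; rewrite -!scalerAl.
transitivity (- \sum_(m < n) \sum_(j < n)
    (p : {poly C})`_j *: (sqcoef C n j m * gpoly (coordf i \o E m)%VF)).
  congr (- _); under eq_bigr => j _ do rewrite scaler_sumr.
  by rewrite exchange_big.
rewrite -sumrN; apply: eq_bigr => m _; rewrite mulNr mulr_suml; congr (- _).
by apply: eq_bigr => j _; rewrite /fpol gpoly_deriv scalerAl.
Qed.

Hypothesis a_gt0 : forall i, (0 < a i)%N.

Lemma fus_lowest_neq0 : v0 != 0.
Proof.
apply/eqP => /(fus_gr_ker M (filtration_lowest a z)) /= /ffunP.
pose k : {dffun forall i : 'I_n, 'I_(a i)} := [ffun i => Ordinal (a_gt0 i)].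
move=> /(_ k); rewrite !ffunE; case: forallP => [_ /eqP|[]]; last by move=> i; rewrite ffunE.
by rewrite oner_eq0.
Qed.

(** If exp(T) v = 0 and T^(j + 1) v = 0, applying T^j leaves T^j v = 0; descending from the
    dimension one reaches v = 0. *)
Lemma nilp_exp_neq0 (T : 'End(V)) v : (forall w, iter (\dim {:V}) T w = 0) ->
  v != 0 -> nilp_exp T v != 0.
Proof.
move=> Tn; apply: contra => /eqP e0.
suff it k : (k <= \dim {:V})%N -> iter (\dim {:V} - k) T v = 0.
  by have := it _ (leqnn _); rewrite subnn => /eqP.
elim: k => [_|k IH kN]; first by rewrite subn0.
have {}IH := IH (ltnW kN).
set j := (\dim {:V} - k.+1)%N.
have jS : (j.+1 = \dim {:V} - k)%N by rewrite /j; lia.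
have jz i : (0 < i)%N -> iter (j + i) T v = 0.
  move=> i0; rewrite -(prednK i0) addnS -addSn jS addnC iterD IH.
  by elim: (i.-1) => //= i' ->; rewrite linear0.
have itl i : linear (iter i T).
  by elim: i => [|i IHi] b u u' //=; rewrite IHi linearP.
have : iter j T (nilp_exp T v) = 0.
  by rewrite e0; elim: (j) => //= i ->; rewrite linear0.
have itsum (I : Type) (r : seq I) (G : I -> V) : iter j T (\sum_(i <- r) G i) = \sum_(i <- r) iter j T (G i).
  elim: r => [|i r IHr]; first by rewrite !big_nil; elim: (j) => //= i ->; rewrite linear0.
  by have := itl j 1 (G i) (\sum_(i <- r) G i); rewrite !big_cons -IHr !scale1r.
have itZ b u : iter j T (b *: u) = b *: iter j T u.
  by elim: (j) => //= i ->; rewrite linearZ.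
rewrite /nilp_exp itsum.
have N0 : (0 < \dim {:V})%N by apply: leq_ltn_trans kN.
rewrite (bigD1 (Ordinal N0)) //= big1 ?addr0 => [|i i0].
  by rewrite fact0 invr1 scale1r.
rewrite itZ -iterD jz ?scaler0 // lt0n; apply: contra i0 => /eqP i0.
by apply/eqP/val_inj.
Qed.

Lemma truncpoly_of (c : 'I_n -> C) : exists p : truncpoly C n,
  current_act M (sl2_e C) p = esum M c.
Proof.
exists (in_qpoly 'X^n (\poly_(j < n) oapp c 0 (insub j))).
apply: eq_bigr => j _; congr (_ *: _).
rewrite in_qpoly_small; first by rewrite coef_poly ltn_ord valK.
rewrite mk_monic_Xn size_polyXn ltnS; apply: leq_trans (size_poly _ _) _.
by case: (n).
Qed.

(** The orbit contains the lines of all exp(sum_j c_j e_j) v0, and by [in_cone_SL2] it stays in the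
    closed cone that they generate. *)
Lemma orbit_vanish d (p : {mpoly C[\dim {:V}]}) : p \is d.-homog ->
  ((forall L, lowest_orbit (M := M) L -> vanishes_at p L) <-> msubst fpol p = 0).
Proof.
move=> ph; split=> [van|p0 L [g [w [_ gw Lw]]]].
  apply: mpoly_eq0_meval => c; rewrite meval_msubst.
  rewrite (_ : (fun i => _) = coords (nilp_exp (esum M c) v0)); last first.
    by apply/funext => i; apply: fpol_meval.
  have [q qE] := truncpoly_of c.
  have w0 : nilp_exp (esum M c) v0 != 0.
    by apply: nilp_exp_neq0 fus_lowest_neq0; rewrite -qE; apply: current_e_nilp.
  have [L Lw] := proj_line w0; apply/(vanishes_line ph Lw)/van.
  exists (upper_unip q *m 1%:M), (nilp_exp (esum M c) v0); split=> //.
    by rewrite det2 !upper_unipE !mxE /= !mul0r !addr0 !mulr0 addr0 mulr1 subr0.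
  by rewrite -qE; apply/SL2_act_e/SL2_act1.
apply/(vanishes_line ph Lw).
apply: (in_cone_SL2 gw _ ph p0) => e q qh q0.
have := meval_msubst fpol q (fun=> 0); rewrite q0 meval0 => h; rewrite [RHS]h.
apply: meval_eq => i; rewrite /fpol gpoly_meval0 ?coordfE //.
Qed.

End OrbitClosure.

Section WeightSpace.
Variables (C : numFieldType) (n : nat) (a : 'I_n -> nat) (z : 'I_n -> C).
Hypothesis zi : injective z.
Hypothesis a_gt0 : forall i, (0 < a i)%N.
Hypothesis a_mono : forall i j : 'I_n, (i <= j)%N -> (a i <= a j)%N.
Variable M : fusion a z.
Local Notation V := (fus_mod M).
Local Notation dual := ('Hom(V, C^o)).
Local Notation xv := (xvar C n).

(** The form [la] is the descent of the form [l] on the tensor product with polynomial [P]; both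
    sides then have the same derivatives at 0. *)
Lemma tprod_gpoly ds : fills (colbins a) ds -> exists la : dual, gpoly la = tprod xv ds.
Proof.
move=> /(@fills_lowest C n z zi a)[s [P [Pl Pz]]].
have [be PE] : exists be, P = \sum_(k : {dffun forall i : 'I_n, 'I_(a i)}) be k *: tensor_exp z k.
  apply: zspan_tensor_exp Pz => i; rewrite count_levels prednK //.
have [l lE] := tensor_realization z be; rewrite -PE in lE.
(* Weights are nonnegative, so a negative [s] means that the product of minors is 0. *)
case: s Pl => s Pl; last first.
  exists 0; rewrite linear0; apply/esym/mpolyP => m; rewrite mcoeff0 Pl.2.
  by case: eqP => // h; exfalso; lia.
have ordlift t : all (gtn n) t -> exists t' : seq 'I_n, t = map val t'.
  elim: t => [|j t IH] /=; first by exists [::].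
  by move=> /andP[jn /IH[t' ->]]; exists (Ordinal (jn : (j < n)%N) :: t').
have [|la laE] := fus_dual zi M (l := l) (s := s).
  move=> t /ordlift[t' ->] ts; rewrite -lE.
  by apply: (lowest_part_mderivs t' Pl).1; rewrite ltz_nat.
exists la; apply/eqP; rewrite -subr_eq0; apply/eqP; apply: mpoly_eq0_mderivs => t.
rewrite linearB mevalB gpoly_mderivs fus_word laE; last exact: filtration_eword.
by rewrite (lowest_part_mderivs t Pl).2 eqz_nat lE subrr.
Qed.

Lemma tprod_meval J ds (c : nat -> C) : all (leq^~ n) J -> fills J ds ->
  (tprod xv ds).@[fun i : 'I_n => c i] = tprod c ds.
Proof.
move=> + dsJ; rewrite -[LHS]/(meval _ _) (tprod_rmorph (meval (fun i : 'I_n => c i))).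
elim: J ds dsJ => [|j J IH] [|d ds] //=; first by rewrite /tprod !big_nil.
move=> [[dr dc] dsJ] /andP[jn Jn].
rewrite /tprod !big_cons; congr (_ * _); last exact: IH.
congr (\det _); apply/matrixP => p q; rewrite !mxE /toep; case: ifP => // _ /=.
have h : (md_row p - md_col q < n)%N.
  by apply: leq_ltn_trans (leq_subr _ _) (leq_trans (dr p) jn).
by rewrite -[(_ - _)%N]/(val (Ordinal h)) xvar_ord mevalXU.
Qed.

(** The prod_i a_i independent products come from independent forms, and the dual space has at most
    this dimension, so these forms are a basis of it. *)
Lemma gpoly_tprod (la : dual) : exists D (u : 'I_D -> seq mdata) (be : 'I_D -> C),
  (forall i, fills (colbins a) (u i)) /\ gpoly la = \sum_i be i *: tprod xv (u i).
Proof.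
have [u uP ui] := @has_indep_fills C n _ (colbins_sorted a) (colbins_leq a).
move: u uP ui; rewrite (colprod_colbins a_gt0 a_mono); set D := (\prod_i a i)%N => u uP ui.
have /choice[la_ laE] i : exists l : dual, gpoly l = tprod xv (u i) by apply: tprod_gpoly.
pose X := [tuple la_ i | i < D].
have Xf : free X.
  apply/freeP => k k0 i; apply: ui => c.
  have h : (gpoly (\sum_(i < D) k i *: X`_i)).@[fun i : 'I_n => c i] = 0.
    by rewrite k0 linear0 meval0.
  rewrite -[RHS]h [gpoly _]linear_sum.
  rewrite meval_sum; apply: eq_bigr => j _; rewrite linearZ /= (nth_map j) ?size_enum_ord //.
  by rewrite nth_ord_enum laE mevalZ (tprod_meval _ (colbins_leq a) (uP j)).
have Xfull : <<X>>%VS = fullv.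
  apply/eqP; rewrite eqEdim subvf /= (eqP Xf) size_tuple.
  rewrite dimvf; apply: leq_trans (dim_fusion M).
  by rewrite dimvf -[X in (_ <= X)%N]muln1; apply: leqnn.
exists D, u, (fun i => coord X i la); split=> //.
rewrite {1}(coord_span (_ : la \in <<X>>%VS)) ?Xfull ?memvf // linear_sum.
apply: eq_bigr => i _; rewrite linearZ /= (nth_map i) ?size_enum_ord //.
by rewrite nth_ord_enum laE.
Qed.

End WeightSpace.

(** * Comparison of two Schubert varieties *)

Section ProductSpan.
Variables (C : numFieldType) (n : nat).
Local Notation xv := (xvar C n).

Inductive pspan (J : seq nat) : {mpoly C[n]} -> Prop :=
| pspan0 : pspan J 0
| pspanS c ds p : fills J ds -> pspan J p -> pspan J (c *: tprod xv ds + p).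

Lemma pspanD J p q : pspan J p -> pspan J q -> pspan J (p + q).
Proof.
move=> + qJ; elim=> [|c ds p' dsJ _ IH]; first by rewrite add0r.
by rewrite -addrA; apply: pspanS.
Qed.

Lemma pspanZ J c p : pspan J p -> pspan J (c *: p).
Proof.
elim=> [|c' ds p' dsJ _ IH]; first by rewrite scaler0; apply: pspan0.
by rewrite scalerDr scalerA; apply: pspanS.
Qed.

Lemma pspan_fills J ds : fills J ds -> pspan J (tprod xv ds).
Proof.
by move=> dsJ; rewrite -[tprod _ _]scale1r -[_ *: _]addr0; apply: pspanS (pspan0 _).
Qed.

Lemma pspan_sum J (I : Type) (r : seq I) (P : pred I) (F : I -> {mpoly C[n]}) :
  (forall i, P i -> pspan J (F i)) -> pspan J (\sum_(i <- r | P i) F i).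
Proof. by move=> H; elim/big_ind: _ => //; [apply: pspan0|apply: pspanD]. Qed.

Lemma fills_cat J J' ds ds' : fills J ds -> fills J' ds' -> fills (J ++ J') (ds ++ ds').
Proof. by elim: J ds => [|j J IH] [|d ds] //= [dj /IH h] /h. Qed.

Lemma fills_catP J J' ds : fills (J ++ J') ds ->
  exists ds1 ds2, [/\ ds = ds1 ++ ds2, fills J ds1 & fills J' ds2].
Proof.
elim: J ds => [|j J IH] ds /=; first by exists [::], ds.
case: ds => [|d ds] //= [dj /IH[ds1 [ds2 [-> h1 h2]]]].
by exists (d :: ds1), ds2.
Qed.

Lemma tprod_cat ds ds' : tprod xv (ds ++ ds') = tprod xv ds * tprod xv ds'.
Proof. by rewrite /tprod big_cat. Qed.

Lemma pspanM J J' p q : pspan J p -> pspan J' q -> pspan (J ++ J') (p * q).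
Proof.
move=> + qJ; elim=> [|c ds p' dsJ _ IH]; first by rewrite mul0r; apply: pspan0.
rewrite mulrDl -scalerAl; apply: pspanD => //; apply: pspanZ.
elim: qJ => [|c' ds' q' dsJ' _ IH']; first by rewrite mulr0; apply: pspan0.
rewrite mulrDr -scalerAr -tprod_cat; apply: pspanS => //; exact: fills_cat.
Qed.

Lemma pspan_perm J J' p : perm_eq J J' -> pspan J p -> pspan J' p.
Proof.
move=> JJ'; elim=> [|c ds q dsJ _ IH]; first exact: pspan0.
suff [ds' dsJ' <-] : exists2 ds', fills J' ds' & tprod xv ds' = tprod xv ds.
  exact: pspanS.
apply: (@catCA_perm_ind _ (fun J => exists2 ds', fills J ds' & tprod xv ds' = tprod xv ds)
  _ _ _ JJ'); last by exists ds.
move=> J1 J2 J3 [ds' /fills_catP[ds1 [ds23 [-> h1 /fills_catP[ds2 [ds3 [-> h2 h3]]]]]] <-].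
exists (ds2 ++ ds1 ++ ds3); first by apply: fills_cat => //; apply: fills_cat.
by rewrite !tprod_cat mulrCA.
Qed.

End ProductSpan.

(** A level must consist of the last j indices. For j < n the threshold is the value of [b] just
    before them, as [b] is strictly increasing; for j = n level 0 is everything because
    [b i >= 2]. *)
Lemma colbins_mem n (b : 'I_n -> nat) j : (0 < n)%N -> (forall i, 2 <= b i)%N ->
  (forall i j : 'I_n, (i < j)%N -> (b i < b j)%N) -> (j <= n)%N -> j \in colbins b.
Proof.
move=> n0 b2 bmono jn.
have bs (i : 'I_n) : (b i <= \sum_i b i)%N by rewrite (bigD1 i) //= leq_addr.
have lv : exists2 t, (t < \sum_i b i)%N & forall i : 'I_n, (t.+1 < b i)%N = (n - j <= i)%N.
  have [j0|] := posnP (n - j)%N.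
    exists 0%N => [|i]; last by rewrite b2 j0.
    by apply: leq_trans (bs (Ordinal n0)); apply: ltnW.
  move=> nj; have kn : ((n - j).-1 < n)%N by rewrite prednK // leq_subr.
  set k := Ordinal kn; exists (b k).-1 => [|i].
    by apply: leq_trans (bs k); rewrite prednK // (leq_trans _ (b2 k)).
  rewrite prednK; last exact: leq_trans (b2 k).
  have [ik|ki] := leqP i k; last first.
    by rewrite bmono //; apply/esym; move: ki => /=; lia.
  have -> : (n - j <= i)%N = false by apply/negbTE; move: ik => /=; lia.
  apply/negbTE; rewrite -leqNgt; move: ik; rewrite leq_eqVlt => /orP[/eqP ik|/bmono/ltnW //].
  by rewrite (_ : i = k) //; apply: val_inj.
have [t ts tE] := lv; apply/mapP; exists t; first by rewrite mem_rev mem_iota.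
rewrite -sum1_card (eq_bigl (fun i : 'I_n => n - j <= i)%N) => [|i]; last first.
  by rewrite in_level tE.
rewrite -(big_mkord (fun i => n - j <= i)%N (fun=> 1%N)).
rewrite (big_cat_nat (leq0n (n - j))) ?leq_subr //=.
rewrite big_nat_cond big_pred0 ?add0n => [|i]; last by apply/negbTE; lia.
rewrite big_nat_cond (eq_bigl (fun i => (n - j <= i < n)%N && true)) => [|i]; last first.
  by rewrite andbT andbC andbA andbb.
by rewrite -big_nat_cond sum_nat_const_nat subKn // muln1.
Qed.

Lemma perm_complement (T : eqType) (s t : seq T) :
  (forall x, count_mem x s <= count_mem x t)%N -> exists r, perm_eq t (s ++ r).
Proof.
elim: s t => [|x s IH] t st; first by exists t.
have xt : x \in t.
  by rewrite -has_pred1 has_count; apply: leq_trans (st x); rewrite /= eqxx.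
have [y|r rP] := IH (rem x t).
  have := st y; rewrite (seq.permP (perm_to_rem xt)) /=.
  by rewrite leq_add2l.
by exists r; rewrite (perm_trans (perm_to_rem xt)) //= perm_cons.
Qed.

(** * The factorisation of the coordinate spaces and the morphism *)

Section Assembly.
Variables (C : numClosedFieldType) (n : nat) (n_gt0 : (0 < n)%N).
Variables (a b : 'I_n -> nat) (z w : 'I_n -> C).
Hypothesis a_gt0 : forall i, (0 < a i)%N.
Hypothesis a_mono : forall i j : 'I_n, (i <= j)%N -> (a i <= a j)%N.
Hypothesis b_ge2 : forall i, (2 <= b i)%N.
Hypothesis b_mono : forall i j : 'I_n, (i < j)%N -> (b i < b j)%N.
Hypotheses (zi : injective z) (wi : injective w).
Variables (MA : fusion a z) (MB : fusion b w).

Let f := @fpol C n b w MB.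
Let h := @fpol C n a z MA.
Let d := (\sum_i a i)%N.

Let b_gt0 i : (0 < b i)%N.
Proof. exact: leq_trans (b_ge2 i). Qed.

Let b_mono' (i j : 'I_n) : (i <= j)%N -> (b i <= b j)%N.
Proof.
rewrite leq_eqVlt => /orP[/eqP ij|/b_mono/ltnW //].
by rewrite (_ : i = j) //; apply: val_inj.
Qed.

Lemma gpoly_pspan (c : 'I_n -> nat) (y : 'I_n -> C) (M : fusion c y) la :
  injective y -> (forall i, 0 < c i)%N -> (forall i j : 'I_n, (i <= j)%N -> (c i <= c j)%N) ->
  pspan (colbins c) (gpoly (M := M) la).
Proof.
move=> yi c0 cm; have [D [u [be [uf ->]]]] := gpoly_tprod yi c0 cm la.
by apply: pspan_sum => i _; apply: pspanZ; apply: pspan_fills.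
Qed.

Lemma gpoly_fpol (c : 'I_n -> nat) (y : 'I_n -> C) (M : fusion c y) la :
  gpoly (M := M) la = \sum_(k < \dim {:fus_mod M}) la (vbasis {:fus_mod M})`_k *: fpol (M := M) k.
Proof.
have {1}-> : la = \sum_(k < \dim {:fus_mod M}) la (vbasis {:fus_mod M})`_k *: coordf (M := M) k.
  apply/lfunP => m; rewrite -{1}(vec_coords m) /vec linear_sum sum_lfunE.
  by apply: eq_bigr => k _; rewrite linearZ scale_lfunE coordfE [RHS]mulrC.
by rewrite linear_sum; apply: eq_bigr => k _; rewrite linearZ.
Qed.

(** Each group of minors filling [colbins b] is a linear form in the coordinates [f], so [k] groups
    give a form of degree [k]. *)
Lemma pspan_flatten_subst k p : pspan (flatten (nseq k (colbins b))) p ->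
  exists2 Q : {mpoly C[\dim {:fus_mod MB}]}, Q \is k.-homog & msubst f Q = p.
Proof.
elim=> [|c ds q dsJ _ [Q Qh <-]]; first by exists 0; rewrite ?dhomog0 ?rmorph0.
suff [R Rh RE] : exists2 R : {mpoly C[\dim {:fus_mod MB}]}, R \is k.-homog & msubst f R = tprod (xvar C n) ds.
  exists (c *: R + Q); first by rewrite rpredD ?rpredZ.
  by rewrite rmorphD /= msubstZ RE.
elim: k ds dsJ {Q Qh} => [|k IH] ds /=.
  case: ds => // _; exists 1; first exact: dhomog1.
  by rewrite rmorph1 /tprod big_nil.
move=> /fills_catP[ds1 [ds2 [-> h1 /IH[R Rh RE]]]].
have [la laE] := tprod_gpoly wi b_gt0 MB h1.
exists ((\sum_(k0 < \dim {:fus_mod MB}) la (vbasis {:fus_mod MB})`_k0 *: 'X_k0) * R).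
  rewrite -add1n; apply: dhomogM => //; apply: rpred_sum => i _; apply: rpredZ.
  exact: dhomogX1.
rewrite rmorphM /= RE tprod_cat -laE gpoly_fpol rmorph_sum; congr (_ * _).
by apply: eq_bigr => i _; rewrite /= msubstZ msubstX.
Qed.

Lemma pspan_cat_split J p : pspan (colbins a ++ J) p ->
  exists2 q : 'I_(\dim {:fus_mod MA}) -> {mpoly C[n]}, forall k, pspan J (q k) &
    p = \sum_k h k * q k.
Proof.
elim=> [|c ds p' dsJ _ [q qJ ->]].
  exists (fun=> 0) => [k|]; first exact: pspan0.
  by rewrite big1 // => k _; rewrite mulr0.
have [ds1 [ds2 [-> h1 h2]]] := fills_catP dsJ.
have [la laE] := tprod_gpoly zi a_gt0 MA h1.
exists (fun k : 'I_(\dim {:fus_mod MA}) => (c * la (vbasis {:fus_mod MA})`_k) *: tprod (xvar C n) ds2 + q k) => [k|].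
  by apply: pspanD => //; apply: pspanZ; apply: pspan_fills.
rewrite tprod_cat -laE gpoly_fpol mulr_suml scaler_sumr -big_split.
apply: eq_bigr => k _ /=; rewrite mulrDr; congr (_ + _).
by rewrite -scalerAl scalerA scalerAr.
Qed.

Lemma schubert_surjection : exists phi : {L | schubert MB L} -> {L | schubert MA L},
  is_morphism phi /\ (forall y, exists x, phi x = y).
Proof.
have d0 : (0 < d)%N.
  by rewrite /d (bigD1 (Ordinal n_gt0)) //= ltn_addr.
(* The list [colbins a] has [d] entries, and each of its sizes occurs in every one of the [d] copies
   of [colbins b]. *)
have [J JP] : exists J, perm_eq (flatten (nseq d (colbins b))) (colbins a ++ J).
  apply: perm_complement => x.
  have [xa|xa] := boolP (x \in colbins a); last by rewrite (count_memPn xa).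
  have xb : x \in colbins b.
    by apply: colbins_mem => //; apply: (allP (colbins_leq a)).
  rewrite count_flatten map_nseq sumn_nseq.
  apply: leq_trans (count_size _ _) _.
  rewrite size_map size_rev size_iota -/d leq_pmull //.
  by rewrite -has_count has_pred1.
have mon (mu : 'X_{1..\dim {:fus_mod MB}}) : mdeg mu = d ->
    pspan (flatten (nseq d (colbins b))) (msubst f 'X_[mu]).
  elim: (d) mu => [|k IH] mu muE.
    have /eqP -> : mu == 0%MM by rewrite -mdeg_eq0 muE.
    have -> : msubst f 'X_[0] = tprod (xvar C n) [::].
      by rewrite mpolyX0 rmorph1 /tprod big_nil.
    exact: pspan_fills.
  have [nu [nu' [-> /eqP]]] : exists nu nu' : 'X_{1..\dim {:fus_mod MB}},
    [/\ mu = (nu + nu')%MM, mdeg nu = 1%N & mdeg nu' = k].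
    by apply: mnm_split; rewrite add1n.
  rewrite mdeg_eq1 => /existsP[i /eqP ->] /IH nuJ.
  rewrite mpolyXD rmorphM /= msubstX; apply: pspanM => //.
  exact: gpoly_pspan.
have /choice[qm qmP] (mu : 'X_{1..(\dim {:fus_mod MB}) < d.+1}) :
    exists q : 'I_(\dim {:fus_mod MA}) -> {mpoly C[n]}, (forall k, pspan J (q k)) /\
      (mdeg mu = d -> msubst f 'X_[mu] = \sum_k h k * q k).
  have [muE|muE] := eqVneq (mdeg mu) d; last first.
    by exists (fun=> 0); split=> [k|/eqP]; [apply: pspan0|rewrite (negbTE muE)].
  have [q qJ qE] := pspan_cat_split (pspan_perm JP (mon _ muE)).
  by exists q.
pose I := ('X_{1..(\dim {:fus_mod MB}) < d.+1} * 'I_(\dim {:fus_mod MA}))%type.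
(* The cofactors of the [h k] in chosen decompositions of the degree [d] monomials in [f]; these
   elements of W' suffice. *)
pose q (l : 'I_#|{: I}|) := let x := enum_val l in qm x.1 x.2.
have /choice[Q_ QP] (kl : 'I_(\dim {:fus_mod MA}) * 'I_#|{: I}|) :
    exists Q : {mpoly C[\dim {:fus_mod MB}]}, Q \is d.-homog /\ msubst f Q = h kl.1 * q kl.2.
  have [|Q Qh QE] := @pspan_flatten_subst d (h kl.1 * q kl.2); last by exists Q.
  have qJ : pspan J (q kl.2) by apply: (qmP _).1.
  rewrite perm_sym in JP; apply: pspan_perm JP _; apply: pspanM => //.
  exact: gpoly_pspan.
have fQ (mu : 'X_{1..\dim {:fus_mod MB}}) : mdeg mu = d ->
    exists be : 'I_(\dim {:fus_mod MA}) -> 'I_#|{: I}| -> C,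
    msubst f 'X_[mu] = \sum_k \sum_l be k l *: (h k * q l).
  move=> muE; have mud : (mdeg mu < d.+1)%N by rewrite muE.
  exists (fun k l => (l == enum_rank (BMultinom mud, k))%:R).
  rewrite [LHS]((qmP (BMultinom mud)).2 muE); apply: eq_bigr => k _.
  rewrite (bigD1 (enum_rank (BMultinom mud, k))) //= eqxx scale1r big1 ?addr0 => [|l /negbTE ->].
    by rewrite /q enum_rankK.
  by rewrite scale0r.
(* Otherwise every [f i ^+ d] would be 0, hence every [f i], whereas the values of the [f i] at 0
   are the coordinates of the lowest weight vector. *)
have q0 : exists l, q l != 0.
  apply: contrapT => nq; have qz l : q l = 0.
    by apply/eqP; apply: contrapT => /negP ?; apply: nq; exists l.
  have := fus_lowest_neq0 MB b_gt0; case/eqP; apply: coords0_eq0 => i; apply/eqP.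
  have dX : mdeg (U_(i) *+ d)%MM = d by rewrite mdegMn mdeg1 mul1n.
  have [be] := fQ _ dX; rewrite big1 => [|k _]; last first.
    by rewrite big1 // => l _; rewrite qz mulr0 scaler0.
  rewrite -mpolyXn rmorphXn /= msubstX => /eqP; rewrite expf_eq0 d0 /= => /eqP fi.
  by rewrite -coordfE -gpoly_meval0 -/(fpol (M := MB) i) -/f fi meval0.
apply: (@closure_surjection C n _ _ _ _ f h _ _ d _ q (fun k l => Q_ (k, l)) d0 q0 _ _ fQ).
- exact: orbit_vanish.
- exact: orbit_vanish.
- by move=> k l; apply: (QP (k, l)).1.
- by move=> k l; apply: (QP (k, l)).2.
Qed.

End Assembly.

(* The variety sh^(n) is the Schubert variety of any b with
   2 <= b_1 < ... < b_n. *)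
Theorem lemma3p8 (R : realType) (n : nat) (hn : (0 < n)%N)
    (a : 'I_n -> nat) (ha0 : forall i, (0 < a i)%N)
    (ha : forall i j : 'I_n, (i <= j)%N -> (a i <= a j)%N)
    (b : 'I_n -> nat) (hb2 : forall i, (2 <= b i)%N)
    (hb : forall i j : 'I_n, (i < j)%N -> (b i < b j)%N)
    (z w : 'I_n -> R[i]) (hz : injective z) (hw : injective w)
    (MA : fusion a z) (MB : fusion b w) :
  exists phi : {L | schubert MB L} -> {L | schubert MA L},
    is_morphism phi /\ (forall y, exists x, phi x = y).
Proof. exact: (@schubert_surjection R[i] n hn a b z w ha0 ha hb2 hb hz hw MA MB). Qed.
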